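(* Let $(M,g)$ be a Lorentzian manifold of dimension $n>3$. Then $(M,g)$ is a Lorentzian Concircular Structure manifold $(LCS)_n$ if and only if it is a Generalized Robertson-Walker (GRW) space-time.
   Context: Conventions: $(M,g)$ is a Lorentzian manifold of dimension $n$ with signature $(-,+,\dots,+)$, and $\nabla$ is its Levi-Civita connection. Indices are lowered and raised with $g$. Generalized Robertson-Walker (GRW) space-time: a Lorentzian manifold that is a warped product $-1\times_{q^2} M^*$, where $(M^*,g^* )$ is an $(n-1)$-dimensional Riemannian submanifold. In other terms, it is a Lorentzian manifold characterised by a metric of the form $$g_{ij}\,dx^i dx^j = -(dt)^2 + q(t)^2\, g^*_{\mu\nu}(x^1,\dots,x^{n-1})\, dx^\mu dx^\nu,$$ where $q$ is the warping function, depending only on $t$, and $g^*$ is the Riemannian metric of $M^*$. Lorentzian Concircular Structure manifold $(LCS)_n$: an $n$-dimensional Lorentzian manifold endowed with a unit time-like vector field $u$, i.e. $u^i u_i=-1$, such that $$\nabla_k u_j = \varphi\,(u_k u_j + g_{kj}),$$ where $\varphi\neq 0$ is a scalar function obeying $$\nabla_j \varphi = \mu\, u_j$$ for some scalar function $\mu$.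
   Formalization: GRW is taken locally (M is covered by product charts with the warped metric, all sharing d/dt, instead of one global product) and the warping function q must be non-constant; φ≠0 means not identically zero. The global claim, or constant q, makes the equivalence false. *)

(* Defs.v *)
From HB Require Import structures.
From mathcomp Require Import all_boot all_order all_algebra.
From mathcomp Require Import all_classical all_reals all_analysis.

Set Implicit Arguments.
Unset Strict Implicit.
Unset Printing Implicit Defensive.

Import Order.TTheory GRing.Theory Num.Theory.
Import numFieldNormedType.Exports.

Local Open Scope classical_set_scope.
Local Open Scope ring_scope.

(* Points of R^n are row vectors.  Manifolds are Hausdorff, second countable, *)
(* C^oo, without boundary, and not assumed connected.  Tensor fields are      *)
(* given, as in the classical index calculus, by their components in every    *)
(* chart of the maximal atlas together with the transformation law; the       *)
(* components in a chart are functions of the coordinates, meaningful on the  *)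
(* image of the chart only.                                                   *)

Section Calculus.
Variables (R : realType) (n : nat).
Implicit Types (f : 'rV[R]_n -> R) (x : 'rV[R]_n) (U : set 'rV[R]_n).

Definition partial (i : 'I_n) f x : R := 'D_(delta_mx 0 i) f x.

Definition iter_partial (s : seq 'I_n) f : 'rV[R]_n -> R := foldr partial f s.

(* C^oo on an open set U *)
Definition smooth_on U f : Prop :=
  forall (s : seq 'I_n) x, U x ->
    {for x, continuous (iter_partial s f)} /\
    (forall i, derivable (iter_partial s f) x (delta_mx 0 i)).

End Calculus.

Section Manifolds.
Variables (R : realType) (n : nat).

(* [cmap] is only relevant on [cdom], and [cinv] on [cimg]. *)
Record chart (M : topologicalType) := Chart {
  cdom : set M;
  cmap : M -> 'rV[R]_n;
  cinv : 'rV[R]_n -> M }.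

Definition cimg (M : topologicalType) (c : chart M) : set 'rV[R]_n :=
  cmap c @` cdom c.

Definition is_chart (M : topologicalType) (c : chart M) : Prop :=
  [/\ open (cdom c), open (cimg c),
      forall p, cdom c p -> cinv c (cmap c p) = p,
      forall p, cdom c p -> {for p, continuous (cmap c)}
    & forall x, cimg c x -> {for x, continuous (cinv c)}].

Definition overlap (M : topologicalType) (c d : chart M) : set 'rV[R]_n :=
  cmap c @` (cdom c `&` cdom d).

Definition transition (M : topologicalType) (c d : chart M) (x : 'rV[R]_n) :
  'rV[R]_n := cmap d (cinv c x).

(* the entry (i, j) is d x'^j / d x^i, for x' the coordinates of the chart d *)
Definition transition_jac (M : topologicalType) (c d : chart M)
    (x : 'rV[R]_n) : 'M[R]_n :=
  \matrix_(i, j) partial i (fun y => transition c d y 0 j) x.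

Definition compatible (M : topologicalType) (c d : chart M) : Prop :=
  forall j, smooth_on (overlap c d) (fun y => transition c d y 0 j) /\
            smooth_on (overlap d c) (fun y => transition d c y 0 j).

Record manifold := Manifold {
  mtop :> topologicalType;
  atlas : set (chart mtop);
  manifold_hausdorff : hausdorff_space mtop;
  manifold_second_countable : @second_countable mtop;
  atlas_chart : forall c, atlas c -> is_chart c;
  atlas_cover : forall p, exists2 c, atlas c & cdom c p;
  atlas_compatible : forall c d, atlas c -> atlas d -> compatible c d;
  atlas_maximal : forall c, is_chart c ->
    (forall d, atlas d -> compatible c d) -> atlas c }.

Definition scalar_field (M : manifold) (f : M -> R) : Prop :=
  forall c, atlas c -> smooth_on (cimg c) (f \o cinv c).

(* [u c x] is the row of contravariant components u^i. *)
Definition vector_field (M : manifold)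
    (u : chart M -> 'rV[R]_n -> 'rV[R]_n) : Prop :=
  (forall c, atlas c ->
     forall i, smooth_on (cimg c) (fun x => u c x 0 i)) /\
  (forall c d, atlas c -> atlas d -> forall x, overlap c d x ->
     u d (transition c d x) = u c x *m transition_jac c d x).

End Manifolds.

Section Lorentzian.
Variables (R : realType) (n : nat).

Definition lorentzian_mx (G : 'M[R]_(1 + n)) : Prop :=
  G^T = G /\
  exists2 P : 'M[R]_(1 + n), P \in unitmx &
    P *m G *m P^T = block_mx (- 1)%:M 0 0 1%:M.

Record lorentz_metric (M : manifold R n.+1) := LorentzMetric {
  metric :> chart R n.+1 M -> 'rV[R]_n.+1 -> 'M[R]_n.+1;
  metric_smooth : forall c, atlas c ->
    forall i j, smooth_on (cimg c) (fun x => metric c x i j);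
  metric_lorentzian : forall c, atlas c ->
    forall x, cimg c x -> lorentzian_mx (metric c x);
  metric_transform : forall c d, atlas c -> atlas d ->
    forall x, overlap c d x ->
      metric c x = transition_jac c d x *m metric d (transition c d x) *m
                   (transition_jac c d x)^T }.

(* Gamma^l_(k j) of the Levi-Civita connection *)
Definition christoffel (G : 'rV[R]_n.+1 -> 'M[R]_n.+1) (x : 'rV[R]_n.+1)
    (l k j : 'I_n.+1) : R :=
  2^-1 * \sum_m invmx (G x) l m *
    (partial k (fun y => G y m j) x + partial j (fun y => G y m k) x
     - partial m (fun y => G y k j) x).

(* nabla_k w_j, for w given by its covariant components *)
Definition nabla (G : 'rV[R]_n.+1 -> 'M[R]_n.+1)
    (w : 'rV[R]_n.+1 -> 'rV[R]_n.+1) (x : 'rV[R]_n.+1) (k j : 'I_n.+1) : R :=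
  partial k (fun y => w y 0 j) x - \sum_l christoffel G x l k j * w x 0 l.

Definition lower (G : 'rV[R]_n.+1 -> 'M[R]_n.+1)
    (v : 'rV[R]_n.+1 -> 'rV[R]_n.+1) (x : 'rV[R]_n.+1) : 'rV[R]_n.+1 :=
  v x *m G x.

(* "phi <> 0" is read as: phi is not the zero function. *)
Definition LCS (M : manifold R n.+1) (g : lorentz_metric M) : Prop :=
  exists (u : chart R n.+1 M -> 'rV[R]_n.+1 -> 'rV[R]_n.+1) (phi mu : M -> R),
  [/\ vector_field u, scalar_field phi, scalar_field mu,
      exists p, phi p != 0 &
      forall c, atlas c -> forall x, cimg c x ->
        let u_ := lower (g c) (u c) in
        [/\ \sum_i u c x 0 i * u_ x 0 i = - 1,
            forall k j, nabla (g c) u_ x k j =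
              phi (cinv c x) * (u_ x 0 k * u_ x 0 j + g c x k j) &
            forall j, partial j (phi \o cinv c) x = mu (cinv c x) * u_ x 0 j]].

(* x^0 and (x^1, ..., x^n) *)
Definition time_coord (x : 'rV[R]_(1 + n)) : R := lsubmx x 0 0.
Definition space_coord (x : 'rV[R]_(1 + n)) : 'rV[R]_n := rsubmx x.

Definition riemannian_on (V : set 'rV[R]_n) (h : 'rV[R]_n -> 'M[R]_n) : Prop :=
  (forall i j, smooth_on V (fun y => h y i j)) /\
  (forall y, V y -> (h y)^T = h y /\
     forall v : 'rV[R]_n, v != 0 -> 0 < (v *m h y *m v^T) 0 0).

(* In the chart c, which maps its domain onto I x V, the metric reads         *)
(* - dt^2 + q(t)^2 h(y)_(a b) dy^a dy^b.                                      *)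
Definition warped_chart (M : manifold R n.+1) (g : lorentz_metric M)
    (c : chart R n.+1 M) (q : R -> R) : Prop :=
  exists (I : set R) (V : set 'rV[R]_n) (h : 'rV[R]_n -> 'M[R]_n),
  [/\ [/\ open I, is_interval I & open V],
      cimg c = [set x | I (time_coord x) /\ V (space_coord x)],
      (forall t, I t -> 0 < q t) /\
      (forall k t, I t -> derivable (derive1n k q) t 1),
      riemannian_on V h &
      forall x, cimg c x ->
        g c x = block_mx (- 1)%:M 0 0
                  ((q (time_coord x)) ^+ 2 *: h (space_coord x))
          :> 'M[R]_(1 + n)].

(* "Characterised by a metric of the form ..." is read in local coordinates:  *)
(* product charts in which g has the warped form cover M.  A single splitting  *)
(* I x M* of the whole of M is not required: it does not follow from the       *)
(* (tensorial) LCS equations, as deleting a point from a warped product shows. *)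
(* As in a warped product, the charts share one vector field d/dt (the first   *)
(* row of the Jacobian is d/dt in the new coordinates); since                  *)
(* dt = - g(d/dt, -), transitions are locally t' = t + const, y' = y'(y).      *)
(* The last clause says that the warping function is not constant, which       *)
(* excludes direct products - dt^2 + g*, where nabla (d/dt) = 0.               *)
Definition GRW (M : manifold R n.+1) (g : lorentz_metric M) : Prop :=
  exists (W : set (chart R n.+1 M)) (q : chart R n.+1 M -> R -> R),
  [/\ W `<=` @atlas R n.+1 M,
      forall p, exists2 c, W c & cdom c p,
      forall c, W c -> warped_chart g c (q c),
      forall c d, W c -> W d -> forall x, overlap c d x ->
        row 0 (transition_jac c d x) = delta_mx 0 0 &
      exists c, W c /\ exists x y, [/\ cimg c x, cimg c y &
        q c (time_coord x) != q c (time_coord y)]].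

End Lorentzian.

(* Main.v *)
Require Import Defs.
From mathcomp Require Import all_boot all_order all_algebra.
From mathcomp Require Import all_classical all_reals all_analysis.
From mathcomp Require Import ring lra.

Set Implicit Arguments.
Unset Strict Implicit.
Unset Printing Implicit Defensive.

Import Order.TTheory GRing.Theory Num.Theory.
Import numFieldNormedType.Exports.

Local Open Scope classical_set_scope.
Local Open Scope ring_scope.

(** Both implications are computations in coordinates (t, y) in which the unit
    field is d/dt = e_0 and the lowered field is - dt.

    From GRW to LCS.  In a warped chart g_(0 j) is constant, so that
    nabla_k u_j = 1/2 d_t g_(k j) for u = d/dt ([nabla_e0]); since
    g_(a b) = q(t)^2 h_(a b)(y), this is (q'/q) (u_k u_j + g_(k j))
    ([warped_nabla]), with phi = q'/q a function of t alone.  The charts share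
    d/dt, so u is a vector field on M; the covariant derivative being a tensor
    ([nabla_transform]), the equation holds in all charts, and comparing one
    spatial entry in two warped charts shows that phi is well defined.  If phi
    were zero, q would be constant ([GRW_LCS]).

    From LCS to GRW.  The right-hand side of the equation for nabla_k u_j is
    symmetric, hence the lowered field is closed ([LCS_closed]) and locally
    equal to - d tau ([poincare]).  As u^i u_i = - 1, tau grows with unit speed
    along the flow of u.  Flowing a point s of a hypersurface transversal to u
    for the time t - tau(s) therefore gives coordinates with u = d/dt and
    tau = t ([adapted_coordinates]); the atlas is maximal, so they form a chart
    of M ([adapted_chart]).  Read backwards, the computation above gives
    d_t g_(a b) = 2 phi g_(a b) ([expansion]), and d phi = mu u makes phi a
    function of t alone.  All the functions t |-> g_(a b)(t, y) thus solve one
    scalar linear equation and are proportional to g_11(t, 0)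
    ([metric_splits]), which is positive because the orthogonal complement of
    a timelike vector is spacelike ([rest_frame_spatial_pos]); so
    q = sqrt g_11(t, 0) and h = g(0, y) / g_11(0, 0).

    The analysis needed (Poincare lemma, smooth flows, inverse function
    theorem) all comes from one existence theorem for ordinary differential
    equations depending continuously on a parameter ([picard_solution]).
    A difference quotient of a solution with respect to a parameter solves a
    linear equation whose coefficients extend continuously to the increment 0,
    by Hadamard's formula ([hadamard]); the solution at increment 0 is then the
    derivative ([quotient_ode]), and induction on the order gives smooth flows
    ([linear_ode_Ck], [smooth_flow]).  Primitives depending on parameters and
    local inverses are read off the flows of auxiliary vector fields
    ([param_prim], [right_inverse]). *)

Local Notation "''e_' i" := (delta_mx 0 i) (at level 8, i at level 2, format "''e_' i").

(** * Limits of matrix-valued functions *)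

Section MxTopology.
Variables (R : realType).

Lemma continuous_mx (T : topologicalType) m n (f : T -> 'M[R]_(m, n)) x :
  (forall i j, {for x, continuous (fun t => f t i j)}) -> {for x, continuous f}.
Proof.
move=> fc A [P fP PA]; rewrite /fmap /=.
have H : \forall t \near x, forall i j, P i j (f t i j).
  by apply: filter_forall => i; apply: filter_forall => j; apply/fc/fP.
by apply: filterS H => t Pt; exact: PA.
Qed.

Lemma continuous_coord (T : topologicalType) m n (f : T -> 'M[R]_(m, n)) x i j :
  {for x, continuous f} -> {for x, continuous (fun t => f t i j)}.
Proof.
move=> fc; apply: (@continuous_comp _ _ _ f (fun M : 'M[R]_(m, n) => M i j)) => //.
exact: coord_continuous.
Qed.

Lemma mx_norm_coord m n (M : 'M[R]_(m, n)) i j : `|M i j| <= `|M|.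
Proof.
by rewrite [leRHS]/Num.Def.normr /= mx_normrE; exact: (le_bigmax _ _ (i, j)).
Qed.

Lemma mx_norm_le m n (M : 'M[R]_(m, n)) e : 0 <= e ->
  (forall i j, `|M i j| <= e) -> `|M| <= e.
Proof.
move=> e0 Me; rewrite [leLHS]/Num.Def.normr /= mx_normrE.
by apply: bigmax_le => // -[i j] _ /=.
Qed.

Lemma mx_norm_lt m n (M : 'M[R]_(m, n)) e : 0 < e ->
  (forall i j, `|M i j| < e) -> `|M| < e.
Proof.
move=> e0 Me; rewrite [ltLHS]/Num.Def.normr /= mx_normrE.
by apply/bigmax_ltP; split => // -[i j] _ /=.
Qed.

Lemma cvg_sumr (T : Type) (F : set_system T) (FF : Filter F) (I : Type)
    (s : seq I) (P : pred I) (f : I -> T -> R) (l : I -> R) :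
  (forall i, P i -> f i @ F --> l i) ->
  (fun t => \sum_(i <- s | P i) f i t) @ F --> \sum_(i <- s | P i) l i.
Proof.
move=> fc; elim: s => [|i s IH].
  rewrite big_nil; have -> : (fun t => \sum_(i <- [::] | P i) f i t) = cst 0.
    by apply/funext => t; rewrite big_nil.
  exact: cvg_cst.
have -> : (fun t => \sum_(j <- i :: s | P j) f j t) =
    (fun t => (if P i then f i t else 0) + \sum_(j <- s | P j) f j t).
  by apply/funext => t; rewrite big_cons; case: ifP => //; rewrite add0r.
have -> : \sum_(j <- i :: s | P j) l j =
    (if P i then l i else 0) + \sum_(j <- s | P j) l j.
  by rewrite big_cons; case: ifP => //; rewrite add0r.
apply: cvgD; [|exact: IH].
by case: ifPn => Pi; [exact: fc|exact: cvg_cst].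
Qed.

Lemma continuous_pair (T U V : topologicalType) (f : T -> U) (g : T -> V) x :
  {for x, continuous f} -> {for x, continuous g} ->
  {for x, continuous (fun t => (f t, g t))}.
Proof. by move=> fc gc; exact: (cvg_pair fc gc). Qed.

Lemma continuous_near_eq (T U : topologicalType) (f g : T -> U) x :
  (\forall t \near x, f t = g t) -> {for x, continuous f} -> {for x, continuous g}.
Proof.
move=> fg fc; have e := nbhs_singleton fg.
change (g @ x --> g x); rewrite -e.
apply: cvg_trans fc; apply: near_eq_cvg.
exact: fg.
Qed.

Section Pointwise.
Variables (T : topologicalType) (V : normedModType R) (x : T).
Implicit Types (f g : T -> V) (s t : T -> R).

Lemma contD f g : {for x, continuous f} -> {for x, continuous g} ->
  {for x, continuous (fun y => f y + g y)}.
Proof. by move=> fc gc; exact: (cvgD fc gc). Qed.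

Lemma contB f g : {for x, continuous f} -> {for x, continuous g} ->
  {for x, continuous (fun y => f y - g y)}.
Proof. by move=> fc gc; exact: (cvgB fc gc). Qed.

Lemma contZ s f : {for x, continuous s} -> {for x, continuous f} ->
  {for x, continuous (fun y => s y *: f y)}.
Proof. by move=> sc fc; exact: (cvgZ sc fc). Qed.

Lemma contM s t : {for x, continuous s} -> {for x, continuous t} ->
  {for x, continuous (fun y => s y * t y)}.
Proof. by move=> sc tc; exact: (cvgM sc tc). Qed.

Lemma contV s : s x != 0 -> {for x, continuous s} ->
  {for x, continuous (fun y => (s y)^-1)}.
Proof. by move=> s0 sc; exact: (cvgV s0 sc). Qed.

Lemma cont_sum (I : Type) (r : seq I) (P : pred I) (F : I -> T -> R) :
  (forall i, P i -> {for x, continuous (F i)}) ->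
  {for x, continuous (fun y => \sum_(i <- r | P i) F i y)}.
Proof. by move=> Fc; exact: (@cvg_sumr T (nbhs x) _ I r P F (fun i => F i x) Fc). Qed.

End Pointwise.

End MxTopology.

(** * Functions of class C^k *)

Section Ck.
Variables (R : realType).

(** The recursive form of C^k on a set: it supports induction on the order,
    which the family of all iterated partial derivatives does not. *)
Fixpoint Ck n (k : nat) (U : set 'rV[R]_n) (f : 'rV[R]_n -> R) : Prop :=
  match k with
  | 0 => forall x, U x -> {for x, continuous f}
  | k'.+1 => (forall x, U x -> {for x, continuous f}) /\
     forall i, (forall x, U x -> derivable f x ('e_ i)) /\ Ck k' U (partial i f)
  end.

Lemma smooth_onP n (U : set 'rV[R]_n) f :
  smooth_on U f <-> forall k, Ck k U f.
Proof.
split=> [sf k|cf s x Ux].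
- have : forall s, smooth_on U (iter_partial s f).
    move=> s s' x Ux; have := sf (s' ++ s) x Ux.
    by rewrite /iter_partial foldr_cat.
  elim: k f {sf} => [|k IH] f sf /=; first by move=> x /(sf [::] [::])[].
  split=> [x Ux|i]; first by have [] := sf [::] [::] x Ux.
  split=> [x Ux|]; first by have [_] := sf [::] [::] x Ux; apply.
  by apply: IH => s; have := sf (rcons s i); rewrite /iter_partial foldr_rcons.
- have : Ck (size s).+1 U f by exact: cf.
  elim/last_ind: s f {cf} => [|s i IH] f.
    by move=> /= [c d]; split=> [|i]; [exact: c|exact: (d i).1].
  rewrite size_rcons /iter_partial foldr_rcons => -[_ /(_ i)[_ /IH]]; exact.
Qed.

Lemma Ck_continuous n k (U : set 'rV[R]_n) f x : Ck k U f -> U x ->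
  {for x, continuous f}.
Proof. by case: k => [|k] /= => [|[]] h Ux; exact: h. Qed.

Lemma Ck_pred n k (U : set 'rV[R]_n) f : Ck k.+1 U f -> Ck k U f.
Proof.
elim: k f => [|k IH] f; first by case.
by move=> [cf df]; split=> // i; have [? ?] := df i; split=> //; exact: IH.
Qed.

Lemma Ck_le n k l (U : set 'rV[R]_n) f : (l <= k)%N -> Ck k U f -> Ck l U f.
Proof.
move=> /subnK <-; elim: (k - l)%N => // d IH; rewrite addSn => /Ck_pred; exact: IH.
Qed.

Lemma Ck_sub n k (U V : set 'rV[R]_n) f : V `<=` U -> Ck k U f -> Ck k V f.
Proof.
move=> VU; elim: k f => [|k IH] f /=; first by move=> h x /VU; exact: h.
move=> [cf df]; split=> [x /VU|i]; first exact: cf.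
by have [h1 h2] := df i; split=> [x /VU|]; [exact: h1|exact: IH].
Qed.

Lemma partial_near n (f g : 'rV[R]_n -> R) x i :
  (\forall y \near x, f y = g y) -> partial i f x = partial i g x.
Proof. exact: near_eq_derive. Qed.

Lemma near_open (T : topologicalType) (U : set T) (P : T -> Prop) x :
  open U -> U x -> (forall y, U y -> P y) -> \forall y \near x, P y.
Proof. by move=> oU Ux UP; apply: filterS UP _; exact: open_nbhs_nbhs. Qed.

Lemma partial_cst_on n (U : set 'rV[R]_n) f a i x : open U -> U x ->
  (forall y, U y -> f y = a) -> partial i f x = 0.
Proof.
move=> oU Ux fa; rewrite (@partial_near _ _ (fun=> a)) ?/partial ?derive_cst//.
exact: near_open oU Ux fa.
Qed.

Lemma Ck_eq n k (U : set 'rV[R]_n) f g : open U -> (forall x, U x -> f x = g x) ->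
  Ck k U f -> Ck k U g.
Proof.
move=> oU; elim: k f g => [|k IH] f g fg /=.
  by move=> cf x Ux; apply: continuous_near_eq (cf x Ux); exact: near_open oU _ _.
move=> [cf df]; split.
  by move=> x Ux; apply: continuous_near_eq (cf x Ux); exact: near_open oU _ _.
move=> i; have [h1 h2] := df i; split=> [x Ux|].
  by apply: near_eq_derivable (h1 x Ux); exact: near_open oU _ _.
apply: IH h2 => x Ux; apply: partial_near; exact: near_open oU _ _.
Qed.

(** The clauses of [Ck] are conditions at points, so any family of sets that
    covers U will do. *)
Lemma Ck_local n k (U : set 'rV[R]_n) f :
  (forall x, U x -> exists2 V : set 'rV[R]_n, V x & Ck k V f) -> Ck k U f.
Proof.
elim: k f => [|k IH] f H /=.
  by move=> x /H[V Vx]; exact.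
split=> [x /H[V Vx [cf _]]|i]; first exact: cf.
split=> [x /H[V Vx [_ df]]|]; first exact: (df i).1.
by apply: IH => x /H[V Vx [_ df]]; exists V => //; exact: (df i).2.
Qed.

Lemma line_is_derive (V W : normedModType R) (f : V -> W) (x v : V) (h : R) :
  derivable f (x + h *: v) v ->
  is_derive h 1 (fun s => f (x + s *: v)) ('D_v f (x + h *: v)).
Proof.
have E : (fun t => t^-1 *: ((f \o shift (x + h *: v)) (t *: v) - f (x + h *: v))) =
   (fun t => t^-1 *: (((fun s => f (x + s *: v)) \o shift h) (t *: (1 : R^o))
      - f (x + h *: v))).
  apply/funext => t /=; congr (_ *: (f _ - _)).
  by rewrite scalerDl -addrCA [_ *: 1]mulr1.
move=> df; apply: DeriveDef.
  by rewrite /derivable -E.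
by rewrite /derive -E.
Qed.

Lemma mvt_line n (f : 'rV[R]_n -> R) (x v : 'rV[R]_n) (h : R) :
  (forall t : R, 0 <= t <= 1 -> derivable f (x + (t * h) *: v) v) ->
  exists2 t : R, 0 <= t <= 1 & f (x + h *: v) - f x = h * 'D_v f (x + (t * h) *: v).
Proof.
move=> df.
have D (t : R) : 0 <= t <= 1 -> is_derive t (1 : R) (fun t => f (x + t *: (h *: v)))
    (h * 'D_v f (x + (t * h) *: v)).
  move=> /df dft.
  have H := line_is_derive dft.
  have H2 : is_derive t (1 : R) ( *%R^~ h : R -> R) h.
    have -> : ( *%R^~ h : R -> R) = h *: (@id R).
      by apply/funext => s; rewrite mulrC.
    have H3 := @is_deriveZ R R R (@id R) h t 1 1 (is_derive_id t 1).
    by apply: is_derive_eq H3 _; rewrite [_ *: _]mulr1.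
  have H4 := @is_derive1_comp R (fun s : R => f (x + s *: v)) ( *%R^~ h : R -> R) t _ _ H H2.
  have -> : (fun t0 : R => f (x + t0 *: (h *: v))) =
     (fun s : R => f (x + s *: v)) \o ( *%R^~ h : R -> R).
    by apply/funext => s /=; rewrite scalerA.
  apply: is_derive_eq H4 _; by rewrite mulrC.
have [|||t t01] := @MVT_segment R (fun t => f (x + t *: (h *: v)))
   (fun t => h * 'D_v f (x + (t * h) *: v)) 0 1.
- exact: ler01.
- by move=> t /[!in_itv]/= /andP[t0 t1]; apply: D; rewrite !ltW.
- apply: derivable_within_continuous => t /[!in_itv]/= t01.
  by have [] := D t t01.
- rewrite scale1r scale0r addr0 subr0 mulr1 => ->.
  by exists t => //; move: t01; rewrite in_itv.
Qed.

End Ck.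

(** * Difference quotients and the chain rule *)

Section Hadamard.
Variables (R : realType).

Lemma nbhs_distP (V : normedModType R) (x : V) (P : set V) :
  nbhs x P <-> exists2 d : R, 0 < d & forall y, `|y - x| < d -> P y.
Proof.
split=> [/nbhs_ballP[d d0 H]|[d d0 H]].
  by exists d => // y yx; apply: H; rewrite -ball_normE /= distrC.
by apply/nbhs_ballP; exists d => // y; rewrite -ball_normE /= distrC => /H.
Qed.

Lemma norm_ball_open n (x0 : 'rV[R]_n) r : open [set s : 'rV[R]_n | `|s - x0| < r].
Proof.
rewrite openE => s Bs; apply/nbhs_distP; exists (r - `|s - x0|); first by rewrite subr_gt0.
move=> y ys /=; have -> : y - x0 = (y - s) + (s - x0) by rewrite addrA subrK.
by rewrite (le_lt_trans (ler_normD _ _))// -ltrBrDr.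
Qed.

Lemma origin_ball_open n r : open [set s : 'rV[R]_n | `|s| < r].
Proof.
have := @norm_ball_open n 0 r.
by congr open; apply/seteqP; split=> x /=; rewrite subr0.
Qed.

Lemma open_preimage (S T : topologicalType) (V : set S) (W : set T) (f : S -> T) :
  open V -> open W -> (forall x, V x -> {for x, continuous f}) ->
  open [set x | V x /\ W (f x)].
Proof.
move=> oV oW fc; rewrite openE => x [Vx Wx]; apply: filterI.
  exact: open_nbhs_nbhs.
by apply: (fc x Vx); exact: open_nbhs_nbhs.
Qed.

Lemma norm_delta_le1 n (i : 'I_n) : `|('e_i : 'rV[R]_n)| <= 1.
Proof.
apply: mx_norm_le => // k l; rewrite mxE; case: (_ && _) => /=; by rewrite ?normr1 ?normr0.
Qed.

(** The value at h = 0 is the limit of the quotients, so that this is one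
    continuous function of (x, h) when f is C^1. *)
Definition dquot n (i : 'I_n) (f : 'rV[R]_n -> R) (x : 'rV[R]_n) (h : R) : R :=
  if h == 0 then partial i f x else (f (x + h *: 'e_i) - f x) / h.

Lemma dquotE n (i : 'I_n) (f : 'rV[R]_n -> R) x h :
  f (x + h *: 'e_i) - f x = h * dquot i f x h.
Proof.
rewrite /dquot; case: eqP => [->|/eqP h0]; first by rewrite scale0r addr0 subrr mul0r.
by rewrite mulrC divfK.
Qed.

(** At h = 0 the mean value theorem writes a nearby quotient as a partial
    derivative at an intermediate point, close to x. *)
Lemma dquot_continuous n (U : set 'rV[R]_n) i f x h :
  open U -> U x -> U (x + h *: 'e_i) ->
  (forall y, U y -> {for y, continuous f}) ->
  (forall y, U y -> derivable f y 'e_i) ->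
  {for x, continuous (partial i f)} ->
  {for (x, h), continuous (fun z : 'rV[R]_n * R => dquot i f z.1 z.2)}.
Proof.
move=> oU Ux Uxh fc fd pc.
have c1 : {for (x, h), continuous (fun z : 'rV[R]_n * R => z.1)} by exact: cvg_fst.
have c2 : {for (x, h), continuous (fun z : 'rV[R]_n * R => z.2)} by exact: cvg_snd.
have [h0|h0] := eqVneq h 0; last first.
  apply: (@continuous_near_eq _ _
     (fun z : 'rV[R]_n * R => (f (z.1 + z.2 *: 'e_i) - f z.1) / z.2)).
    have : \forall z \near (x, h), z.2 != 0 by exact: (cvgr_neq0 _ c2 h0).
    by apply: filterS => z z0; rewrite /dquot (negPf z0).
  apply: (@cvgM R); last exact: cvgV.
  apply: cvgB.
    apply: (@continuous_comp _ _ _ (fun z : 'rV[R]_n * R => z.1 + z.2 *: 'e_i) f); last exact: fc.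
    by apply: cvgD => //; apply: cvgZr_tmp.
  by apply: (@continuous_comp _ _ _ (fun z : 'rV[R]_n * R => z.1) f) => //; exact: fc.
rewrite h0 in c1 c2 *.
apply/cvgrPdist_lt => e e0 /=; rewrite [in dquot _ _ x 0]/dquot eqxx.
have : nbhs x [set y | U y /\ `|partial i f x - partial i f y| < e].
  apply: filterI; first exact: open_nbhs_nbhs.
  by move/cvgrPdist_lt: pc; apply.
move=> /nbhs_distP[d d0 H].
have d20 : 0 < d / 2 by rewrite divr_gt0.
have N1 : \forall z \near (x, 0 : R), `|z.1 - x| < d / 2.
  by move/cvgrPdist_lt: c1 => /(_ _ d20); apply: filterS => z; rewrite distrC.
have N2 : \forall z \near (x, 0 : R), `|z.2| < d / 2.
  by move/cvgrPdist_lt: c2 => /(_ _ d20); apply: filterS => z; rewrite sub0r normrN.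
apply: filterS (filterI N1 N2) => -[y k] /= [yx k0].
have B (t : R) : 0 <= t <= 1 -> `|y + (t * k) *: 'e_i - x| < d.
  move=> /andP[t0 t1]; rewrite addrAC (le_lt_trans (ler_normD _ _))//.
  rewrite (splitr d) ltr_leD // normrZ normrM (ger0_norm t0).
  apply: le_trans (ltW k0); rewrite -[leRHS]mulr1 ler_pM ?norm_delta_le1 //.
  by rewrite mulr_ge0.
  by rewrite -[leRHS]mul1r ler_wpM2r.
rewrite /dquot; case: eqP => [k00|/eqP k0'].
  have B0 : `|y - x| < d.
    by have := B 0; rewrite lexx ler01 mul0r scale0r addr0; apply.
  by have [_] := H _ B0.
have [|t t01 ->] := @mvt_line _ _ f y 'e_i k.
  by move=> t t01; have [Uy _] := H _ (B t t01); exact: fd.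
rewrite mulrAC divff// mul1r.
by have [_] := H _ (B t t01).
Qed.

(** These points lead from b to a by changing one coordinate at a time. *)
Definition interp n (a b : 'rV[R]_n) (j : nat) : 'rV[R]_n :=
  \row_k (if (k < j)%N then a 0 k else b 0 k).

Lemma interp0 n (a b : 'rV[R]_n) : interp a b 0 = b.
Proof. by apply/rowP => k; rewrite mxE. Qed.

Lemma interpn n (a b : 'rV[R]_n) : interp a b n = a.
Proof. by apply/rowP => k; rewrite mxE ltn_ord. Qed.

Lemma interpS n (a b : 'rV[R]_n) (j : 'I_n) :
  interp a b j.+1 = interp a b j + (a 0 j - b 0 j) *: 'e_j.
Proof.
apply/rowP => k; rewrite !mxE ltnS leq_eqVlt eqxx /=.
have [->|kj] := eqVneq k j; first by rewrite eqxx ltnn /= mulr1 addrC subrK.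
by rewrite (negPf (kj : (k : nat) != j)) /= mulr0 addr0.
Qed.

(** An increment is exactly linear in a - b, with difference quotients as
    coefficients: the sum of the increments along the path of [interp]. *)
Lemma hadamard n (f : 'rV[R]_n -> R) (a b : 'rV[R]_n) :
  f a - f b = \sum_(j < n) (a 0 j - b 0 j) * dquot j f (interp a b j) (a 0 j - b 0 j).
Proof.
under eq_bigr => j _ do rewrite -dquotE -interpS.
rewrite -(big_mkord xpredT (fun j => f (interp a b j.+1) - f (interp a b j))).
by rewrite telescope_sumr// interp0 interpn.
Qed.

Lemma continuous_interp (T : topologicalType) n (a b : T -> 'rV[R]_n) j t :
  {for t, continuous a} -> {for t, continuous b} ->
  {for t, continuous (fun s => interp (a s) (b s) j)}.
Proof.
move=> ac bc; apply: continuous_mx => i k.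
have -> : (fun s => interp (a s) (b s) j i k) =
   (if (k < j)%N then (fun s => a s 0 k) else (fun s => b s 0 k)).
  by apply/funext => s; rewrite mxE; case: ifP.
by case: ifP => _; apply: continuous_coord.
Qed.

(** By Hadamard's formula the quotient of f o g is a finite sum of products,
    each of which converges. *)
Lemma chain_rule (V : normedModType R) n (U : set 'rV[R]_n) f
    (g : V -> 'rV[R]_n) x v : open U -> U (g x) -> Ck 1 U f ->
  (forall j, derivable (fun y => g y 0 j) x v) ->
  is_derive x v (f \o g)
    (\sum_j partial j f (g x) * 'D_v (fun y => g y 0 j) x).
Proof.
move=> oU Ux [fc fd] gd.
suff H : (fun h => h^-1 *: (((f \o g) \o shift x) (h *: v) - (f \o g) x)) @ 0^'
    --> \sum_j partial j f (g x) * 'D_v (fun y => g y 0 j) x.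
  by apply: DeriveDef; [apply/cvg_ex; eexists; exact: H|apply/cvg_lim].
pose G (h : R) := g (h *: v + x).
have Gj j : {for (0 : R), continuous (fun h : R => G h 0 j)}.
  apply: differentiable_continuous; apply/derivable1_diffP.
  exact: (derivable1P (fun y => g y 0 j) x v).1.
have Gc : {for (0 : R), continuous G}.
  by apply: continuous_mx => i j; rewrite (ord1 i).
have G0 : G 0 = g x by rewrite /G scale0r add0r.
have -> : (fun h => h^-1 *: (((f \o g) \o shift x) (h *: v) - (f \o g) x)) =
   (fun h => \sum_j dquot j f (interp (G h) (g x) j) (G h 0 j - g x 0 j) *
     (h^-1 *: (G h 0 j - g x 0 j))).
  apply/funext => h /=; rewrite -/(G h) hadamard scaler_sumr.
  by apply: eq_bigr => j _; rewrite [in LHS]mulrC scalerAr.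
apply: cvg_sumr => j _; apply: (@cvgM R); last exact: gd.
apply: cvg_within_filter.
have -> : partial j f (g x) = dquot j f (interp (G 0) (g x) j) (G 0 0 j - g x 0 j).
  rewrite G0 subrr /dquot eqxx; congr (partial _ _ _).
  by apply/rowP => k; rewrite mxE; case: ifP.
apply: (@continuous_comp _ _ _ (fun h => (interp (G h) (g x) j, G h 0 j - g x 0 j))
   (fun z => dquot j f z.1 z.2)).
  apply: continuous_pair.
    by apply: continuous_interp => //; exact: cst_continuous.
  by apply: cvgB; [exact: Gj|exact: cvg_cst].
have E : interp (G 0) (g x) j = g x.
  by rewrite G0; apply/rowP => k; rewrite mxE; case: ifP.
rewrite /= E G0 subrr.
apply: (@dquot_continuous _ U) => //; first by rewrite scale0r addr0.
- by move=> y Uy; exact: (fd j).1.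
- exact: (fd j).2.
Qed.

End Hadamard.

(** * Operations on functions of class C^k *)

Section CkAlgebra.
Variables (R : realType).

Section Rules.
Variable n : nat.
Implicit Types (U : set 'rV[R]_n) (f g : 'rV[R]_n -> R).

Lemma Ck_cst k U (c : R) : Ck k U (fun=> c).
Proof.
elim: k c => [|k IH] c /=; first by move=> x _; exact: cst_continuous.
split=> [x _|i]; first exact: cst_continuous.
split=> [x _|]; first exact: derivable_cst.
have -> : partial i (fun=> c) = (fun=> 0) :> ('rV[R]_n -> R).
  by apply/funext => x; rewrite /partial derive_cst.
exact: IH.
Qed.

Lemma is_derive_coord (j : 'I_n) (x v : 'rV[R]_n) :
  is_derive x v (fun y : 'rV[R]_n => y 0 j) (v 0 j).
Proof.
have d : derivable (fun y : 'rV[R]_n => y) x v by exact: derivable_id.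
apply: DeriveDef; first exact: ((derivable_mxP _ _ _).1 d).
by have := derive_mx d; rewrite derive_id => /rowP/(_ j); rewrite mxE => <-.
Qed.

Lemma partial_coord i j x : partial i (fun y : 'rV[R]_n => y 0 j) x = (i == j)%:R.
Proof. by rewrite /partial (@derive_val _ _ _ _ _ _ _ (is_derive_coord j x _)) mxE eqxx eq_sym. Qed.

Lemma Ck_coord k U (j : 'I_n) : Ck k U (fun y : 'rV[R]_n => y 0 j).
Proof.
case: k => [|k] /=; first by move=> x _; exact: coord_continuous.
split=> [x _|i]; first exact: coord_continuous.
split=> [x _|]; first by have [] := is_derive_coord j x 'e_i.
have -> : partial i (fun y : 'rV[R]_n => y 0 j) = (fun=> (i == j)%:R).
  by apply/funext => x; exact: partial_coord.
exact: Ck_cst.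
Qed.

Lemma partialD f g i x : derivable f x 'e_i -> derivable g x 'e_i ->
  partial i (fun y => f y + g y) x = partial i f x + partial i g x.
Proof. by move=> df dg; rewrite /partial -deriveD. Qed.

Lemma partialM f g i x : derivable f x 'e_i -> derivable g x 'e_i ->
  partial i (fun y => f y * g y) x = f x * partial i g x + g x * partial i f x.
Proof. by move=> df dg; rewrite /partial [LHS](deriveM df dg). Qed.

Lemma CkD k U f g : open U -> Ck k U f -> Ck k U g -> Ck k U (fun x => f x + g x).
Proof.
move=> oU; elim: k f g => [|k IH] f g.
  by move=> cf cg x Ux; apply: contD; [exact: cf|exact: cg].
move=> [cf df] [cg dg]; split.
  by move=> x Ux; apply: contD; [exact: cf|exact: cg].
move=> i; have [df1 df2] := df i; have [dg1 dg2] := dg i; split.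
  by move=> x Ux; apply: derivableD; [exact: df1|exact: dg1].
apply: Ck_eq (IH _ _ df2 dg2) => // x Ux.
by rewrite partialD//; [exact: df1|exact: dg1].
Qed.

Lemma CkM k U f g : open U -> Ck k U f -> Ck k U g -> Ck k U (fun x => f x * g x).
Proof.
move=> oU; elim: k f g => [|k IH] f g.
  by move=> cf cg x Ux; apply: contM; [exact: cf|exact: cg].
move=> f1 g1; have f0 := Ck_pred f1; have g0 := Ck_pred g1.
move: f1 g1 => [cf df] [cg dg]; split.
  by move=> x Ux; apply: contM; [exact: cf|exact: cg].
move=> i; have [df1 df2] := df i; have [dg1 dg2] := dg i; split.
  by move=> x Ux; apply: derivableM; [exact: df1|exact: dg1].
apply: Ck_eq (CkD oU (IH _ _ f0 dg2) (IH _ _ g0 df2)) => // x Ux.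
by rewrite partialM//; [exact: df1|exact: dg1].
Qed.

Lemma CkN k U f : open U -> Ck k U f -> Ck k U (fun x => - f x).
Proof.
move=> oU cf; have := CkM oU (Ck_cst k U (-1)) cf.
by apply: Ck_eq => // x _; rewrite mulN1r.
Qed.

Lemma CkB k U f g : open U -> Ck k U f -> Ck k U g -> Ck k U (fun x => f x - g x).
Proof. by move=> oU cf /(CkN oU); exact: CkD. Qed.

Lemma Ck_sum k U (I : Type) (s : seq I) (P : pred I) (F : I -> 'rV[R]_n -> R) :
  open U -> (forall i, P i -> Ck k U (F i)) -> Ck k U (fun x => \sum_(i <- s | P i) F i x).
Proof.
move=> oU cF; elim: s => [|i s IH].
  by apply: Ck_eq (Ck_cst k U 0) => // x _; rewrite big_nil.
have [Pi|Pi] := boolP (P i).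
  by apply: Ck_eq (CkD oU (cF i Pi) IH) => // x _; rewrite big_cons Pi.
by apply: Ck_eq IH => // x _; rewrite big_cons (negPf Pi).
Qed.

Lemma Ck_prod k U (I : Type) (s : seq I) (P : pred I) (F : I -> 'rV[R]_n -> R) :
  open U -> (forall i, P i -> Ck k U (F i)) -> Ck k U (fun x => \prod_(i <- s | P i) F i x).
Proof.
move=> oU cF; elim: s => [|i s IH].
  by apply: Ck_eq (Ck_cst k U 1) => // x _; rewrite big_nil.
have [Pi|Pi] := boolP (P i).
  by apply: Ck_eq (CkM oU (cF i Pi) IH) => // x _; rewrite big_cons Pi.
by apply: Ck_eq IH => // x _; rewrite big_cons (negPf Pi).
Qed.

Lemma is_derive_comp1 (V : normedModType R) (s : R -> R) (f : V -> R) x v ds :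
  derivable f x v -> is_derive (f x) 1 s ds ->
  is_derive x v (s \o f) (ds * 'D_v f x).
Proof.
move=> df [ds1 ds2].
have H : derivable (fun h : R => f (h *: v + x)) 0 1 by exact: (derivable1P f x v).1.
have E : f (0 *: v + x) = f x by rewrite scale0r add0r.
have S0 : is_derive (f ((0 : R) *: v + x)) 1 s ds by rewrite E; apply: DeriveDef.
have [K1 K2] := @is_derive1_comp R s (fun h : R => f (h *: v + x)) 0 _ _ S0 (derivableP H).
have F (g : V -> R) : 'D_1 (fun h : R => g (h *: v + x)) 0 = 'D_v g x.
  suff E' : (fun h => h^-1 *: (((fun h : R => g (h *: v + x)) \o shift 0) (h *: (1 : R^o))
      - g ((0 : R) *: v + x))) = (fun h => h^-1 *: ((g \o shift x) (h *: v) - g x)).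
    by rewrite /derive E'.
  apply/funext => h /=; by rewrite addr0 scale0r add0r [_ *: 1]mulr1.
apply: DeriveDef; first exact: (derivable1P (s \o f) x v).2.
by rewrite -F [LHS]K2 F.
Qed.

(** The two classes differ by one: s' o f only has to be C^k, which is what
    an induction on k provides when s' is expressed by s, as for 1/y and sqrt. *)
Lemma Ck_comp1 k U f (s s' : R -> R) : open U ->
  (forall x, U x -> is_derive (f x) 1 s (s' (f x))) ->
  Ck k.+1 U f -> Ck k U (s' \o f) -> Ck k.+1 U (s \o f).
Proof.
move=> oU ds [cf df] c'; split.
  move=> x Ux; apply: continuous_comp; first exact: cf.
  by apply: differentiable_continuous; apply/derivable1_diffP; have [] := ds x Ux.
move=> i; have [df1 df2] := df i; split.
  by move=> x Ux; have [] := is_derive_comp1 (df1 x Ux) (ds x Ux).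
apply: Ck_eq (CkM oU c' df2) => // x Ux.
by rewrite /= /partial (@derive_val _ _ _ _ _ _ _ (is_derive_comp1 (df1 x Ux) (ds x Ux))).
Qed.

Lemma is_derive_inv (x : R) : x != 0 -> is_derive x 1 (fun y : R => y^-1) (- (x^-1 * x^-1)).
Proof.
move=> x0; have := @is_deriveV R (@id R) x 1 1 x0 (is_derive_id _ _).
by move=> H; apply: is_derive_eq H _; rewrite /= [_ *: _]mulr1 expr2 invfM.
Qed.

Lemma CkV k U f : open U -> (forall x, U x -> f x != 0) -> Ck k U f ->
  Ck k U (fun x => (f x)^-1).
Proof.
move=> oU f0; elim: k => [|k IH].
  by move=> cf x Ux; apply: contV; [exact: f0|exact: cf].
move=> cf; have c := IH (Ck_pred cf).
apply: (@Ck_comp1 k U f (fun y => y^-1) (fun y => - (y^-1 * y^-1))) => //.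
  by move=> x Ux; apply: is_derive_inv; exact: f0.
exact: CkN oU (CkM oU c c).
Qed.

Lemma Ck_sqrt k U f : open U -> (forall x, U x -> 0 < f x) -> Ck k U f ->
  Ck k U (fun x => Num.sqrt (f x)).
Proof.
move=> oU f0; elim: k => [|k IH].
  move=> cf x Ux; apply: (@continuous_comp _ _ _ f (@Num.sqrt R)); first exact: cf.
  exact: sqrt_continuous.
move=> cf; have c := IH (Ck_pred cf).
apply: (@Ck_comp1 k U f (@Num.sqrt R) (fun y => (2 * Num.sqrt y)^-1)) => //.
  by move=> x Ux; apply: is_derive1_sqrt; exact: f0.
apply: CkV => //.
  by move=> x Ux; rewrite mulf_neq0// ?gt_eqF// sqrtr_gt0 f0.
exact: CkM oU (Ck_cst k U 2) c.
Qed.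

End Rules.

Lemma partial_comp n m (U : set 'rV[R]_n) (f : 'rV[R]_n -> R)
    (g : 'rV[R]_m -> 'rV[R]_n) x i : open U -> U (g x) -> Ck 1 U f ->
  (forall j, derivable (fun y => g y 0 j) x 'e_i) ->
  partial i (f \o g) x =
    \sum_j partial j f (g x) * partial i (fun y => g y 0 j) x.
Proof.
by move=> oU Ux cf dg; rewrite /partial (@derive_val _ _ _ _ _ _ _ (chain_rule oU Ux cf dg)).
Qed.

Lemma Ck_comp n m k (U : set 'rV[R]_n) (V : set 'rV[R]_m) (f : 'rV[R]_n -> R)
    (g : 'rV[R]_m -> 'rV[R]_n) : open U -> open V -> (forall x, V x -> U (g x)) ->
  Ck k U f -> (forall j, Ck k V (fun x => g x 0 j)) -> Ck k V (f \o g).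
Proof.
move=> oU oV VU; have gc k' x : (forall j, Ck k' V (fun x => g x 0 j)) -> V x -> {for x, continuous g}.
  by move=> cg Vx; apply: continuous_mx => i j; rewrite (ord1 i); exact: Ck_continuous (cg j) Vx.
elim: k f => [|k IH] f cf cg.
  move=> x Vx; apply: continuous_comp; first exact: gc cg Vx.
  exact/cf/VU.
have f1 : Ck 1 U f by exact: Ck_le cf.
split=> [x Vx|i].
  apply: continuous_comp; first exact: gc cg Vx.
  exact: Ck_continuous cf (VU _ Vx).
have dg j x : V x -> derivable (fun x => g x 0 j) x 'e_i.
  by move=> Vx; have [_ /(_ i)[+ _]] := cg j; exact.
split=> [x Vx|].
  by have [] := chain_rule oU (VU _ Vx) f1 (fun j => dg j x Vx).
have cpf j : Ck k V (partial j f \o g).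
  by apply: IH => [|l]; [have [_ /(_ j)[]] := cf|exact: Ck_pred].
apply: (@Ck_eq _ _ _ _ (fun x => \sum_j (partial j f \o g) x * partial i (fun y => g y 0 j) x)) => //.
  by move=> x Vx; rewrite (partial_comp oU (VU _ Vx) f1)// => j; exact: dg.
apply: Ck_sum => // j _; apply: CkM => //.
by have [_ /(_ i)[]] := cg j.
Qed.

Lemma is_derive_translate (V W : normedModType R) (f : V -> W) (c x v : V) df :
  is_derive (x + c) v f df -> is_derive x v (fun y => f (y + c)) df.
Proof.
move=> [d1 d2].
have E : (fun t => t^-1 *: ((f \o shift (x + c)) (t *: v) - f (x + c))) =
   (fun t => t^-1 *: (((fun y => f (y + c)) \o shift x) (t *: v) - f (x + c))).
  by apply/funext => t /=; rewrite addrA.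
by apply: DeriveDef; [rewrite /derivable -E|rewrite /derive -E].
Qed.

(** The mean value theorem, applied twice, identifies the second difference
    quotient along e_a and e_b with the mixed derivative at a nearby point; that
    quotient is symmetric in a and b. *)
Lemma schwarz n (U : set 'rV[R]_n) f i j x : open U -> U x -> Ck 2 U f ->
  partial i (partial j f) x = partial j (partial i f) x.
Proof.
move=> oU Ux cf.
have key (a b : 'I_n) e : 0 < e -> exists2 d : R, 0 < d & forall h : R, 0 < h < d ->
    `|partial b (partial a f) x -
      (f (x + h *: 'e_a + h *: 'e_b) - f (x + h *: 'e_a)
        - (f (x + h *: 'e_b) - f x)) / h ^+ 2| < e.
  move=> e0; have [_ /(_ a)[fa [_ /(_ b)[fab cab]]]] := cf.
  have : nbhs x [set y | U y /\
      `|partial b (partial a f) x - partial b (partial a f) y| < e].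
    apply: filterI; first exact: open_nbhs_nbhs.
    by move/cvgrPdist_lt: (cab x Ux); apply.
  move=> /nbhs_distP[d d0 H].
  exists (d / 2) => [|h /andP[h0 hd]]; first by rewrite divr_gt0.
  have B (s t : R) : 0 <= s <= 1 -> 0 <= t <= 1 ->
     `|x + (s * h) *: 'e_a + (t * h) *: 'e_b - x| < d.
    move=> /andP[s0 s1] /andP[t0 t1]; rewrite -[x + _ + _]addrA [x + _]addrC addrK.
    rewrite (le_lt_trans (ler_normD _ _))//.
    have N c (u : R) : 0 <= u -> u <= 1 -> `|(u * h) *: ('e_c : 'rV[R]_n)| <= h.
      move=> u0 u1; rewrite normrZ ger0_norm ?mulr_ge0 ?(ltW h0)//.
      rewrite -[leRHS]mulr1 ler_pM ?norm_delta_le1 ?mulr_ge0 ?(ltW h0)//.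
      by rewrite -[leRHS]mul1r ler_wpM2r// ltW.
    rewrite (le_lt_trans (lerD (N a s s0 s1) (N b t t0 t1)))//.
    by rewrite (splitr d) ltrD.
  (* The second difference is the increment of F along e_a. *)
  pose F y := f (y + h *: 'e_b) - f y.
  have h1 : (0 : R) <= (1 : R) <= (1 : R) by rewrite ler01 lexx.
  have h00 : (0 : R) <= (0 : R) <= (1 : R) by rewrite ler01 lexx.
  have dF (t : R) : 0 <= t <= 1 ->
    is_derive (x + (t * h) *: 'e_a) 'e_a F
     (partial a f (x + (t * h) *: 'e_a + h *: 'e_b) - partial a f (x + (t * h) *: 'e_a)).
    move=> t01.
    have [U1 _] := H _ (B t 1 t01 h1).
    have [U2 _] := H _ (B t 0 t01 h00).
    rewrite mul1r in U1; rewrite mul0r scale0r addr0 in U2.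
    apply: is_deriveB; last by apply: derivableP; exact: fa.
    by apply: is_derive_translate; apply: derivableP; exact: fa.
  have [|s s01 E1] := @mvt_line _ _ F x 'e_a h.
    by move=> t t01; have [] := dF t t01.
  rewrite (@derive_val _ _ _ _ _ _ _ (dF s s01)) in E1.
  have [|t t01 E2] := @mvt_line _ _ (partial a f) (x + (s * h) *: 'e_a) 'e_b h.
    by move=> t t01; have [Ut _] := H _ (B s t s01 t01); exact: fab.
  rewrite E2 in E1; rewrite -/(F (x + h *: 'e_a)) -/(F x) E1.
  rewrite mulrA -expr2 mulrAC divff ?mul1r ?expf_neq0 ?gt_eqF//.
  by have [_] := H _ (B s t s01 t01).
apply/eqP; rewrite -subr_eq0 -normr_le0; apply/ler_addgt0Pr => e e0.
have e20 : 0 < e / 2 by rewrite divr_gt0.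
have [d d0 D] := key i j _ e20; have [d' d'0 D'] := key j i _ e20.
pose h := Num.min d d' / 2.
have m0 : 0 < Num.min d d' by rewrite lt_min d0.
have h0 : 0 < h by rewrite divr_gt0.
have hm : h < Num.min d d' by rewrite ltr_pdivrMr// ltr_pMr// ltr1n.
move: (hm); rewrite lt_min => /andP[hd hd'].
have := D h; rewrite h0 hd => /(_ isT) A1.
have := D' h; rewrite h0 hd' => /(_ isT).
have -> : x + h *: 'e_j + h *: 'e_i = x + h *: 'e_i + h *: 'e_j by rewrite addrAC.
have -> : f (x + h *: 'e_i + h *: 'e_j) - f (x + h *: 'e_j) - (f (x + h *: 'e_i) - f x) =
  f (x + h *: 'e_i + h *: 'e_j) - f (x + h *: 'e_i) - (f (x + h *: 'e_j) - f x) by ring.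
move=> A2; move: A1 A2; set w := (_ / h ^+ 2).
set u := partial i _ x; set v := partial j _ x.
move=> A1 A2; rewrite add0r (_ : u - v = (u - w) - (v - w)).
  apply: le_trans (ler_normB _ _) _; rewrite (splitr e).
  by apply: lerD; apply: ltW; [exact: A2|exact: A1].
by rewrite opprB addrA subrK.
Qed.

End CkAlgebra.

(** * Estimates on derivatives and primitives in one variable *)

Section Primitive.
Variables (R : realType).
Local Notation mu := (@lebesgue_measure R).

Lemma mvt0 (F f : R -> R) (t : R) :
  (forall s : R, `|s| <= `|t| -> is_derive s (1 : R) F (f s)) ->
  exists2 c, `|c| <= `|t| & F t - F 0 = f c * t.
Proof.
move=> dF; have cF a b : -`|t| <= a -> b <= `|t| -> {within `[a, b], continuous F}.
  move=> ta tb; apply: derivable_within_continuous => s /[!in_itv]/= /andP[s1 s2].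
  have [] // := dF s; rewrite ler_norml (le_trans ta s1) /=; exact: le_trans s2 tb.
have [t0|t0] := leP 0 t.
  have [s||c] := @MVT_segment R F f 0 t t0.
  - by rewrite in_itv/= => /andP[s1 s2]; apply: dF; rewrite !ger0_norm// ltW.
  - by apply: cF; rewrite ger0_norm// oppr_le0.
  rewrite in_itv/= subr0 => /andP[c0 ct] E; exists c => //.
  by rewrite !ger0_norm.
have [s||c] := @MVT_segment R F f t 0 (ltW t0).
- rewrite in_itv/= => /andP[s1 s2]; apply: dF.
  by rewrite !ltr0_norm// lerN2 ltW.
- by apply: cF; rewrite ltr0_norm ?opprK ?oppr_ge0// ltW.
rewrite in_itv/= sub0r => /andP[ct c0] E; exists c => //.
  by rewrite (ltr0_norm t0) ler0_norm// lerN2.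
by apply: oppr_inj; rewrite opprB E mulrN.
Qed.

Lemma mvt_bound (F f : R -> R) (t M : R) :
  (forall s : R, `|s| <= `|t| -> is_derive s (1 : R) F (f s)) ->
  (forall s : R, `|s| <= `|t| -> `|f s| <= M) -> `|F t - F 0| <= M * `|t|.
Proof.
move=> dF fM; have [c ct ->] := mvt0 dF.
by rewrite normrM ler_wpM2r// fM.
Qed.

Lemma is_derive_expRM (K s : R) : is_derive s (1 : R) (fun s => expR (K * s)) (K * expR (K * s)).
Proof.
have H : is_derive s (1 : R) (fun s : R => K * s) K.
  have := @is_deriveZ R R R (@id R) K s 1 1 (is_derive_id _ _).
  by move=> H; apply: is_derive_eq H _; rewrite [_ *: _]mulr1.
have := @is_derive1_comp R expR (fun s => K * s) s _ _ (is_derive_expR _) H.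
by move=> H2; apply: is_derive_eq H2 _; rewrite mulrC.
Qed.

(** Integrating the bound K C exp(K s).  With K = 2 L this is what makes an
    integral operator of Lipschitz constant L halve distances weighted by
    exp(2 L |t|), on any time interval. *)
Lemma mvt_expR (F f : R -> R) (t K C : R) :
  (forall s : R, `|s| <= `|t| -> is_derive s (1 : R) F (f s)) ->
  (forall s : R, `|s| <= `|t| -> `|f s| <= K * C * expR (K * `|s|)) ->
  `|F t - F 0| <= C * (expR (K * `|t|) - 1).
Proof.
move=> dF fM.
(* Both signs, that of t and that of the increment of F, are factored out:
   a one-sided estimate on [0, |t|] remains. *)
have [sg [sg1 sgt]] : exists sg : R, `|sg| = 1 /\ sg * `|t| = t.
  have [t0|t0] := leP 0 t; first by exists 1; rewrite normr1 mul1r ger0_norm.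
  by exists (-1); rewrite normrN1 mulN1r ltr0_norm// opprK.
suff H ep : `|ep| = 1 -> ep * (F t - F 0) <= C * (expR (K * `|t|) - 1).
  rewrite ler_norml; have := H 1 (normr1 _); have := H (-1) (normrN1 _).
  by rewrite mulN1r mul1r lerNl => -> ->.
move=> ep1.
pose G s := ep * F (sg * s) - C * expR (K * s).
pose g s := ep * (sg * f (sg * s)) - C * (K * expR (K * s)).
have dG s : 0 <= s <= `|t| -> is_derive s (1 : R) G (g s).
  move=> /andP[s0 s1].
  have H : is_derive s (1 : R) (fun s : R => sg * s) sg.
    have H := @is_deriveZ R R R (@id R) sg s 1 1 (is_derive_id _ _).
    by apply: is_derive_eq H _; rewrite [_ *: _]mulr1.
  have ds : is_derive (sg * s) 1 F (f (sg * s)).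
    by apply: dF; rewrite normrM sg1 mul1r ger0_norm.
  have H2 := @is_derive1_comp R F (fun s => sg * s) s _ _ ds H.
  have H3 := @is_deriveZ R R R _ ep s 1 _ H2.
  have H4 := @is_deriveZ R R R _ C s 1 _ (is_derive_expRM K s).
  have H5 := is_deriveB H3 H4.
  by apply: is_derive_eq H5 _; rewrite /g [f _ * _]mulrC.
have [s||c] := @MVT_segment R G g 0 `|t| (normr_ge0 _).
- by rewrite in_itv/= => /andP[s1 s2]; apply: dG; rewrite !ltW.
- by apply: derivable_within_continuous => s /[!in_itv]/= s01; have [] := dG s s01.
rewrite in_itv/= subr0 /G mulr0 mulr0 expR0 sgt => /andP[c0 ct] E.
suff : g c * `|t| <= 0 by rewrite -E; lra.
apply: mulr_le0_ge0 => //; rewrite /g subr_le0 (le_trans (ler_norm _))//.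
rewrite !normrM ep1 sg1 !mul1r mulrA [C * K]mulrC.
by have := fM (sg * c); rewrite normrM sg1 mul1r (ger0_norm c0); apply.
Qed.

Lemma eq_prim (F G f : R -> R) (t : R) :
  (forall s : R, `|s| <= `|t| -> is_derive s (1 : R) F (f s)) ->
  (forall s : R, `|s| <= `|t| -> is_derive s (1 : R) G (f s)) -> F 0 = G 0 -> F t = G t.
Proof.
move=> dF dG E; have d (s : R) : `|s| <= `|t| -> is_derive s (1 : R) (F - G) 0.
  by move=> st; apply: is_derive_eq (is_deriveB (dF s st) (dG s st)) _; rewrite subrr.
have := @mvt_bound (F - G) (fun=> 0) t 0 d.
rewrite mul0r /= => /(_ _)/wrap[]; first by move=> s _; rewrite normr0.
by rewrite normr_le0 !fctE /= E subrr subr0 subr_eq0 => /eqP.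
Qed.

Lemma prim_on_ball (f : R -> R) (N : R) : continuous f -> 0 < N ->
  exists F : R -> R, F 0 = 0 /\ forall t : R, `|t| < N -> is_derive t (1 : R) F (f t).
Proof.
move=> cf N0.
pose F0 (x : R) := (\int[mu]_(t in `[-N, x]) f t)%R.
have d0 (t : R) : `|t| < N -> is_derive t (1 : R) F0 (f t).
  rewrite ltr_norml => /andP[t1 t2].
  have [|||d1 d2] := @continuous_FTC1_closed R f (-N) t N t2; last 1 first.
  - by apply: DeriveDef => //; rewrite -derive1E.
  - apply: continuous_compact_integrable; first exact: segment_compact.
    by apply: continuous_subspaceT.
  - exact: t1.
  - exact: cf.
exists (fun x => F0 x - F0 0); split=> [|t tN]; first by rewrite subrr.
have := is_deriveB (d0 t tN) (is_derive_cst (F0 0) t 1).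
by move=> H; apply: is_derive_eq H _; rewrite subr0.
Qed.

(** The integral from - N gives a primitive on ]-N, N[; primitives
    vanishing at 0 agree where they are both defined. *)
Lemma exists_prim (f : R -> R) : continuous f ->
  exists F : R -> R, F 0 = 0 /\ forall t : R, is_derive t (1 : R) F (f t).
Proof.
move=> cf.
(* For N <= 0 the choice is arbitrary. *)
have P (N : R) : exists F : R -> R, 0 < N -> F 0 = 0 /\ forall t : R, `|t| < N -> is_derive t (1 : R) F (f t).
  have [N0|N0] := ltP 0 N; last by exists (fun=> 0).
  by have [F HF] := prim_on_ball cf N0; exists F.
have [G HG] := choice P.
(* Any radius larger than |t| would do: they all give the same value. *)
pose F t := G (`|t| + 1) t.
have E (N t : R) : `|t| < N -> F t = G N t.
  move=> tN; have N0 : 0 < N by apply: le_lt_trans tN.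
  have [h1 h2] := HG N N0.
  have [h3 h4] : G (`|t| + 1) 0 = 0 /\ forall u : R, `|u| < `|t| + 1 -> is_derive u (1 : R) (G (`|t| + 1)) (f u).
    by apply: HG; rewrite ltr_wpDl.
  apply: (@eq_prim (G (`|t| + 1)) (G N) f t) => [s st|s st|]; last by rewrite h1.
    by apply: h4; rewrite (le_lt_trans st)// ltrDl.
  by apply: h2; rewrite (le_lt_trans st).
exists F; split; first by rewrite (E 1) ?normr0//; have [] := HG 1 ltr01.
move=> t; have t0 : 0 < `|t| + 1 by rewrite ltr_wpDl.
have [h1 h2] := HG _ t0.
apply: (near_eq_is_derive (f := G (`|t| + 1))); last by apply: h2; rewrite ltrDl.
apply/nbhs_distP; exists 1 => // s st; rewrite (@E (`|t| + 1))//.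
by rewrite -[s](subrK t) addrC (le_lt_trans (ler_normD _ _))// ltrD2l.
Qed.

Definition prim (f : R -> R) : R -> R :=
  get (fun F : R -> R => F 0 = 0 /\ forall t : R, is_derive t (1 : R) F (f t)).

Lemma primP f : continuous f -> prim f 0 = 0 /\ forall t : R, is_derive t (1 : R) (prim f) (f t).
Proof.
move=> /exists_prim ex.
exact: (@getPex _ (fun F : R -> R => F 0 = 0 /\ forall t : R, is_derive t (1 : R) F (f t)) ex).
Qed.

(** On a compact time interval g t s is close to g t s0, uniformly in t, for
    s near s0; the mean value inequality transfers this to the primitives. *)
Lemma prim_continuous (T : topologicalType) (g : R -> T -> R) :
  (forall t s, {for (t, s), continuous (fun z => g z.1 z.2)}) ->
  forall t s, {for (t, s), continuous (fun z => prim (g^~ z.2) z.1)}.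
Proof.
move=> gc t0 s0.
have gct s : continuous (g^~ s).
  move=> t; apply: (@continuous_comp _ _ _ (fun t => (t, s)) (fun z => g z.1 z.2)); last exact: gc.
  by apply: continuous_pair => //; exact: cst_continuous.
apply/cvgrPdist_lt => e e0 /=.
set N := `|t0| + 1; have N0 : 0 < N by rewrite ltr_wpDl.
(* The increment in s costs at most e' |t| <= e / 2, that in t at most e / 2. *)
pose e' := e / 2 / N; have e'0 : 0 < e' by rewrite !divr_gt0.
have near1 : \forall s \near s0, `[-N, N]%classic `<=` (fun t => `|g t s - g t s0| < e').
  have /compact_near_coveringP := @segment_compact R (-N) N; apply => t _.
  have c : {for (t, s0), continuous (fun z : R * T => g z.1 z.2 - g z.1 s0)}.
    apply: contB; first exact: gc.
    apply: (@continuous_comp _ _ _ fst (g^~ s0)); last exact: gct.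
    exact: cvg_fst.
  move/cvgrPdist_lt: c => /(_ _ e'0) /=.
  apply: filterS => -[t' s] /=.
  by rewrite subrr sub0r normrN.
have near2 : \forall z \near (t0, s0), `[-N, N]%classic `<=` (fun t => `|g t z.2 - g t s0| < e').
  exact: (@cvg_snd _ _ (nbhs t0) (nbhs s0) _ _ near1).
have near3 : \forall z \near (t0, s0), `|z.1 - t0| < 1.
  have : nbhs t0 [set t : R | `|t - t0| < 1] by apply/nbhs_distP; exists 1.
  exact: cvg_fst.
have near4 : \forall z \near (t0, s0), `|prim (g^~ s0) t0 - prim (g^~ s0) z.1| < e / 2.
  have H : nbhs t0 [set t : R | `|prim (g^~ s0) t0 - prim (g^~ s0) t| < e / 2].
    have : {for t0, continuous (prim (g^~ s0))}.
      apply: differentiable_continuous; apply/derivable1_diffP.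
      by have [_ /(_ t0)[]] := primP (gct s0).
    by move/cvgrPdist_lt; apply; rewrite divr_gt0.
  exact: (@cvg_fst _ _ (nbhs t0) (nbhs s0) _ _ H).
apply: filterS (filterI near2 (filterI near3 near4)) => -[t s] /= [n2 [n3 n4]].
have tN : `|t| <= N.
  by rewrite -[t](subrK t0) addrC (le_trans (ler_normD _ _))// lerD2l ltW.
have [p0 pd] := primP (gct s0); have [q0 qd] := primP (gct s).
have B : `|(prim (g^~ s) - prim (g^~ s0)) t - (prim (g^~ s) - prim (g^~ s0)) 0| <= e' * `|t|.
  apply: (@mvt_bound _ (fun t => g t s - g t s0)) => u ut.
  apply/ltW/n2; rewrite /= in_itv /= -ler_norml; exact: le_trans ut tN.
move: B; rewrite !fctE p0 q0 subr0 subr0 => B.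
rewrite (_ : _ - _ = (prim (g^~ s0) t0 - prim (g^~ s0) t) - (prim (g^~ s) t - prim (g^~ s0) t)); last by ring.
rewrite (le_lt_trans (ler_normB _ _))// (splitr e) ltr_leD//.
rewrite (le_trans B)// (le_trans (ler_wpM2l (ltW e'0) tN))// /e' divfK// gt_eqF//.
Qed.

End Primitive.

(** * Ordinary differential equations with a parameter *)

Section Picard.
Variables (R : realType).

Lemma expR_ge1 (x : R) : 0 <= x -> 1 <= expR x.
Proof. by move=> x0; rewrite -expR0 ler_expR. Qed.

Lemma norm_lt_near (V : normedModType R) (u t : V) e :
  `|u - t| < e -> `|u| < `|t| + e.
Proof.
move=> ut; have -> : u = t + (u - t) by rewrite addrC subrK.
by rewrite (le_lt_trans (ler_normD _ _))// ltrD2l.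
Qed.

Lemma small_pow2 (A e : R) : 0 < e -> exists k, A / 2 ^+ k < e.
Proof.
move=> e0; exists (Num.truncn (A / e)).+1.
rewrite ltr_pdivrMr ?exprn_gt0// mulrC -ltr_pdivrMr//.
apply: lt_le_trans (real_truncnS_gt (num_real _)) _.
by rewrite -natrX ler_nat ltnW// ltn_expl.
Qed.

(** Near each point every large M bounds f; compactness provides one M that is
    large enough for all points. *)
Lemma compact_bound (T : topologicalType) (K : set T) (f : T -> R) :
  compact K -> (forall x, K x -> {for x, continuous f}) ->
  exists M : R, forall x, K x -> `|f x| <= M.
Proof.
move=> /compact_near_coveringP cK fc.
have /filter_ex[M HM] : \forall M \near +oo, K `<=` (fun x => `|f x| <= M).
  apply: (cK R (pinfty_nbhs R) (fun M x => `|f x| <= M)) => x Kx.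
  have N1 : \forall x' \near x, `|f x'| < `|f x| + 1.
    move/cvgrPdist_lt: (fc x Kx) => /(_ 1 ltr01); apply: filterS => y yx.
    by rewrite -[f y](subrK (f x)) addrC (le_lt_trans (ler_normD _ _))// ltrD2l distrC.
  have N2 : \forall M \near +oo, `|f x| + 1 < M by apply: nbhs_pinfty_gt; rewrite num_real.
  exists ([set x' | `|f x'| < `|f x| + 1], [set M | `|f x| + 1 < M]) => //= -[x' M] /= [h1 h2].
  exact/ltW/(lt_trans h1 h2).
by exists M.
Qed.

(** By compactness d is bounded on [- b, b]; integrating a bound
    M exp(2 L |t|) yields the bound M/2 exp(2 L |t|), so d vanishes. *)
Lemma ode_unique m (d d' : R -> 'rV[R]_m) (L b : R) : 0 < L ->
  (forall (t : R) j, `|t| <= b -> is_derive t (1 : R) (fun s => d s 0 j) (d' t 0 j)) ->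
  (forall t : R, `|t| <= b -> `|d' t| <= L * `|d t|) ->
  d 0 = 0 -> forall t : R, `|t| <= b -> d t = 0.
Proof.
move=> L0 dd d'L d0.
have dc (t : R) : `|t| <= b -> {for t, continuous d}.
  move=> tb; apply: continuous_mx => i j; rewrite (ord1 i).
  apply: differentiable_continuous; apply/derivable1_diffP.
  by have [] := dd t j tb.
have [M HM] : exists M : R, forall t : R, `|t| <= b -> `|d t| <= M.
  have [|M HM] := @compact_bound _ `[-b, b]%classic (fun t => `|d t|) (@segment_compact R _ _).
    move=> t; rewrite /= in_itv/= -ler_norml => tb.
    by apply: (@continuous_comp _ _ _ d Num.norm); [exact: dc|exact: norm_continuous].
  exists M => t tb; have := HM t; rewrite /= in_itv /= -ler_norml normr_id.
  exact.
have M0 (t : R) : `|t| <= b -> 0 <= M by move=> tb; exact: le_trans (HM t tb).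
(* Each integration of the differential inequality gains a factor 1/2. *)
have key k (t : R) : `|t| <= b -> `|d t| <= M / 2 ^+ k * expR (2 * L * `|t|).
  elim: k t => [|k IH] t tb.
    rewrite expr0 divr1 (le_trans (HM t tb))// ler_peMr ?(M0 t)// expR_ge1//.
    by rewrite !mulr_ge0// ltW.
  apply: mx_norm_le => [|i j].
    by rewrite mulr_ge0 ?expR_ge0// divr_ge0 ?(M0 t)// exprn_ge0.
  have E0 : d 0 0 j = 0 by rewrite d0 mxE.
  rewrite (ord1 i).
  have := @mvt_expR R (fun s => d s 0 j) (fun s => d' s 0 j) t (2 * L) (M / 2 ^+ k.+1).
  rewrite E0 subr0 => H; apply: le_trans (H _ _) _ => [s st|s st|].
  - by apply: dd; exact: le_trans st tb.
  - have sb := le_trans st tb.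
    rewrite (le_trans (mx_norm_coord _ _ _))// (le_trans (d'L s sb))//.
    rewrite (le_trans (ler_wpM2l (ltW L0) (IH s sb)))//.
    rewrite le_eqVlt; apply/orP; left; apply/eqP.
    by rewrite exprS invfM; set q := (2 ^+ _)^-1; set E := expR _; field.
  - rewrite ler_wpM2l// ?gerBl// divr_ge0 ?(M0 t)// exprn_ge0//.
move=> t tb; apply/eqP; rewrite -normr_le0; apply/ler_addgt0Pr => e e0.
rewrite add0r.
set B := M * expR (2 * L * `|t|).
have B0 : 0 <= B by rewrite mulr_ge0 ?(M0 t)// expR_ge0.
have [k Hk] := small_pow2 B e0.
by rewrite (le_trans (key k t tb))// mulrAC ltW.
Qed.

(** Coordinatewise, the intervals centred at u k of radius 2 B / 2^k are
    nested; the limit is the supremum of their left ends. *)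
Lemma geometric_limit m (u : nat -> 'rV[R]_m) (B : R) : 0 <= B ->
  (forall k, `|u k.+1 - u k| <= B / 2 ^+ k) ->
  exists l, forall k, `|l - u k| <= 2 * B / 2 ^+ k.
Proof.
move=> B0 uB.
suff H j : exists l : R, forall k, `|l - u k 0 j| <= 2 * B / 2 ^+ k.
  have [l Hl] := choice H; exists (\row_j l j) => k.
  by apply: mx_norm_le => [|i j]; rewrite ?divr_ge0 ?mulr_ge0 ?exprn_ge0// (ord1 i) !mxE.
have uBj k : `|u k.+1 0 j - u k 0 j| <= B / 2 ^+ k.
  by apply: le_trans (uB k); have := mx_norm_coord (u k.+1 - u k) 0 j; rewrite !mxE.
pose v k := u k 0 j - 2 * B / 2 ^+ k.
pose w k := u k 0 j + 2 * B / 2 ^+ k.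
have E k : 2 * B / 2 ^+ k = B / 2 ^+ k + 2 * B / 2 ^+ k.+1.
  by rewrite exprS invfM; set q := (2 ^+ _)^-1; field.
have vS k : v k <= v k.+1.
  have := uBj k; rewrite ler_norml /v (E k) => /andP[h _]; lra.
have wS k : w k.+1 <= w k.
  have := uBj k; rewrite ler_norml /w (E k) => /andP[_ h]; lra.
have vD k l : (k <= l)%N -> v k <= v l.
  by move=> /subnK <-; elim: (l - k)%N => // p IH; rewrite addSn (le_trans IH).
have wD k l : (k <= l)%N -> w l <= w k.
  by move=> /subnK <-; elim: (l - k)%N => // p IH; rewrite addSn (le_trans _ IH).
have vw k l : v k <= w l.
  have h p : v p <= w p.
    rewrite /v /w lerBlDr -addrA lerDl addr_ge0// divr_ge0 ?mulr_ge0// exprn_ge0//.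
  by rewrite (le_trans (vD _ _ (leq_maxl k l)))// (le_trans (h _))// wD// leq_maxr.
have ne : [set v k | k in setT] !=set0 by exists (v 0%N), 0%N.
have ub l : ubound [set v k | k in setT] (w l) by move=> _ [k _ <-].
exists (sup [set v k | k in setT]) => k.
have h1 : v k <= sup [set v k | k in setT].
  by apply: ub_le_sup; [exists (w 0%N)|exists k].
have h2 : sup [set v k | k in setT] <= w k by apply: ge_sup.
by rewrite ler_norml; move: h1 h2; rewrite /v /w => h1 h2; apply/andP; split; lra.
Qed.

Definition vec_prim m (g : R -> 'rV[R]_m) (t : R) : 'rV[R]_m :=
  \row_j prim (fun s => g s 0 j) t.

Lemma vec_prim_is_derive m (g : R -> 'rV[R]_m) t j : continuous g ->
  is_derive t (1 : R) (fun s => vec_prim g s 0 j) (g t 0 j).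
Proof.
move=> gc; have [_ /(_ t)] := @primP R (fun s => g s 0 j) (fun x => continuous_coord (gc x)).
by move=> H; under eq_fun do rewrite mxE.
Qed.

Lemma vec_prim0 m (g : R -> 'rV[R]_m) : continuous g -> vec_prim g 0 = 0.
Proof.
move=> gc; apply/rowP => j; rewrite !mxE.
by have [-> _] := @primP R (fun s => g s 0 j) (fun x => continuous_coord (gc x)).
Qed.

Lemma vec_prim_continuous (T : topologicalType) m (g : R -> T -> 'rV[R]_m) :
  (forall t s, {for (t, s), continuous (fun z => g z.1 z.2)}) ->
  forall t s, {for (t, s), continuous (fun z => vec_prim (g^~ z.2) z.1)}.
Proof.
move=> gc t s; apply: continuous_mx => i j; rewrite (ord1 i).
have -> : (fun z : R * T => vec_prim (g^~ z.2) z.1 0 j) =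
    (fun z => prim ((fun t s => g t s 0 j)^~ z.2) z.1).
  by apply/funext => z; rewrite mxE.
have H t' s' : {for (t', s'), continuous (fun z : R * T => g z.1 z.2 0 j)}.
  by apply: continuous_coord; exact: gc.
exact: (@prim_continuous R T (fun t s => g t s 0 j) H t s).
Qed.

Section Existence.
Variables (T : topologicalType) (m : nat) (f : R -> T -> 'rV[R]_m -> 'rV[R]_m).
Variables (y0 : T -> 'rV[R]_m) (L C : R).
Hypothesis fc : forall t s y, {for (t, s, y), continuous (fun z => f z.1.1 z.1.2 z.2)}.
Hypothesis y0c : continuous y0.
Hypothesis L1 : 1 <= L.
Hypothesis fL : forall t s y y', `|f t s y - f t s y'| <= L * `|y - y'|.
Hypothesis fC : forall t s, `|f t s (y0 s)| <= C.

Fixpoint picard k (t : R) (s : T) : 'rV[R]_m :=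
  if k is k'.+1 then y0 s + vec_prim (fun u => f u s (picard k' u s)) t else y0 s.

Lemma picardS k t s :
  picard k.+1 t s = y0 s + vec_prim (fun u => f u s (picard k u s)) t.
Proof. by []. Qed.

Let jcont (g : R -> T -> 'rV[R]_m) :=
  forall t s, {for (t, s), continuous (fun z => g z.1 z.2)}.

Let fg_cont g : jcont g -> jcont (fun t s => f t s (g t s)).
Proof.
move=> gc t s.
apply: (@continuous_comp _ _ _ (fun z : R * T => (z, g z.1 z.2)) (fun z => f z.1.1 z.1.2 z.2)).
  by apply: continuous_pair => //; exact: gc.
exact: fc.
Qed.

Let fslice g s : jcont g -> continuous (fun u => f u s (g u s)).
Proof.
move=> gc t.
apply: (@continuous_comp _ _ _ (fun t => (t, s)) (fun z => f z.1 z.2 (g z.1 z.2))).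
  by apply: continuous_pair => //; exact: cst_continuous.
exact: (@fg_cont g gc t s).
Qed.

Lemma picard_continuous k : jcont (picard k).
Proof.
elim: k => [|k IH] t s.
  by apply: (@continuous_comp _ _ _ snd y0); [exact: cvg_snd|exact: y0c].
rewrite /picard -/picard; apply: contD.
  by apply: (@continuous_comp _ _ _ snd y0); [exact: cvg_snd|exact: y0c].
by apply: (@vec_prim_continuous T m (fun u s => f u s (picard k u s))); exact: fg_cont.
Qed.

Let C0 : inhabited T -> 0 <= C.
Proof. by case=> s; apply: le_trans (fC 0 s). Qed.

Let L0 : 0 < L. Proof. exact: lt_le_trans L1. Qed.

(** When g and h come from an L-Lipschitz right-hand side, a weighted distance
    2 B of the unknowns becomes the weighted distance B of the primitives. *)
Lemma vec_prim_compare (g h : R -> 'rV[R]_m) (B t : R) :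
  continuous g -> continuous h -> 0 <= B ->
  (forall u, `|g u - h u| <= 2 * L * B * expR (2 * L * `|u|)) ->
  `|vec_prim g t - vec_prim h t| <= B * expR (2 * L * `|t|).
Proof.
move=> gc hc B0 gh; apply: mx_norm_le => [|i j]; first by rewrite mulr_ge0 ?expR_ge0.
rewrite (ord1 i) mxE [X in _ + X]mxE.
have := @mvt_expR R ((fun s => vec_prim g s 0 j) - (fun s => vec_prim h s 0 j))
  (fun s => g s 0 j - h s 0 j) t (2 * L) B.
rewrite !fctE (vec_prim0 gc) (vec_prim0 hc) !mxE !subr0 => H.
apply: le_trans (H _ _) _ => [s _|s _|].
- by apply: is_deriveB; exact: vec_prim_is_derive.
- by apply: le_trans (gh s); have := mx_norm_coord (g s - h s) 0 j; rewrite !mxE.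
- by rewrite ler_wpM2l// gerBl.
Qed.

Lemma picard_step k t s : `|picard k.+1 t s - picard k t s| <= C * expR (2 * L * `|t|) / 2 ^+ k.
Proof.
have C00 : 0 <= C by apply: C0.
elim: k t => [|k IH] t.
  rewrite /= addrAC subrr add0r expr0 divr1.
  have c0 := @fslice (picard 0) s (@picard_continuous 0).
  have cz : continuous (fun _ : R => (0 : 'rV[R]_m)) by move=> ?; exact: cst_continuous.
  have z : vec_prim (fun _ : R => (0 : 'rV[R]_m)) t = 0.
    apply/rowP => j; rewrite [RHS]mxE.
    have h1 u : is_derive u (1 : R) (fun s => vec_prim (fun=> 0) s 0 j) 0.
      by apply: is_derive_eq (vec_prim_is_derive u j cz) _; rewrite mxE.
    have h2 u : is_derive u (1 : R) (fun _ : R => 0 : R) 0 by exact: is_derive_cst.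
    have h3 : vec_prim (fun _ : R => (0 : 'rV[R]_m)) 0 0 j = 0 by rewrite vec_prim0// mxE.
    exact: (@eq_prim R _ _ (fun=> 0) t (fun u _ => h1 u) (fun u _ => h2 u) h3).
  have := @vec_prim_compare (fun u => f u s (picard 0 u s)) (fun=> 0) C t c0 cz C00.
  rewrite z subr0; apply => u; rewrite subr0 (le_trans (fC _ _))//.
  rewrite mulrAC mulrC ler_peMr// mulr_ege1 ?expR_ge1 ?mulr_ge0 ?(ltW L0)//.
  by rewrite mulr_ege1// ler1n.
rewrite (picardS k.+1) (picardS k) opprD addrACA subrr add0r.
rewrite mulrAC.
apply: vec_prim_compare.
- exact (@fslice (picard k.+1) s (@picard_continuous k.+1)).
- exact (@fslice (picard k) s (@picard_continuous k)).
- by rewrite divr_ge0// exprn_ge0.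
move=> u; rewrite (le_trans (fL _ _ _ _))// (le_trans (ler_wpM2l (ltW L0) (IH u)))//.
rewrite le_eqVlt; apply/orP; left; apply/eqP.
by rewrite exprS invfM; set q := (2 ^+ _)^-1; set E := expR _; field.
Qed.

(** Global existence under a global Lipschitz bound.  The Picard iterates
    converge uniformly in s and locally uniformly in t, so that the solution is
    jointly continuous in time and in the parameter, which ranges over any
    topological space. *)
Lemma picard_solution : exists phi : R -> T -> 'rV[R]_m,
  [/\ jcont phi, forall s, phi 0 s = y0 s &
   forall t s j, is_derive t (1 : R) (fun u => phi u s 0 j) (f t s (phi t s) 0 j)].
Proof.
pose B (t : R) := C * expR (2 * L * `|t|).
have B0 (s : T) (t : R) : 0 <= B t by rewrite mulr_ge0 ?expR_ge0//; exact: C0 (inhabits s).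
have ex t s : exists l, forall k, `|l - picard k t s| <= 2 * B t / 2 ^+ k.
  by apply: (geometric_limit (B0 s t)) => k; exact: picard_step.
have [phi Hphi] : exists phi : R -> T -> 'rV[R]_m,
    forall t s k, `|phi t s - picard k t s| <= 2 * B t / 2 ^+ k.
  have [phi Hphi] := choice (fun z : R * T => ex z.1 z.2).
  by exists (fun t s => phi (t, s)) => t s k; exact: (Hphi (t, s)).
have phic : jcont phi.
  move=> t s; apply/cvgrPdist_lt => e e0 /=.
  pose N := `|t| + 1.
  have e30 : 0 < e / 3 by rewrite divr_gt0.
  have [k Hk] := small_pow2 (2 * B N) e30.
  have N1 : \forall z \near (t, s), `|z.1| < N.
    have : nbhs t [set u : R | `|u| < N].
      apply/nbhs_distP; exists 1 => // u ut.
      exact: norm_lt_near.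
    exact: (@cvg_fst _ _ (nbhs t) (nbhs s)).
  have N2 : \forall z \near (t, s), `|picard k t s - picard k z.1 z.2| < e / 3.
    by move/cvgrPdist_lt: (@picard_continuous k t s); apply; rewrite divr_gt0.
  have U u v : `|u| <= N -> `|phi u v - picard k u v| < e / 3.
    move=> uN; rewrite (le_lt_trans (Hphi u v k))// (le_lt_trans _ Hk)//.
    rewrite ler_wpM2r ?invr_ge0 ?exprn_ge0// ler_wpM2l// /B ler_wpM2l ?C0//.
    by rewrite ler_expR ler_wpM2l ?mulr_ge0 ?(ltW L0)// (ger0_norm (le_trans (normr_ge0 u) uN)).
  apply: filterS (filterI N1 N2) => -[u v] /= [uN n2].
  rewrite (_ : phi t s - phi u v = (phi t s - picard k t s) +
     (picard k t s - picard k u v) - (phi u v - picard k u v)); last first.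
    by rewrite [X in _ = X - _]addrA subrK opprB addrA subrK.
  have e3 : e = e / 3 + e / 3 + e / 3 by field.
  rewrite [X in _ < X]e3 (le_lt_trans (ler_normB _ _))// ltrD ?U ?(ltW uN)//.
  by rewrite (le_lt_trans (ler_normD _ _))// ltrD// U// lerDl.
(* The integral equation, as the limit of the recursion defining the iterates. *)
have E t s : phi t s = y0 s + vec_prim (fun u => f u s (phi u s)) t.
  apply/eqP; rewrite -subr_eq0 -normr_le0; apply/ler_addgt0Pr => e e0; rewrite add0r.
  have [k Hk] := small_pow2 (2 * B t) e0.
  apply: ltW; apply: le_lt_trans Hk.
  rewrite (_ : _ - _ = (phi t s - picard k.+1 t s) +
     (picard k.+1 t s - (y0 s + vec_prim (fun u => f u s (phi u s)) t))); last by rewrite addrA subrK.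
  rewrite (le_trans (ler_normD _ _))//.
  have h1 := Hphi t s k.+1.
  have h2 : `|picard k.+1 t s - (y0 s + vec_prim (fun u => f u s (phi u s)) t)| <= C / 2 ^+ k * expR (2 * L * `|t|).
    rewrite picardS opprD addrACA subrr add0r.
    apply: vec_prim_compare.
    - exact (@fslice (picard k) s (@picard_continuous k)).
    - exact (@fslice phi s phic).
    - by rewrite divr_ge0 ?C0// exprn_ge0.
    move=> u; rewrite (le_trans (fL _ _ _ _))// distrC.
    rewrite (le_trans (ler_wpM2l (ltW L0) (Hphi u s k)))// /B.
    rewrite le_eqVlt; apply/orP; left; apply/eqP.
    by set q := (2 ^+ _)^-1; set E := expR _; field.
  apply: le_trans (lerD h1 h2) _.
  rewrite le_eqVlt; apply/orP; left; apply/eqP; rewrite /B exprS invfM.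
  by set q := (2 ^+ _)^-1; set E := expR _; field.
exists phi; split => //.
  by move=> s; rewrite E vec_prim0 ?addr0//; exact (@fslice phi s phic).
move=> t s j.
have c : continuous (fun u => f u s (phi u s)) by exact (@fslice phi s phic).
have H := is_deriveD (is_derive_cst (y0 s 0 j) t (1 : R)) (vec_prim_is_derive t j c).
have -> : (fun u => phi u s 0 j) = (cst (y0 s 0 j) + (fun u => vec_prim (fun u => f u s (phi u s)) u 0 j)).
  by apply/funext => u; rewrite E mxE.
by apply: is_derive_eq H _; rewrite add0r.
Qed.

End Existence.

End Picard.

(** * Local flows of vector fields of class C^1 *)

Section Clamp.
Variables (R : realType).

(** The retraction of the line onto [c - r, c + r].  Composing a locally
    defined right-hand side with it makes [picard_solution] applicable. *)
Definition clamp (c r x : R) : R := Num.max (c - r) (Num.min (c + r) x).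

Lemma clamp_in c r x : 0 <= r -> `|clamp c r x - c| <= r.
Proof.
move=> r0; rewrite ler_distl /clamp ge_max le_max lexx /=.
by rewrite ge_min lexx andbT; lra.
Qed.

Lemma clamp_id c r x : `|x - c| <= r -> clamp c r x = x.
Proof.
rewrite ler_distl => /andP[h1 h2]; rewrite /clamp.
by rewrite (min_idPr h2) (max_idPr h1).
Qed.

Lemma clamp_lip c r x y : 0 <= r -> `|clamp c r x - clamp c r y| <= `|x - y|.
Proof.
move=> r0; wlog xy : x y / x <= y.
  by move=> H; case: (leP x y) => [/H//|/ltW /H]; rewrite distrC [in X in _ <= X]distrC.
rewrite distrC [leRHS]distrC [leRHS]ger0_norm ?subr_ge0//.
have [h1|h1] := leP (c + r) x.
  rewrite /clamp (min_idPl h1) (min_idPl (le_trans h1 xy)) subrr normr0; lra.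
rewrite {2}/clamp (min_idPr (ltW h1)).
have [h2|h2] := leP (c + r) y.
  rewrite /clamp (min_idPl h2).
  have h3 : c - r <= c + r by lra.
  rewrite (max_idPr h3); have [h4|h4] := leP (c - r) x; rewrite ger0_norm; lra.
rewrite /clamp (min_idPr (ltW h2)).
have [h3|h3] := leP (c - r) x.
  have h4 := le_trans h3 xy; rewrite (max_idPr h4) ger0_norm; lra.
have [h4|h4] := leP (c - r) y; first by rewrite ger0_norm; lra.
by rewrite subrr normr0; lra.
Qed.

Lemma lip1_continuous (V W : normedModType R) (f : V -> W) :
  (forall x y, `|f x - f y| <= `|x - y|) -> continuous f.
Proof.
move=> fl x; apply/cvgrPdist_lt => e e0 /=; apply/nbhs_distP; exists e => // y yx.
by rewrite (le_lt_trans (fl _ _))// distrC.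
Qed.

Lemma clamp_continuous c r : 0 <= r -> continuous (clamp c r).
Proof. by move=> r0; apply: (@lip1_continuous R R) => x y; exact: clamp_lip. Qed.

Definition vclamp n (c : 'rV[R]_n) (r : R) (x : 'rV[R]_n) : 'rV[R]_n :=
  \row_k clamp (c 0 k) r (x 0 k).

Lemma vclamp_in n (c : 'rV[R]_n) r x : 0 <= r -> `|vclamp c r x - c| <= r.
Proof.
by move=> r0; apply: mx_norm_le => // i j; rewrite (ord1 i) !mxE; exact: clamp_in.
Qed.

Lemma vclamp_id n (c : 'rV[R]_n) r x : `|x - c| <= r -> vclamp c r x = x.
Proof.
move=> xc; apply/rowP => k; rewrite mxE; apply: clamp_id.
by apply: le_trans xc; have := mx_norm_coord (x - c) 0 k; rewrite !mxE.
Qed.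

Lemma vclamp_lip n (c : 'rV[R]_n) r x y : 0 <= r ->
  `|vclamp c r x - vclamp c r y| <= `|x - y|.
Proof.
move=> r0; apply: mx_norm_le => // i j; rewrite (ord1 i) !mxE.
apply: le_trans (clamp_lip _ _ _ r0) _.
by have := mx_norm_coord (x - y) 0 j; rewrite !mxE.
Qed.

Lemma vclamp_continuous n (c : 'rV[R]_n) r : 0 <= r -> continuous (vclamp c r).
Proof. by move=> r0; apply: lip1_continuous => x y; exact: vclamp_lip. Qed.

Lemma ball_compact n (c : 'rV[R]_n) r : compact [set x : 'rV[R]_n | `|x - c| <= r].
Proof.
apply: bounded_closed_compact.
  exists (`|c| + r); split; first exact: num_real.
  move=> M hM x /= xc; apply: ltW; apply: le_lt_trans hM.
  have -> : x = c + (x - c) by rewrite addrC subrK.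
  by rewrite (le_trans (ler_normD _ _))// lerD2l.
rewrite (_ : [set x | _] = closed_ball_ (fun x => `|x|) c r).
  exact: closed_closed_ball_.
by apply/seteqP; split=> x /=; rewrite distrC.
Qed.

Lemma dquot_bound n (i : 'I_n) (f : 'rV[R]_n -> R) x h M :
  (forall t : R, 0 <= t <= 1 -> derivable f (x + (t * h) *: 'e_i) 'e_i /\
    `|partial i f (x + (t * h) *: 'e_i)| <= M) -> `|dquot i f x h| <= M.
Proof.
move=> H; rewrite /dquot; case: eqP => [h0|/eqP h0].
  have [|_] := H 0; first by rewrite lexx ler01.
  by rewrite mul0r scale0r addr0.
have [|t t01 ->] := @mvt_line _ _ f x 'e_i h; first by move=> t /H[].
by rewrite mulrAC divff// mul1r; have [] := H t t01.
Qed.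

Lemma ball_convex (V : normedModType R) (c x v : V) r t : 0 <= t <= 1 ->
  `|x - c| <= r -> `|x + v - c| <= r -> `|x + t *: v - c| <= r.
Proof.
move=> /andP[t0 t1] xc xvc.
have -> : x + t *: v - c = (1 - t) *: (x - c) + t *: (x + v - c).
  by rewrite [x + v - c]addrAC [t *: (_ + v)]scalerDr addrA scalerBl scale1r subrK addrAC.
rewrite (le_trans (ler_normD _ _))// !normrZ (ger0_norm t0) ger0_norm ?subr_ge0//.
rewrite (_ : r = (1 - t) * r + t * r); last by rewrite mulrBl mul1r subrK.
by rewrite lerD// ler_wpM2l// subr_ge0.
Qed.

Lemma interp_ball n (c a b : 'rV[R]_n) r j : `|a - c| <= r -> `|b - c| <= r ->
  `|interp a b j - c| <= r.
Proof.
move=> ac bc; apply: mx_norm_le => [|i k]; first exact: le_trans ac.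
rewrite (ord1 i) !mxE; case: ifP => _.
  by apply: le_trans ac; have := mx_norm_coord (a - c) 0 k; rewrite !mxE.
by apply: le_trans bc; have := mx_norm_coord (b - c) 0 k; rewrite !mxE.
Qed.

(** Hadamard's formula; the interpolating points stay in the ball, because
    the norm is the maximum norm. *)
Lemma C1_lipschitz n (f : 'rV[R]_n -> R) (c : 'rV[R]_n) r M : 0 <= M ->
  (forall x i, `|x - c| <= r -> derivable f x 'e_i /\ `|partial i f x| <= M) ->
  forall a b, `|a - c| <= r -> `|b - c| <= r -> `|f a - f b| <= n%:R * M * `|a - b|.
Proof.
move=> M0 H a b ac bc; rewrite hadamard.
apply: le_trans (ler_norm_sum _ _ _) _.
rewrite -mulrA -[X in X%:R]card_ord -sum1_card natr_sum mulr_suml.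
apply: ler_sum => j _; rewrite mul1r normrM mulrC ler_pM//.
  apply: dquot_bound => t t01; apply: H; rewrite -scalerA.
  by apply: ball_convex => //; [exact: interp_ball|rewrite -interpS; exact: interp_ball].
by have := mx_norm_coord (a - b) 0 j; rewrite !mxE.
Qed.

End Clamp.

Section LocalFlow.
Variables (R : realType).

Lemma compact_mx_bound (T : topologicalType) (K : set T) p q (f : T -> 'M[R]_(p, q)) :
  compact K -> (forall x, K x -> {for x, continuous f}) ->
  exists2 M : R, 0 <= M & forall x, K x -> `|f x| <= M.
Proof.
move=> cK fc; have [|M HM] := @compact_bound R T K (fun x => `|f x|) cK.
  by move=> x Kx; apply: (@continuous_comp _ _ _ f Num.norm); [exact: fc|exact: norm_continuous].
exists (Num.max 0 M); first by rewrite le_max lexx.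
by move=> x Kx; rewrite le_max; have := HM x Kx; rewrite normr_id => ->; rewrite orbT.
Qed.

(** The field is clamped to a closed ball of radius rho around x0, where it
    is bounded by C and Lipschitz.  A solution of the clamped equation that
    starts within rho/2 moves with speed at most C, so it stays in the ball for
    a time rho/2/(C + 1) and solves the original equation. *)
Lemma local_flow_continuous m (X : 'rV[R]_m -> 'rV[R]_m) U x0 : open U -> U x0 ->
  (forall j, Ck 1 U (fun x => X x 0 j)) ->
  exists (a r rho : R) (phi : R -> 'rV[R]_m -> 'rV[R]_m),
  [/\ 0 < a, 0 < r, (forall y, `|y - x0| <= rho -> U y),
     (forall t s, {for (t, s), continuous (fun z => phi z.1 z.2)}) &
     (forall s, phi 0 s = s) /\
     (forall t s, `|t| < a -> `|s - x0| < r -> `|phi t s - x0| < rho /\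
       forall j, is_derive t (1 : R) (fun u => phi u s 0 j) (X (phi t s) 0 j))].
Proof.
move=> oU Ux0 cX.
have [d d0 dU] : exists2 d : R, 0 < d & forall y, `|y - x0| < d -> U y.
  by apply/nbhs_distP; exact: open_nbhs_nbhs.
pose rho := d / 2; have rho0 : 0 < rho by rewrite divr_gt0.
have rhod : rho < d by rewrite ltr_pdivrMr// ltr_pMr// ltr1n.
have KU y : `|y - x0| <= rho -> U y by move=> h; apply: dU; exact: le_lt_trans rhod.
pose K := [set x : 'rV[R]_m | `|x - x0| <= rho].
have cK : compact K by exact: ball_compact.
have Xc x : U x -> {for x, continuous X}.
  by move=> Ux; apply: continuous_mx => i j; rewrite (ord1 i); exact: Ck_continuous (cX j) Ux.
have [C C0 HC] := compact_mx_bound cK (fun x Kx => Xc x (KU x Kx)).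
have [M M0 HM] : exists2 M : R, 0 <= M & forall x, K x -> `|\matrix_(i, j) partial i (fun x => X x 0 j) x| <= M.
  apply: (compact_mx_bound (f := fun x => \matrix_(i, j) partial i (fun x => X x 0 j) x)) => // x Kx.
  apply: continuous_mx => i j.
  have -> : (fun t => (\matrix_(i0, j0) partial i0 (fun x => X x 0 j0) t) i j) = partial i (fun x => X x 0 j).
    by apply/funext => t; rewrite mxE.
  by have [_ /(_ i)[_ H]] := cX j; exact: H (KU x Kx).
pose L := m%:R * M + 1.
have L1 : 1 <= L by rewrite lerDr mulr_ge0.
have XL a b : K a -> K b -> `|X a - X b| <= L * `|a - b|.
  move=> Ka Kb; apply: mx_norm_le => [|i j]; first by rewrite mulr_ge0// (le_trans ler01).
  rewrite (ord1 i) !mxE.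
  have := @C1_lipschitz R m (fun x => X x 0 j) x0 rho M M0 _ a b Ka Kb.
  move=> H; apply: le_trans (H _) _ => [x k Kx|].
    split; first by have [_ /(_ k)[H' _]] := cX j; exact: H' (KU x Kx).
    apply: le_trans (HM x Kx).
    by have := mx_norm_coord (\matrix_(i0, j0) partial i0 (fun x => X x 0 j0) x) k j; rewrite mxE.
  by rewrite ler_wpM2r// lerDl.
pose f (t : R) (s : 'rV[R]_m) (y : 'rV[R]_m) := X (vclamp x0 rho y).
have clK y : K (vclamp x0 rho y) by apply: vclamp_in; exact: ltW.
have [||||phi [phic phi0 phid]] := @picard_solution R 'rV[R]_m m f (fun s => s) L C _ _ L1.
- move=> t s y; apply: (@continuous_comp _ _ _ snd (fun y => X (vclamp x0 rho y))).
    exact: cvg_snd.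
  apply: continuous_comp; first exact: vclamp_continuous (ltW rho0) _.
  exact: Xc (KU _ (clK _)).
- by move=> x; exact: cvg_id.
- move=> t s y y'; apply: le_trans (XL _ _ (clK y) (clK y')) _.
  by rewrite ler_wpM2l ?(le_trans ler01)//; apply: vclamp_lip; exact: ltW.
- by move=> t s; apply: HC.
have C10 : 0 < C + 1 by rewrite ltr_wpDl.
pose a := rho / 2 / (C + 1); have a0 : 0 < a by rewrite !divr_gt0.
exists a, (rho / 2), rho, phi; split => //; first by rewrite divr_gt0.
split=> // t s ta sr.
have H : `|phi t s - s| <= C * `|t|.
  apply: mx_norm_le => [|i j]; first by rewrite mulr_ge0.
  rewrite (ord1 i) !mxE; have {1}-> : s 0 j = phi 0 s 0 j by rewrite phi0.
  apply: (@mvt_bound R (fun u => phi u s 0 j) (fun u => f u s (phi u s) 0 j)).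
  move=> u _; apply: le_trans (mx_norm_coord _ _ _) _; exact: HC.
have H2 : `|phi t s - x0| < rho.
  have -> : phi t s - x0 = (phi t s - s) + (s - x0) by rewrite addrA subrK.
  rewrite (le_lt_trans (ler_normD _ _))// (splitr rho) ler_ltD// (le_trans H)//.
  apply: (@le_trans _ _ ((C + 1) * a)).
    by rewrite ler_pM ?lerDl// ltW.
  by rewrite /a mulrC divfK// gt_eqF.
split=> // j; have := phid t s j.
by rewrite /f vclamp_id// ltW.
Qed.

End LocalFlow.

(** * Differentiation of solutions with respect to parameters *)

Section Quotient.
Variables (R : realType).

Lemma cont_mulmx (T : topologicalType) p q r (A : T -> 'M[R]_(p, q)) (B : T -> 'M[R]_(q, r)) x :
  {for x, continuous A} -> {for x, continuous B} ->
  {for x, continuous (fun t => A t *m B t)}.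
Proof.
move=> cA cB; apply: continuous_mx => i j.
have -> : (fun t => (A t *m B t) i j) = (fun t => \sum_k A t i k * B t k j).
  by apply/funext => t; rewrite mxE.
by apply: cont_sum => k _; apply: contM; apply: continuous_coord.
Qed.

Lemma norm_mulmx p q r (A : 'M[R]_(p, q)) (B : 'M[R]_(q, r)) :
  `|A *m B| <= q%:R * `|A| * `|B|.
Proof.
apply: mx_norm_le => [|i j]; first by rewrite !mulr_ge0.
rewrite mxE; apply: le_trans (ler_norm_sum _ _ _) _.
rewrite -mulrA -[X in X%:R]card_ord -sum1_card natr_sum mulr_suml.
apply: ler_sum => k _; rewrite mul1r normrM.
by apply: ler_pM => //; exact: mx_norm_coord.
Qed.

Lemma is_derive_sumr (I : Type) (r : seq I) (P : pred I) (V : normedModType R) (F : I -> V -> R) (dF : I -> R) x v :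
  (forall i, P i -> is_derive x v (F i) (dF i)) ->
  is_derive x v (fun y => \sum_(i <- r | P i) F i y) (\sum_(i <- r | P i) dF i).
Proof.
move=> H; elim: r => [|i r IH].
  rewrite big_nil; under eq_fun do rewrite big_nil; exact: is_derive_cst.
rewrite big_cons; under eq_fun do rewrite big_cons; case: ifPn => // Pi.
exact: (is_deriveD (H i Pi) IH).
Qed.

(** A parameter derivative of phi solves the linearised equation.  The
    hypothesis says that the increments of phi' are linear in those of phi, with
    coefficients continuous up to h = 0.  Hence the quotients
    (phi t (s + h e_i) - phi t s) / h, all starting from c0, solve the linear
    equation W' = W G + b; its solution W depends continuously on (t, s, h), and
    W at h = 0 is the derivative. *)
Lemma quotient_ode p m (phi phi' : R -> 'rV[R]_p -> 'rV[R]_m) (i : 'I_p) (a : R)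
  (B : set 'rV[R]_p) (G : R -> 'rV[R]_p -> R -> 'M[R]_m) (b : R -> 'rV[R]_p -> R -> 'rV[R]_m)
  (c0 : 'rV[R]_m) : open B ->
  (forall (t : R) s, `|t| < a -> B s -> forall j, is_derive t (1 : R) (fun u => phi u s 0 j) (phi' t s 0 j)) ->
  (forall (t : R) s (h : R), `|t| < a -> B s -> B (s + h *: 'e_i) ->
     phi' t (s + h *: 'e_i) - phi' t s =
     (phi t (s + h *: 'e_i) - phi t s) *m G t s h + h *: b t s h) ->
  (forall (t : R) s (h : R), `|t| < a -> B s -> B (s + h *: 'e_i) ->
     {for (t, s, h), continuous (fun z => G z.1.1 z.1.2 z.2)} /\
     {for (t, s, h), continuous (fun z => b z.1.1 z.1.2 z.2)}) ->
  (forall s (h : R), B s -> B (s + h *: 'e_i) -> phi 0 (s + h *: 'e_i) - phi 0 s = h *: c0) ->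
  forall (t : R) s, `|t| < a -> B s ->
    [/\ forall j, derivable (fun s => phi t s 0 j) s 'e_i,
      {for (t, s), continuous (fun z => \row_j partial i (fun s => phi z.1 s 0 j) z.2)} &
      forall j, is_derive t (1 : R) (fun u => partial i (fun s => phi u s 0 j) s)
        (((\row_j partial i (fun s => phi t s 0 j) s) *m G t s 0 + b t s 0) 0 j)].
Proof.
move=> oB dphi quo Gbc init t1 s1 t1a Bs1.
have [d d0 dB] : exists2 d : R, 0 < d & forall y, `|y - s1| < d -> B y.
  by apply/nbhs_distP; exact: open_nbhs_nbhs.
pose rho := d / 3; have rho0 : 0 < rho by rewrite divr_gt0.
have B1 s : `|s - s1| <= rho -> B s.
  by move=> H; apply: dB; rewrite (le_lt_trans H)// ltr_pdivrMr// ltr_pMr// ltr1n.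
have B2 s (h : R) : `|s - s1| <= rho -> `|h| <= rho -> B (s + h *: 'e_i).
  move=> H1 H2; apply: dB; rewrite addrAC (le_lt_trans (ler_normD _ _))//.
  apply: (@le_lt_trans _ _ (rho + rho)).
    rewrite lerD// normrZ -[leRHS]mulr1 ler_pM// norm_delta_le1//.
  have -> : d = rho + rho + rho by rewrite /rho; field.
  by rewrite ltrDl.
(* A compact neighbourhood K of (t1, s1, 0) on which the coefficients are
   bounded; clamping to it gives a linear equation with globally bounded and
   continuous coefficients. *)
pose b1 := (`|t1| + a) / 2.
have [tb1 b1a] : `|t1| < b1 /\ b1 < a by rewrite /b1; split; lra.
have b10 : 0 < b1 by exact: le_lt_trans tb1.
pose ct (t : R) := clamp 0 b1 t; pose cs s := vclamp s1 rho s; pose ch (h : R) := clamp 0 rho h.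
have ctP (t : R) : `|ct t| <= b1 by have := clamp_in 0 t (ltW b10); rewrite subr0.
have chP (h : R) : `|ch h| <= rho by have := clamp_in 0 h (ltW rho0); rewrite subr0.
have csP s : `|cs s - s1| <= rho by exact: vclamp_in (ltW rho0).
have ct_id (t : R) : `|t| <= b1 -> ct t = t by move=> H; apply: clamp_id; rewrite subr0.
have ch_id (h : R) : `|h| <= rho -> ch h = h by move=> H; apply: clamp_id; rewrite subr0.
have cs_id s : `|s - s1| <= rho -> cs s = s by exact: vclamp_id.
pose K := ([set t : R | `|t| <= b1] `*` [set s : 'rV[R]_p | `|s - s1| <= rho]) `*` [set h : R | `|h| <= rho].
have cK : compact K.
  have cI r : compact [set t : R | `|t| <= r].
    rewrite (_ : [set t | _] = `[-r, r]%classic); first exact: segment_compact.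
    by apply/seteqP; split=> x /=; rewrite in_itv /= ler_norml.
  by apply: compact_setX => //; apply: compact_setX => //; exact: ball_compact.
have Kc z : K z -> {for z, continuous (fun z => G z.1.1 z.1.2 z.2)} /\
     {for z, continuous (fun z => b z.1.1 z.1.2 z.2)}.
  move: z => [[t s] h] [[/= Kt Ks] Kh].
  by apply: Gbc; [exact: le_lt_trans b1a|exact: B1|exact: B2].
have [MG MG0 HG] := compact_mx_bound cK (fun z Kz => (Kc z Kz).1).
have [Mb Mb0 Hb] := compact_mx_bound cK (fun z Kz => (Kc z Kz).2).
have clK (t : R) s (h : R) : K ((ct t, cs s), ch h) by split; [split; [exact: ctP|exact: csP]|exact: chP].
pose f (t : R) (sh : 'rV[R]_p * R) (y : 'rV[R]_m) : 'rV[R]_m :=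
  y *m G (ct t) (cs sh.1) (ch sh.2) + b (ct t) (cs sh.1) (ch sh.2).
pose L := m%:R * MG + 1.
have L1 : 1 <= L by rewrite lerDr mulr_ge0.
pose C := m%:R * `|c0| * MG + Mb.
have cl_cont (t : R) (sh : 'rV[R]_p * R) (y : 'rV[R]_m) :
    {for (t, sh, y), continuous (fun z => (ct z.1.1, cs z.1.2.1, ch z.1.2.2))}.
  apply: continuous_pair; first apply: continuous_pair.
  - apply: (@continuous_comp _ _ _ (fun z : (R * ('rV[R]_p * R)) * 'rV[R]_m => z.1.1) ct).
      by apply: (@continuous_comp _ _ _ fst fst); exact: cvg_fst.
    exact: clamp_continuous (ltW b10) _.
  - apply: (@continuous_comp _ _ _ (fun z : (R * ('rV[R]_p * R)) * 'rV[R]_m => z.1.2.1) cs).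
      apply: (@continuous_comp _ _ _ (fun z : (R * ('rV[R]_p * R)) * 'rV[R]_m => z.1.2) fst); last exact: cvg_fst.
      by apply: (@continuous_comp _ _ _ fst snd); [exact: cvg_fst|exact: cvg_snd].
    exact: vclamp_continuous (ltW rho0) _.
  - apply: (@continuous_comp _ _ _ (fun z : (R * ('rV[R]_p * R)) * 'rV[R]_m => z.1.2.2) ch).
      apply: (@continuous_comp _ _ _ (fun z : (R * ('rV[R]_p * R)) * 'rV[R]_m => z.1.2) snd); last exact: cvg_snd.
      by apply: (@continuous_comp _ _ _ fst snd); [exact: cvg_fst|exact: cvg_snd].
    exact: clamp_continuous (ltW rho0) _.
have [||||W [Wc W0 Wd]] := @picard_solution R ('rV[R]_p * R)%type m f (fun=> c0) L C _ _ L1.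
- move=> t sh y; apply: contD.
    apply: cont_mulmx; first exact: cvg_snd.
    apply: (@continuous_comp _ _ _ _ (fun z => G z.1.1 z.1.2 z.2) _ (cl_cont t sh y)).
    exact: (Kc _ (clK _ _ _)).1.
  apply: (@continuous_comp _ _ _ _ (fun z => b z.1.1 z.1.2 z.2) _ (cl_cont t sh y)).
  exact: (Kc _ (clK _ _ _)).2.
- by move=> x; exact: cst_continuous.
- move=> t sh y y'; rewrite /f opprD addrACA subrr addr0 -mulmxBl.
  apply: le_trans (norm_mulmx _ _) _.
  rewrite mulrAC ler_wpM2r// (@le_trans _ _ (m%:R * MG))// ?lerDl//.
  by rewrite ler_wpM2l//; exact: (HG _ (clK _ _ _)).
- move=> t sh; apply: le_trans (ler_normD _ _) _; apply: lerD; last exact: (Hb _ (clK _ _ _)).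
  apply: le_trans (norm_mulmx _ _) _; rewrite ler_wpM2l ?mulr_ge0//.
  exact: (HG _ (clK _ _ _)).
(* For h <> 0 uniqueness identifies W with the difference quotient. *)
have quot (t : R) s (h : R) : `|t| <= b1 -> `|s - s1| <= rho -> `|h| <= rho -> h != 0 ->
    W t (s, h) = h^-1 *: (phi t (s + h *: 'e_i) - phi t s).
  move=> tb sr hr h0.
  pose D u := W u (s, h) - h^-1 *: (phi u (s + h *: 'e_i) - phi u s).
  pose D' u := D u *m G u s h.
  apply/eqP; rewrite -subr_eq0; apply/eqP.
  apply: (@ode_unique R m D D' L b1 (lt_le_trans ltr01 L1)) => // [u j ub|u ub|].
  - have ua : `|u| < a by exact: le_lt_trans b1a.
    have E1 := dphi u s ua (B1 s sr) j.
    have E2 := dphi u (s + h *: 'e_i) ua (B2 s h sr hr) j.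
    have E3 := @is_deriveB _ _ _ _ _ _ _ _ _ (Wd u (s, h) j) (@is_deriveZ _ _ _ _ (h^-1) _ _ _ (is_deriveB E2 E1)).
    have -> : (fun u => D u 0 j) = (fun u => W u (s, h) 0 j) - h^-1 \*: ((fun u => phi u (s + h *: 'e_i) 0 j) - (fun u => phi u s 0 j)).
      by apply/funext => v; rewrite /D !mxE.
    apply: is_derive_eq E3 _.
    have Q := quo u s h ua (B1 s sr) (B2 s h sr hr).
    have -> : phi' u (s + h *: 'e_i) 0 j - phi' u s 0 j = (phi' u (s + h *: 'e_i) - phi' u s) 0 j by rewrite !mxE.
    have -> : D' u = W u (s, h) *m G u s h - h^-1 *: ((phi u (s + h *: 'e_i) - phi u s) *m G u s h).
      by rewrite /D' /D mulmxBl scalemxAl.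
    rewrite Q /f /= (ct_id _ ub) (cs_id _ sr) (ch_id _ hr).
    rewrite [X in _ = X]mxE [X in _ - h^-1 *: X]mxE [X in X - _]mxE.
    rewrite [X in _ = _ + X]mxE [X in _ = _ - X]mxE [X in _ - h^-1 *: (_ + X)]mxE.
    rewrite scalerDr -!/(_ * _) opprD addrACA -[RHS]addr0; congr (_ + _).
    by rewrite [h^-1 *: _]mulrA mulVf// mul1r subrr.
  - rewrite /D'; apply: le_trans (norm_mulmx _ _) _.
    rewrite mulrAC ler_wpM2r// (@le_trans _ _ (m%:R * MG))// ?lerDl//.
    rewrite ler_wpM2l//.
    by have := HG ((u, s), h); apply; split.
  - by rewrite /D W0 init ?scalerA ?mulVf ?scale1r ?subrr//; [exact: B1|exact: B2].
(* The continuity of W at h = 0 is the differentiability of phi. *)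
have dW (t : R) s j : `|t| <= b1 -> `|s - s1| < rho ->
    is_derive s 'e_i (fun s => phi t s 0 j) (W t (s, 0) 0 j).
  move=> tb sr; have srw := ltW sr.
  suff H : (fun h => h^-1 *: (((fun s => phi t s 0 j) \o shift s) (h *: 'e_i) - phi t s 0 j)) @ 0^' --> W t (s, 0) 0 j.
    by apply: DeriveDef; [apply/cvg_ex; eexists; exact: H|apply/cvg_lim].
  have c : {for (0 : R), continuous (fun h : R => W t (s, h) 0 j)}.
    apply: continuous_coord.
    apply: (@continuous_comp _ _ _ (fun h : R => (t, (s, h))) (fun z => W z.1 z.2)); last exact: Wc.
    apply: continuous_pair; first exact: cst_continuous.
    by apply: continuous_pair; [exact: cst_continuous|exact: cvg_id].
  have c' : (fun h : R => W t (s, h) 0 j) @ 0^' --> W t (s, 0) 0 j.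
    by apply: cvg_within_filter; exact: c.
  apply: cvg_trans c'.
  apply: near_eq_cvg; rewrite near_withinE.
  apply/nbhs_distP; exists rho => // h; rewrite subr0 => hr h0.
  rewrite quot// ?(ltW hr)// /= [h *: _ + s]addrC.
  by rewrite !mxE.
have E (t : R) s : `|t| <= b1 -> `|s - s1| < rho ->
    \row_j partial i (fun s => phi t s 0 j) s = W t (s, 0).
  move=> tb sr; apply/rowP => j; rewrite mxE /partial.
  exact: (@derive_val _ _ _ _ _ _ _ (dW t s j tb sr)).
have tb1w := ltW tb1; have s10 : `|s1 - s1| < rho by rewrite subrr normr0.
have nt : \forall t \near t1, `|t : R| < b1.
  apply/nbhs_distP; exists (b1 - `|t1|); first by rewrite subr_gt0.
  by move=> t /norm_lt_near; rewrite addrC subrK.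
have ns : \forall s \near s1, `|s - s1| < rho by apply/nbhs_distP; exists rho.
split=> [j||j].
- by have [] := dW t1 s1 j tb1w s10.
- apply: (@continuous_near_eq _ _ (fun z : R * 'rV[R]_p => W z.1 (z.2, 0))).
    have N1 : \forall z \near (t1, s1), `|z.1 : R| < b1 by exact: (@cvg_fst _ _ (nbhs t1) (nbhs s1) _ _ nt).
    have N2 : \forall z \near (t1, s1), `|z.2 - s1| < rho by exact: (@cvg_snd _ _ (nbhs t1) (nbhs s1) _ _ ns).
    apply: filterS (filterI N1 N2) => -[t s] /= [h1 h2].
    by rewrite (E t s (ltW h1) h2).
  apply: (@continuous_comp _ _ _ (fun z : R * 'rV[R]_p => (z.1, (z.2, 0 : R))) (fun z => W z.1 z.2)); last exact: Wc.
  apply: continuous_pair; first exact: cvg_fst.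
  by apply: continuous_pair; [exact: cvg_snd|exact: cst_continuous].
- apply: (near_eq_is_derive (f := fun u => W u (s1, 0) 0 j)).
    by apply: filterS nt => t tb; rewrite -E ?mxE// ltW.
  apply: is_derive_eq (Wd t1 (s1, 0) j) _.
  have z0 : `|0 : R| <= rho by rewrite normr0 ltW.
  by rewrite /f /= (ct_id _ tb1w) (cs_id _ (ltW s10)) (ch_id _ z0) E.
Qed.

End Quotient.

(** * Time and space coordinates *)

Section TimeSpace.
Variables (R : realType) (p : nat).
Local Notation e0 := ('e_(lshift p (0 : 'I_1)) : 'rV[R]_(1 + p)).

Definition pt (t : R) (s : 'rV[R]_p) : 'rV[R]_(1 + p) := row_mx t%:M s.

(** Passing from a function of time and space to a function on R^(1 + p); it
    is inverted by [pt]. *)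
Definition hat (T : Type) (F : R -> 'rV[R]_p -> T) (z : 'rV[R]_(1 + p)) : T :=
  F (time_coord z) (space_coord z).

Lemma time_pt t s : time_coord (pt t s) = t.
Proof. by rewrite /time_coord row_mxKl mxE eqxx mulr1n. Qed.

Lemma space_pt t s : space_coord (pt t s) = s.
Proof. by rewrite /space_coord row_mxKr. Qed.

Lemma pt_time_space z : pt (time_coord z) (space_coord z) = z.
Proof. by rewrite /pt /time_coord -mx11_scalar hsubmxK. Qed.

Lemma time_e0 (z : 'rV[R]_(1 + p)) h : time_coord (h *: e0 + z) = h + time_coord z.
Proof. by rewrite /time_coord !mxE !eqxx mulr1. Qed.

Lemma space_e0 (z : 'rV[R]_(1 + p)) h : space_coord (h *: e0 + z) = space_coord z.
Proof. by apply/rowP => k; rewrite /space_coord !mxE eq_rlshift andbF mulr0 add0r. Qed.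

Lemma time_ei (z : 'rV[R]_(1 + p)) h i :
  time_coord (h *: 'e_(rshift 1 i) + z) = time_coord z.
Proof. by rewrite /time_coord !mxE eq_lrshift andbF mulr0 add0r. Qed.

Lemma space_ei (z : 'rV[R]_(1 + p)) h i :
  space_coord (h *: 'e_(rshift 1 i) + z) = h *: 'e_i + space_coord z.
Proof.
apply/rowP => k; rewrite /space_coord !mxE.
by rewrite (inj_eq (@rshift_inj _ _)).
Qed.

Lemma time_continuous : continuous (@time_coord R p).
Proof.
move=> z; rewrite /time_coord.
have -> : (fun z : 'rV[R]_(1 + p) => lsubmx z 0 0) = (fun z => z 0 (lshift p 0)).
  by apply/funext => x; rewrite mxE.
exact: coord_continuous.
Qed.

Lemma space_continuous : continuous (@space_coord R p).
Proof.
move=> z; apply: continuous_mx => i j.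
have -> : (fun z : 'rV[R]_(1 + p) => space_coord z i j) = (fun z => z i (rshift 1 j)).
  by apply/funext => x; rewrite mxE.
exact: coord_continuous.
Qed.

Lemma hat_is_derive_time (V : normedModType R) (F : R -> 'rV[R]_p -> V) z d :
  is_derive (time_coord z) (1 : R) (fun u => F u (space_coord z)) d <->
  is_derive z e0 (hat F) d.
Proof.
have E : (fun h : R => h^-1 *: ((hat F \o shift z) (h *: e0) - hat F z)) =
  (fun h : R => h^-1 *: (((fun u => F u (space_coord z)) \o shift (time_coord z)) (h *: (1 : R^o))
    - F (time_coord z) (space_coord z))).
  apply/funext => h /=; rewrite /hat time_e0 space_e0.
  by rewrite [h *: 1]mulr1.
split=> -[d1 d2]; apply: DeriveDef.
- by rewrite /derivable E.
- by rewrite /derive E.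
- by rewrite /derivable -E.
- by rewrite /derive -E.
Qed.

Lemma hat_is_derive_space (V : normedModType R) (F : R -> 'rV[R]_p -> V) z i d :
  is_derive (space_coord z) 'e_i (F (time_coord z)) d <->
  is_derive z 'e_(rshift 1 i) (hat F) d.
Proof.
have E : (fun h : R => h^-1 *: ((hat F \o shift z) (h *: 'e_(rshift 1 i)) - hat F z)) =
  (fun h : R => h^-1 *: (((F (time_coord z)) \o shift (space_coord z)) (h *: 'e_i)
    - F (time_coord z) (space_coord z))).
  by apply/funext => h /=; rewrite /hat time_ei space_ei.
split=> -[d1 d2]; apply: DeriveDef.
- by rewrite /derivable E.
- by rewrite /derive E.
- by rewrite /derivable -E.
- by rewrite /derive -E.
Qed.

Lemma partial_hat (F : R -> 'rV[R]_p -> R) z i :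
  partial (rshift 1 i) (hat F) z = partial i (F (time_coord z)) (space_coord z).
Proof.
have E : (fun h : R => h^-1 *: ((hat F \o shift z) (h *: 'e_(rshift 1 i)) - hat F z)) =
  (fun h : R => h^-1 *: (((F (time_coord z)) \o shift (space_coord z)) (h *: 'e_i)
    - F (time_coord z) (space_coord z))).
  by apply/funext => h /=; rewrite /hat time_ei space_ei.
by rewrite /partial /derive E.
Qed.

Lemma dquot_hat (F : R -> 'rV[R]_p -> R) t s i h :
  dquot i (F t) s h = dquot (rshift 1 i) (hat F) (pt t s) h.
Proof.
rewrite /dquot; case: eqP => _; first by rewrite partial_hat time_pt space_pt.
by rewrite /hat [s + _]addrC [pt t s + _]addrC time_ei space_ei time_pt space_pt.
Qed.

Lemma pt_continuous (t : R) (s : 'rV[R]_p) :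
  {for (t, s), continuous (fun z : R * 'rV[R]_p => pt z.1 z.2)}.
Proof.
apply: continuous_mx => i j; rewrite (ord1 i).
case: (split_ordP j) => k ->.
  have -> : (fun z : R * 'rV[R]_p => pt z.1 z.2 0 (lshift p k)) = fst.
    by apply/funext => z; rewrite row_mxEl (ord1 k) mxE eqxx mulr1n.
  exact: cvg_fst.
have -> : (fun z : R * 'rV[R]_p => pt z.1 z.2 0 (rshift 1 k)) = (fun z => z.2 0 k).
  by apply/funext => z; rewrite row_mxEr.
by apply: continuous_coord; exact: cvg_snd.
Qed.

Lemma hat_continuous (T : topologicalType) (F : R -> 'rV[R]_p -> T) z :
  {for z, continuous (hat F)} <->
  {for (time_coord z, space_coord z), continuous (fun w => F w.1 w.2)}.
Proof.
split=> H.
  have -> : (fun w : R * 'rV[R]_p => F w.1 w.2) = (hat F) \o (fun w => pt w.1 w.2).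
    by apply/funext => w; rewrite /hat /= time_pt space_pt.
  apply: continuous_comp; first exact: pt_continuous.
  by rewrite /= pt_time_space.
apply: (@continuous_comp _ _ _ (fun z => (time_coord z, space_coord z)) (fun w => F w.1 w.2)) => //.
by apply: continuous_pair; [exact: time_continuous|exact: space_continuous].
Qed.

Lemma pt_curve_derive (F : 'rV[R]_(1 + p) -> R) (t : R) y :
  derivable F (pt t y) 'e_(lshift p 0) ->
  is_derive t (1 : R) (fun s => F (pt s y)) (partial (lshift p 0) F (pt t y)).
Proof.
move=> dF.
have := (hat_is_derive_time (fun u s => F (pt u s)) (pt t y) (partial (lshift p 0) F (pt t y))).2.
rewrite time_pt space_pt; apply.
have -> : hat (fun u s => F (pt u s)) = F by apply/funext => w; rewrite /hat pt_time_space.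
exact: derivableP.
Qed.

End TimeSpace.

(** * Smooth dependence on initial conditions *)

Section Regularity.
Variables (R : realType).

Section Box.
Variables (p m : nat) (a : R) (B : set 'rV[R]_p).
Hypothesis oB : open B.

(** The domains of flows: small times, initial values in B. *)
Definition tube : set 'rV[R]_(1 + p) :=
  [set z | `|time_coord z| < a /\ B (space_coord z)].

Lemma tube_open : open tube.
Proof.
rewrite openE => z [z1 z2]; apply: filterI.
  have : nbhs (time_coord z) [set t : R | `|t| < a].
    apply/nbhs_distP; exists (a - `|time_coord z|); first by rewrite subr_gt0.
    by move=> t /norm_lt_near; rewrite addrC subrK.
  exact: time_continuous.
exact: (@space_continuous R p z B (open_nbhs_nbhs (conj oB z2))).
Qed.

Lemma tube_pt t s : `|t| < a -> B s -> tube (pt t s).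
Proof. by rewrite /tube /= time_pt space_pt. Qed.

Lemma dquot_hat_continuous (F : R -> 'rV[R]_p -> R) i (t : R) s (h : R) :
  Ck 1 tube (hat F) -> `|t| < a -> B s -> B (s + h *: 'e_i) ->
  {for (t, s, h), continuous (fun z => dquot i (F z.1.1) z.1.2 z.2)}.
Proof.
move=> [cF dF] ta Bs Bsh.
have -> : (fun z : R * 'rV[R]_p * R => dquot i (F z.1.1) z.1.2 z.2) =
  (fun w => dquot (rshift 1 i) (hat F) w.1 w.2) \o
  (fun z : R * 'rV[R]_p * R => (pt z.1.1 z.1.2, z.2)).
  by apply/funext => z; rewrite /= dquot_hat.
apply: continuous_comp.
  apply: continuous_pair; last exact: cvg_snd.
  apply: (@continuous_comp _ _ _ fst (fun w : R * 'rV[R]_p => pt w.1 w.2)).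
    exact: cvg_fst.
  exact: pt_continuous.
apply: (@dquot_continuous _ _ tube) => /=.
- exact: tube_open.
- exact: tube_pt.
- rewrite /tube /= addrC time_ei space_ei time_pt space_pt.
  by split=> //; rewrite addrC.
- exact: cF.
- exact: (dF (rshift 1 i)).1.
- by apply: (dF (rshift 1 i)).2; exact: tube_pt.
Qed.

(** Solutions of a linear equation are as regular as its coefficients.  The
    time derivative is given by the equation; a space derivative solves, by
    [quotient_ode], a linear equation with the same matrix and a source of class
    one less, so induction applies to it. *)
Lemma linear_ode_Ck k (psi : R -> 'rV[R]_p -> 'rV[R]_m) (A : R -> 'rV[R]_p -> 'M[R]_m)
   (b : R -> 'rV[R]_p -> 'rV[R]_m) (c0 : 'rV[R]_m) :
  (forall z, tube z -> {for z, continuous (hat psi)}) ->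
  (forall (t : R) s, `|t| < a -> B s -> forall j,
     is_derive t (1 : R) (fun u => psi u s 0 j) ((psi t s *m A t s + b t s) 0 j)) ->
  (forall s, B s -> psi 0 s = c0) ->
  (forall l j, Ck k tube (hat (fun t s => A t s l j))) ->
  (forall j, Ck k tube (hat (fun t s => b t s 0 j))) ->
  forall j, Ck k tube (hat (fun t s => psi t s 0 j)).
Proof.
elim: k psi b c0 => [|k IH] psi b c0 psic dpsi psi0 cA cb j.
  by move=> z tz; exact: continuous_coord (psic z tz).
have oD := tube_open.
have cpsi l : Ck k tube (hat (fun t s => psi t s 0 l)).
  by apply: (IH psi b c0) => // *; exact: Ck_pred.
have cj z i : tube z -> {for z, continuous (hat (fun t s => psi t s 0 i))}.
  by move=> tz; exact: continuous_coord (psic z tz).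
have C1 F : Ck k.+1 tube F -> Ck 1 tube F by exact: Ck_le.
have Q i (t : R) s : `|t| < a -> B s ->
    [/\ forall j, derivable (fun s => psi t s 0 j) s 'e_i,
      {for (t, s), continuous (fun z => \row_j partial i (fun s => psi z.1 s 0 j) z.2)} &
      forall j, is_derive t (1 : R) (fun u => partial i (fun s => psi u s 0 j) s)
        (((\row_j partial i (fun s => psi t s 0 j) s) *m A t s +
         (psi t s *m (\matrix_(l, j) partial i (fun s => A t s l j) s)
          + \row_j partial i (fun s => b t s 0 j) s)) 0 j)].
  move=> ta Bs.
  have := @quotient_ode R p m psi (fun t s => psi t s *m A t s + b t s) i a B
    (fun t s h => A t (s + h *: 'e_i))
    (fun t s h => psi t s *m (\matrix_(l, j) dquot i (fun s => A t s l j) s h)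
       + \row_j dquot i (fun s => b t s 0 j) s h) 0 oB dpsi.
  case/(_ _ _ _ t s ta Bs)/wrap.
  - move=> u v h ua Bv Bvh.
    have EA : A u (v + h *: 'e_i) - A u v = h *: (\matrix_(l, j) dquot i (fun s => A u s l j) v h).
      by apply/matrixP => l q; rewrite !mxE -dquotE.
    have Eb : b u (v + h *: 'e_i) - b u v = h *: (\row_j dquot i (fun s => b u s 0 j) v h).
      by apply/rowP => q; rewrite !mxE -dquotE.
    rewrite scalerDr scalemxAr -EA -Eb mulmxBl mulmxBr opprD addrACA.
    by rewrite [RHS]addrA [X in _ = X + _]addrA subrK.
  - move=> u v h ua Bv Bvh; split.
      apply: continuous_mx => l q.
      have -> : (fun z : R * 'rV[R]_p * R => A z.1.1 (z.1.2 + z.2 *: 'e_i) l q) =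
        (fun w => A w.1 w.2 l q) \o (fun z => (z.1.1, z.1.2 + z.2 *: 'e_i)) by [].
      apply: continuous_comp.
        apply: continuous_pair.
          by apply: (@continuous_comp _ _ _ fst fst); exact: cvg_fst.
        apply: contD.
          by apply: (@continuous_comp _ _ _ fst snd); [exact: cvg_fst|exact: cvg_snd].
        by apply: contZ; [exact: cvg_snd|exact: cst_continuous].
      have := @Ck_continuous _ _ _ _ _ (pt u (v + h *: 'e_i)) (cA l q) (tube_pt ua Bvh).
      by move/hat_continuous; rewrite time_pt space_pt.
    apply: contD.
      apply: cont_mulmx.
        apply: (@continuous_comp _ _ _ fst (fun w : R * 'rV[R]_p => psi w.1 w.2)).
          exact: cvg_fst.
        have := psic (pt u v) (tube_pt ua Bv).
        by move/hat_continuous; rewrite time_pt space_pt.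
      apply: continuous_mx => l q.
      have -> : (fun z : R * 'rV[R]_p * R => (\matrix_(l, j) dquot i (fun s => A z.1.1 s l j) z.1.2 z.2) l q) =
         (fun z => dquot i ((fun t s => A t s l q) z.1.1) z.1.2 z.2).
        by apply/funext => z; rewrite mxE.
      apply: (@dquot_hat_continuous (fun t s => A t s l q)) => //; exact: C1.
    apply: continuous_mx => l q.
    have -> : (fun z : R * 'rV[R]_p * R => (\row_j dquot i (fun s => b z.1.1 s 0 j) z.1.2 z.2) l q) =
         (fun z => dquot i ((fun t s => b t s 0 q) z.1.1) z.1.2 z.2).
      by apply/funext => z; rewrite mxE.
    by apply: (@dquot_hat_continuous (fun t s => b t s 0 q)) => //; exact: C1.
  - by move=> v h Bv Bvh; rewrite !psi0// subrr scaler0.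
  move=> [d1 d2 d3]; split => //.
  move=> l; have := d3 l; rewrite scale0r addr0.
  have -> : (\matrix_(l0, j0) dquot i (fun s0 => A t s0 l0 j0) s 0) = \matrix_(l0, j0) partial i (fun s => A t s l0 j0) s.
    by apply/matrixP => l0 j0; rewrite !mxE /dquot eqxx.
  have -> : (\row_j0 dquot i (fun s0 => b t s0 0 j0) s 0) = \row_j0 partial i (fun s => b t s 0 j0) s.
    by apply/rowP => j0; rewrite !mxE /dquot eqxx.
  by [].
split=> [|idx]; first by move=> z tz; exact: cj.
case: (split_ordP idx) => i ->.
  have d z : tube z -> is_derive z 'e_(lshift p i) (hat (fun t s => psi t s 0 j))
      (hat (fun t s => (psi t s *m A t s + b t s) 0 j) z).
    move=> [tz Bz]; rewrite (ord1 i); apply/hat_is_derive_time.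
    exact: (dpsi _ _ tz Bz j).
  split=> [z tz|]; first by have [] := d z tz.
  apply: (@Ck_eq _ _ _ _ (fun z => \sum_l hat (fun t s => psi t s 0 l) z * hat (fun t s => A t s l j) z + hat (fun t s => b t s 0 j) z)) => //.
    move=> z tz; rewrite /partial (@derive_val _ _ _ _ _ _ _ (d z tz)).
    by rewrite /hat !mxE.
  apply: CkD => //; last exact: Ck_pred.
  by apply: Ck_sum => // l _; apply: CkM => //; exact: Ck_pred.
split=> [z [tz Bz]|].
  have [d1 _ _] := Q i _ _ tz Bz.
  by have [] := (hat_is_derive_space (fun t s => psi t s 0 j) z i _).1 (derivableP (d1 j)).
pose psi' (t : R) s : 'rV[R]_m := \row_j partial i (fun s => psi t s 0 j) s.
apply: (@Ck_eq _ _ _ _ (hat (fun t s => psi' t s 0 j))) => //.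
  by move=> z tz; rewrite partial_hat /hat mxE.
apply: (IH psi' (fun t s => psi t s *m (\matrix_(l, j) partial i (fun s => A t s l j) s)
          + \row_j partial i (fun s => b t s 0 j) s) 0).
- move=> z [tz Bz]; apply/hat_continuous.
  by have [] := Q i _ _ tz Bz.
- move=> t s ta Bs l; have [_ _ /(_ l)] := Q i t s ta Bs.
  by move=> H; under eq_fun do rewrite mxE.
- move=> s Bs; apply/rowP => l; rewrite !mxE.
  rewrite /partial (@near_eq_derive _ _ _ _ (fun=> c0 0 l)).
    by rewrite derive_cst.
  by apply: (near_open oB Bs) => y By; rewrite psi0.
- by move=> l q; exact: Ck_pred.
move=> l.
apply: (@Ck_eq _ _ _ _ (fun z => \sum_q hat (fun t s => psi t s 0 q) z * partial (rshift 1 i) (hat (fun t s => A t s q l)) z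
   + partial (rshift 1 i) (hat (fun t s => b t s 0 l)) z)) => //.
  move=> z tz; rewrite /hat !mxE; congr (_ + _); last by rewrite -(partial_hat (fun t s => b t s 0 l)).
  by apply: eq_bigr => q _; rewrite mxE -(partial_hat (fun t s => A t s q l)).
apply: CkD => //; last exact: ((cb l).2 (rshift 1 i)).2.
apply: Ck_sum => // q _; apply: CkM => //.
exact: ((cA q l).2 (rshift 1 i)).2.
Qed.

End Box.
End Regularity.

Section SmoothFlow.
Variables (R : realType).

(** The flow of a smooth vector field is smooth in time and initial value.
    Hadamard's formula applied to the field puts the increments of the flow in
    the form required by [quotient_ode]; the derivative in the initial value
    then solves the linear variational equation, whose coefficients are as
    regular as the flow itself, and [linear_ode_Ck] gains one order at a time. *)
Lemma smooth_flow m (X : 'rV[R]_m -> 'rV[R]_m) U x0 : open U -> U x0 ->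
  (forall k j, Ck k U (fun x => X x 0 j)) ->
  exists (a r : R) (Phi : 'rV[R]_(1 + m) -> 'rV[R]_m),
  let D := tube a [set s | `|s - x0| < r] in
  [/\ 0 < a, 0 < r, (forall k j, Ck k D (fun z => Phi z 0 j)),
     (forall s, Phi (pt 0 s) = s) &
     forall z, D z -> U (Phi z) /\
       forall j, partial (lshift m 0) (fun z => Phi z 0 j) z = X (Phi z) 0 j].
Proof.
move=> oU Ux0 cX.
have [a [r [rho [phi [a0 r0 rhoU phic [phi0 phid]]]]]] := local_flow_continuous oU Ux0 (cX 1%N).
pose B := [set s : 'rV[R]_m | `|s - x0| < r].
have oB : open B by exact: norm_ball_open.
pose U' := [set y : 'rV[R]_m | `|y - x0| < rho].
have oU' : open U' by exact: norm_ball_open.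
have U'U : U' `<=` U by move=> y /ltW /rhoU.
have cX' k j : Ck k U' (fun x => X x 0 j) by exact: Ck_sub (cX k j).
have oD := @tube_open R m a B oB.
(* Hadamard's matrix of the field: X x - X y = (x - y) H x y. *)
pose H (x y : 'rV[R]_m) : 'M[R]_m := \matrix_(l, j) dquot l (fun x => X x 0 j) (interp x y l) (x 0 l - y 0 l).
have HX x y : X x - X y = (x - y) *m H x y.
  apply/rowP => j; rewrite !mxE [LHS](hadamard (fun x => X x 0 j) x y); apply: eq_bigr => l _.
  by rewrite !mxE.
have Hd x : H x x = \matrix_(l, j) partial l (fun x => X x 0 j) x.
  apply/matrixP => l j; rewrite !mxE subrr /dquot eqxx; congr (partial _ _ _).
  by apply/rowP => q; rewrite mxE; case: ifP.
have Hc x y : U' x -> U' y -> {for (x, y), continuous (fun w => H w.1 w.2)}.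
  move=> Ux Uy; apply: continuous_mx => l j.
  have -> : (fun w : 'rV[R]_m * 'rV[R]_m => H w.1 w.2 l j) =
     (fun v => dquot l (fun x => X x 0 j) v.1 v.2) \o (fun w => (interp w.1 w.2 l, w.1 0 l - w.2 0 l)).
    by apply/funext => w; rewrite mxE.
  pose q := Num.max `|x - x0| `|y - x0|.
  have xq : `|x - x0| <= q by rewrite le_max lexx.
  have yq : `|y - x0| <= q by rewrite le_max lexx orbT.
  have qr : q < rho by rewrite gt_max Ux Uy.
  have mU n : U' (interp x y n) by apply: le_lt_trans qr; exact: interp_ball.
  apply: continuous_comp.
    apply: continuous_pair.
      by apply: continuous_interp; [exact: cvg_fst|exact: cvg_snd].
    by apply: contB; apply: continuous_coord; [exact: cvg_fst|exact: cvg_snd].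
  apply: (@dquot_continuous _ _ U') => //=.
  - by rewrite -interpS.
  - by move=> z; exact: Ck_continuous (cX' 0%N j).
  - by move=> z; exact: ((cX' 1%N j).2 l).1.
  - by have := ((cX' 1%N j).2 l).2; apply.
have Q i (t : R) s : `|t| < a -> B s ->
    [/\ forall j, derivable (fun s => phi t s 0 j) s 'e_i,
      {for (t, s), continuous (fun z => \row_j partial i (fun s => phi z.1 s 0 j) z.2)} &
      forall j, is_derive t (1 : R) (fun u => partial i (fun s => phi u s 0 j) s)
        (((\row_j partial i (fun s => phi t s 0 j) s) *m
          (\matrix_(l, j) partial l (fun x => X x 0 j) (phi t s)) + 0) 0 j)].
  move=> ta Bs.
  have := @quotient_ode R m m phi (fun t s => X (phi t s)) i a B
    (fun t s h => H (phi t (s + h *: 'e_i)) (phi t s)) (fun _ _ _ => 0) 'e_i oB.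
  case/(_ _ _ _ _ t s ta Bs)/wrap.
  - by move=> u v ua Bv j; have [_] := phid u v ua Bv; exact.
  - by move=> u v h ua Bv Bvh; rewrite scaler0 addr0; exact: HX.
  - move=> u v h ua Bv Bvh; split; last exact: cst_continuous.
    have c2 : {for (u, v, h), continuous (fun z : R * 'rV[R]_m * R => phi z.1.1 z.1.2)}.
      apply: (@continuous_comp _ _ _ fst (fun w : R * 'rV[R]_m => phi w.1 w.2)).
        exact: cvg_fst.
      exact: phic.
    have c1 : {for (u, v, h), continuous (fun z : R * 'rV[R]_m * R => phi z.1.1 (z.1.2 + z.2 *: 'e_i))}.
      apply: (@continuous_comp _ _ _ (fun z : R * 'rV[R]_m * R => (z.1.1, z.1.2 + z.2 *: 'e_i)) (fun w : R * 'rV[R]_m => phi w.1 w.2)); last exact: phic.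
      apply: continuous_pair.
        by apply: (@continuous_comp _ _ _ fst fst); exact: cvg_fst.
      apply: contD.
        by apply: (@continuous_comp _ _ _ fst snd); [exact: cvg_fst|exact: cvg_snd].
      by apply: contZ; [exact: cvg_snd|exact: cst_continuous].
    apply: (@continuous_comp _ _ _ _ (fun w => H w.1 w.2) _ (continuous_pair c1 c2)).
    apply: Hc => /=.
      by have [] := phid u _ ua Bvh.
    by have [] := phid u _ ua Bv.
  - by move=> v h Bv Bvh; rewrite !phi0 addrC addKr.
  move=> [d1 d2 d3]; split => // j; have := d3 j.
  by rewrite scale0r !addr0 Hd.
(* The step from k to k + 1: the time derivative of the flow is X o phi, and
   its derivatives in the initial value solve the variational equation. *)
have main k : forall j, Ck k (tube a B) (hat (fun t s => phi t s 0 j)).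
  elim: k => [|k IH] j.
    move=> z tz; apply/hat_continuous.
    by apply: continuous_coord; exact: phic.
  split=> [z tz|idx].
    by apply/hat_continuous; apply: continuous_coord; exact: phic.
  have hphi z : tube a B z -> U' (hat phi z) by move=> [tz Bz]; have [] := phid _ _ tz Bz.
  have cXphi f : Ck k U' f -> Ck k (tube a B) (f \o hat phi).
    by move=> cf; apply: Ck_comp oU' oD hphi cf _ => l; exact: IH.
  case: (split_ordP idx) => i ->.
    have d z : tube a B z -> is_derive z 'e_(lshift m i) (hat (fun t s => phi t s 0 j))
        (hat (fun t s => X (phi t s) 0 j) z).
      move=> [tz Bz]; rewrite (ord1 i); apply/hat_is_derive_time.
      by have [_ H1] := phid _ _ tz Bz; exact: H1.
    split=> [z tz|]; first by have [] := d z tz.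
    apply: (@Ck_eq _ _ _ _ ((fun x => X x 0 j) \o hat phi)) => //.
      by move=> z tz; rewrite /partial (@derive_val _ _ _ _ _ _ _ (d z tz)).
    exact: cXphi.
  split=> [z [tz Bz]|].
    have [d1 _ _] := Q i _ _ tz Bz.
    by have [] := (hat_is_derive_space (fun t s => phi t s 0 j) z i _).1 (derivableP (d1 j)).
  pose psi (t : R) s : 'rV[R]_m := \row_j partial i (fun s => phi t s 0 j) s.
  apply: (@Ck_eq _ _ _ _ (hat (fun t s => psi t s 0 j))) => //.
    by move=> z tz; rewrite partial_hat /hat mxE.
  have L := @linear_ode_Ck R m m a B oB k psi (fun t s => \matrix_(l, j) partial l (fun x => X x 0 j) (phi t s)) (fun _ _ => 0) 'e_i.
  apply: L => //.
  - move=> z [tz Bz]; apply/hat_continuous.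
    by have [] := Q i _ _ tz Bz.
  - move=> t s ta Bs l; have [_ _ /(_ l)] := Q i t s ta Bs.
    by move=> H1; under eq_fun do rewrite mxE.
  - move=> s Bs; apply/rowP => l; rewrite mxE.
    have -> : (fun s => phi 0 s 0 l) = (fun s => s 0 l) by apply/funext => y; rewrite phi0.
    by rewrite partial_coord mxE eqxx eq_sym.
  - move=> l q; apply: (@Ck_eq _ _ _ _ (partial l (fun x => X x 0 q) \o hat phi)) => //.
      by move=> z tz; rewrite /hat /= mxE.
    by apply: cXphi; exact: ((cX' k.+1 q).2 l).2.
  - move=> l; apply: (@Ck_eq _ _ _ _ (fun=> 0)) => //; last exact: Ck_cst.
    by move=> z _; rewrite /hat mxE.
exists a, r, (hat phi); split => //.
  by move=> s; rewrite /hat time_pt space_pt phi0.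
move=> z [tz Bz]; have [h1 h2] := phid _ _ tz Bz; split; first exact: U'U.
move=> j; have d := (hat_is_derive_time (fun t s => phi t s 0 j) z _).1 (h2 j).
by rewrite /partial (@derive_val _ _ _ _ _ _ _ d).
Qed.

End SmoothFlow.

(** * Primitives depending on parameters and the Poincare lemma *)

Section FlowApps.
Variables (R : realType).

Definition smooth_map n m (U : set 'rV[R]_n) (g : 'rV[R]_n -> 'rV[R]_m) : Prop :=
  forall k j, Ck k U (fun x => g x 0 j).

Lemma smooth_map_comp n m p (U : set 'rV[R]_n) (V : set 'rV[R]_m) (f : 'rV[R]_n -> 'rV[R]_p)
    (g : 'rV[R]_m -> 'rV[R]_n) : open U -> open V -> (forall x, V x -> U (g x)) ->
  smooth_map U f -> smooth_map V g -> smooth_map V (f \o g).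
Proof.
by move=> oU oV VU sf sg k j; apply: (Ck_comp oU oV VU (sf k j)) => l; exact: sg.
Qed.

Lemma smooth_map_continuous n m (U : set 'rV[R]_n) (f : 'rV[R]_n -> 'rV[R]_m) x :
  smooth_map U f -> U x -> {for x, continuous f}.
Proof.
by move=> sf Ux; apply: continuous_mx => i j; rewrite (ord1 i); exact: Ck_continuous (sf 0%N j) Ux.
Qed.

Lemma det_Ck n k m (U : set 'rV[R]_n) (A : 'rV[R]_n -> 'M[R]_m) : open U ->
  (forall i j, Ck k U (fun x => A x i j)) -> Ck k U (fun x => \det (A x)).
Proof.
move=> oU cA; rewrite /determinant.
apply: Ck_sum => // s _; apply: CkM => //; first exact: Ck_cst.
by apply: Ck_prod => // i _.
Qed.

Lemma invmx_Ck n k m (U : set 'rV[R]_n) (A : 'rV[R]_n -> 'M[R]_m) : open U ->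
  (forall x, U x -> A x \in unitmx) ->
  (forall i j, Ck k U (fun x => A x i j)) ->
  forall i j, Ck k U (fun x => invmx (A x) i j).
Proof.
move=> oU uA cA i j.
apply: (@Ck_eq _ _ _ _ (fun x => (\det (A x))^-1 * ((-1) ^+ (j + i) * \det (row' j (col' i (A x)))))) => //.
  by move=> x Ux; rewrite /invmx (uA x Ux) !mxE.
apply: CkM => //.
  apply: CkV => //; last exact: det_Ck.
  by move=> x /uA; rewrite unitmxE unitfE.
apply: CkM => //; first exact: Ck_cst.
apply: det_Ck => // p q.
by apply: Ck_eq (cA (lift j p) (lift i q)) => // x _; rewrite !mxE.
Qed.

(** W t s is the integral of f(u, s) over u in [0, t].  It is obtained as the
    last component of the flow of the field (e_0, f) on R^(1 + n) x R, which
    makes its smoothness a case of [smooth_flow]. *)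
Lemma param_prim n (U : set 'rV[R]_(1 + n)) (f : 'rV[R]_(1 + n) -> R) : open U -> U 0 ->
  (forall k, Ck k U f) ->
  exists (a r : R) (W : 'rV[R]_(1 + n) -> R),
  let D := tube a [set s | `|s| < r] in
  [/\ 0 < a, 0 < r, (forall k, Ck k D W), (forall s, W (pt 0 s) = 0) &
     forall z, D z -> U z /\ partial (lshift n 0) W z = f z].
Proof.
move=> oU U0 cf.
pose X (z : 'rV[R]_((1 + n) + 1)) : 'rV[R]_((1 + n) + 1) :=
  row_mx 'e_(lshift n 0) (f (lsubmx z))%:M.
pose U1 := [set z : 'rV[R]_((1 + n) + 1) | U (lsubmx z)].
have sl (V : set 'rV[R]_((1 + n) + 1)) : smooth_map V (@lsubmx R 1 (1 + n) 1).
  move=> k j; have -> : (fun x : 'rV[R]_((1 + n) + 1) => lsubmx x 0 j) = (fun x => x 0 (lshift 1 j)).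
    by apply/funext => x; rewrite mxE.
  exact: Ck_coord.
have oU1 : open U1.
  have := @open_preimage _ _ setT U (@lsubmx R 1 (1 + n) 1) openT oU (fun x _ => smooth_map_continuous (sl setT) I).
  by congr open; apply/seteqP; split=> x //= [].
have sX k j : Ck k U1 (fun z => X z 0 j).
  case: (split_ordP j) => l ->.
    apply: (@Ck_eq _ _ _ _ (fun=> ('e_(lshift n 0) : 'rV[R]_(1 + n)) 0 l)) => //; last exact: Ck_cst.
    by move=> z _; rewrite row_mxEl.
  apply: (@Ck_eq _ _ _ _ (f \o (@lsubmx R 1 (1 + n) 1))) => //.
    by move=> z _; rewrite row_mxEr (ord1 l) mxE eqxx mulr1n.
  apply: (Ck_comp oU oU1) => //; exact: sl.
have U10 : U1 0 by rewrite /U1 /= linear0.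
have [a [r [Phi [a0 r0 sPhi Phi0 dPhi]]]] := smooth_flow oU1 U10 sX.
(* The flow is started at time 0 of the point (0, s), with last component 0. *)
pose emb (z : 'rV[R]_(1 + n)) : 'rV[R]_(1 + ((1 + n) + 1)) :=
  pt (time_coord z) (row_mx (pt 0 (space_coord z)) 0).
pose D := tube a [set s : 'rV[R]_n | `|s| < r].
have oD : open D.
  by apply: tube_open; exact: origin_ball_open.
have embD z : D z -> tube a [set s | `|s - 0| < r] (emb z).
  move=> [tz sz]; rewrite /emb; apply: tube_pt => //=; rewrite subr0.
  apply: mx_norm_lt => // i j; rewrite (ord1 i).
  case: (split_ordP j) => l ->; last by rewrite row_mxEr mxE normr0.
  rewrite row_mxEl; case: (split_ordP l) => q ->.
    by rewrite row_mxEl (ord1 q) mxE eqxx mulr1n normr0.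
  by rewrite row_mxEr; apply: le_lt_trans sz; exact: mx_norm_coord.
have semb : smooth_map D emb.
  move=> k j; case: (split_ordP j) => l ->.
    apply: (@Ck_eq _ _ _ _ (fun z => z 0 (lshift n 0))) => //; last exact: Ck_coord.
    by move=> z _; rewrite row_mxEl (ord1 l) mxE eqxx mulr1n /time_coord mxE.
  case: (split_ordP l) => q ->; last first.
    apply: (@Ck_eq _ _ _ _ (fun=> 0)) => //; last exact: Ck_cst.
    by move=> z _; rewrite row_mxEr row_mxEr mxE.
  case: (split_ordP q) => v ->.
    apply: (@Ck_eq _ _ _ _ (fun=> 0)) => //; last exact: Ck_cst.
    by move=> z _; rewrite row_mxEr row_mxEl row_mxEl (ord1 v) mxE eqxx mulr1n.
  apply: (@Ck_eq _ _ _ _ (fun z => z 0 (rshift 1 v))) => //; last exact: Ck_coord.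
  by move=> z _; rewrite row_mxEr row_mxEl row_mxEr /space_coord mxE.
pose W z := Phi (emb z) 0 (rshift (1 + n) 0).
have oD' : open (tube a [set s : 'rV[R]_((1 + n) + 1) | `|s - 0| < r]).
  by apply: tube_open; exact: norm_ball_open.
exists a, r, W; split => //.
- by move=> k; apply: (Ck_comp oD' oD embD (sPhi k _)) => j; exact: semb.
- by move=> s; rewrite /W /emb time_pt Phi0 row_mxEr mxE.
move=> z Dz.
have cur (u : R) j : `|u| < a -> is_derive u (1 : R)
    (fun u => Phi (emb (pt u (space_coord z))) 0 j) (X (Phi (emb (pt u (space_coord z)))) 0 j).
  move=> ua; pose w := pt u (space_coord z).
  have Dw : D w by apply: tube_pt => //; exact: Dz.2.
  have [_ dw] := dPhi _ (embD w Dw).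
  have dd : derivable (fun z => Phi z 0 j) (emb w) 'e_(lshift _ 0).
    by have [_ /(_ (lshift _ 0))[H _]] := sPhi 1%N j; apply: H; exact: embD.
  have Et : time_coord (emb w) = u by rewrite /emb time_pt /w time_pt.
  rewrite -(pt_time_space (emb w)) in dd.
  have H := pt_curve_derive dd.
  rewrite pt_time_space Et dw in H.
  have -> : (fun u => Phi (emb (pt u (space_coord z))) 0 j) =
     (fun u => Phi (pt u (space_coord (emb w))) 0 j).
    by apply/funext => v; rewrite /emb /w !time_pt !space_pt.
  exact: H.
(* The first components of the flow run through (u, s). *)
have left0 (u : R) : `|u| < a -> lsubmx (Phi (emb (pt u (space_coord z)))) = pt u (space_coord z).
  move=> ua; apply/rowP => j; rewrite mxE.
  apply: (@eq_prim R (fun u => Phi (emb (pt u (space_coord z))) 0 (lshift 1 j))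
    (fun u => pt u (space_coord z) 0 j) (fun=> ('e_(lshift n 0) : 'rV[R]_(1 + n)) 0 j)) => [s su|s su|].
  - have := cur s (lshift 1 j) (le_lt_trans su ua).
    by rewrite /X row_mxEl.
  - case: (split_ordP j) => q ->.
      have -> : (fun u => pt u (space_coord z) 0 (lshift n q)) = @id R.
        by apply/funext => v; rewrite row_mxEl (ord1 q) mxE eqxx mulr1n.
      by rewrite (ord1 q) mxE !eqxx; exact: is_derive_id.
    have -> : (fun u => pt u (space_coord z) 0 (rshift 1 q)) = cst (space_coord z 0 q).
      by apply/funext => v; rewrite row_mxEr.
    have -> : ('e_(lshift n 0) : 'rV[R]_(1 + n)) 0 (rshift 1 q) = 0.
      by rewrite mxE eq_rlshift andbF.
    exact: is_derive_cst.
  - by rewrite /emb time_pt space_pt Phi0 row_mxEl.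
have tz : `|time_coord z| < a by exact: Dz.1.
have := cur (time_coord z) (rshift (1 + n) 0) tz.
rewrite /X row_mxEr (left0 _ tz) pt_time_space mxE eqxx mulr1n => H.
split.
  have [+ _] := dPhi _ (embD z Dz); rewrite /U1 /=.
  by rewrite -{1}(pt_time_space z) left0// pt_time_space.
have := (hat_is_derive_time (fun u s => Phi (emb (pt u s)) 0 (rshift (1 + n) 0)) z _).1 H.
have -> : hat (fun u s => Phi (emb (pt u s)) 0 (rshift (1 + n) 0)) = W.
  by apply/funext => w; rewrite /hat pt_time_space.
by move=> d; rewrite /partial (@derive_val _ _ _ _ _ _ _ d).
Qed.

End FlowApps.

Section Poincare.
Variables (R : realType).

Lemma tube_eq n a (B : set 'rV[R]_n) (f g : 'rV[R]_(1 + n) -> R) :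
  (forall z, tube a B z -> derivable f z 'e_(lshift n 0)) ->
  (forall z, tube a B z -> derivable g z 'e_(lshift n 0)) ->
  (forall z, tube a B z -> partial (lshift n 0) f z = partial (lshift n 0) g z) ->
  (forall s, B s -> f (pt 0 s) = g (pt 0 s)) ->
  forall z, tube a B z -> f z = g z.
Proof.
move=> df dg dfg fg z [tz Bz].
have H (h : 'rV[R]_(1 + n) -> R) : (forall z, tube a B z -> derivable h z 'e_(lshift n 0)) ->
    forall u : R, `|u| <= `|time_coord z| ->
    is_derive u (1 : R) (fun u => h (pt u (space_coord z))) (partial (lshift n 0) h (pt u (space_coord z))).
  move=> dh u uz.
  by apply: pt_curve_derive; apply: dh; apply: tube_pt => //; exact: le_lt_trans tz.
have := @eq_prim R (fun u => f (pt u (space_coord z))) (fun u => g (pt u (space_coord z)))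
   (fun u => partial (lshift n 0) f (pt u (space_coord z))) (time_coord z) (H f df).
rewrite pt_time_space; apply; last exact: fg.
move=> s sz; rewrite dfg; last by apply: tube_pt => //; exact: le_lt_trans tz.
exact: H.
Qed.

(** The primitive is the integral of om along segments,
    th(x0 + t s) = integral over u in [0, t] of sum_j s_j om_j(x0 + u s).
    Closedness of om enters in the computation of its derivative in s, which is
    t om(x0 + t s). *)
Lemma poincare n (U : set 'rV[R]_n) (om : 'rV[R]_n -> 'rV[R]_n) x0 : open U -> U x0 ->
  smooth_map U om ->
  (forall x i j, U x -> partial i (fun y => om y 0 j) x = partial j (fun y => om y 0 i) x) ->
  exists (V : set 'rV[R]_n) (th : 'rV[R]_n -> R),
  [/\ open V, V x0, V `<=` U & [/\ (forall k, Ck k V th), th x0 = 0 &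
    forall x i, V x -> partial i th x = om x 0 i]].
Proof.
move=> oU Ux0 som closed.
pose aff (z : 'rV[R]_(1 + n)) := x0 + time_coord z *: space_coord z.
have affE l : (fun z => aff z 0 l) = (fun z => x0 0 l + z 0 (lshift n 0) * z 0 (rshift 1 l)).
  by apply/funext => z; rewrite /aff /time_coord /space_coord !mxE.
have saff V : open V -> smooth_map V aff.
  move=> oV k j; rewrite affE; apply: CkD => //; first exact: Ck_cst.
  by apply: CkM => //; exact: Ck_coord.
pose Uf := [set z | U (aff z)].
have oUf : open Uf.
  have := @open_preimage _ _ setT U aff openT oU (fun x _ => smooth_map_continuous (saff _ openT) I).
  by congr open; apply/seteqP; split=> x //= [].
have sco j k V : Ck k V (fun z : 'rV[R]_(1 + n) => space_coord z 0 j).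
  have -> : (fun z : 'rV[R]_(1 + n) => space_coord z 0 j) = (fun z => z 0 (rshift 1 j)).
    by apply/funext => z; rewrite mxE.
  exact: Ck_coord.
have tco k V : Ck k V (fun z : 'rV[R]_(1 + n) => time_coord z).
  have -> : (fun z : 'rV[R]_(1 + n) => time_coord z) = (fun z => z 0 (lshift n 0)).
    by apply/funext => z; rewrite /time_coord mxE.
  exact: Ck_coord.
have somaff : smooth_map Uf (om \o aff) by apply: (smooth_map_comp oU oUf) => //; exact: saff.
pose f z := \sum_j space_coord z 0 j * om (aff z) 0 j.
have sf k : Ck k Uf f.
  by apply: Ck_sum => // j _; apply: CkM.
have Uf0 : Uf 0.
  rewrite /Uf /= /aff (_ : space_coord 0 = 0) ?scaler0 ?addr0//.
  by rewrite /space_coord linear0.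
have [a [r [W [a0 r0 sW W0 dW]]]] := param_prim oUf Uf0 sf.
pose B := [set s : 'rV[R]_n | `|s| < r]; pose D := tube a B.
have oB : open B by exact: origin_ball_open.
have oD : open D by exact: tube_open.
have DU : D `<=` Uf by move=> z /dW[].
have d_t z : is_derive z 'e_(lshift n 0) (fun z : 'rV[R]_(1 + n) => time_coord z) 1.
  have -> : (fun z : 'rV[R]_(1 + n) => time_coord z) = (fun z => z 0 (lshift n 0)).
    by apply/funext => w; rewrite /time_coord mxE.
  by apply: is_derive_eq (is_derive_coord _ _ _) _; rewrite mxE !eqxx.
have p_s z i j : partial (rshift 1 i) (fun z : 'rV[R]_(1 + n) => space_coord z 0 j) z = (i == j)%:R.
  have -> : (fun z : 'rV[R]_(1 + n) => space_coord z 0 j) = (fun z => z 0 (rshift 1 j)).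
    by apply/funext => w; rewrite mxE.
  by rewrite partial_coord (inj_eq (@rshift_inj _ _)).
have p_aff idx l z : partial idx (fun z => aff z 0 l) z =
    z 0 (lshift n 0) * (idx == rshift 1 l)%:R + z 0 (rshift 1 l) * (idx == lshift n 0)%:R.
  rewrite affE; have d k := is_derive_coord k z 'e_idx.
  have H := is_deriveD (is_derive_cst (x0 0 l) z 'e_idx) (is_deriveM (d (lshift n 0)) (d (rshift 1 l))).
  rewrite /partial (@derive_val _ _ _ _ _ _ _ H) add0r.
  by rewrite !mxE !eqxx /= [lshift n 0 == _]eq_sym [rshift 1 l == _]eq_sym.
have d_aff idx l z : derivable (fun z => aff z 0 l) z 'e_idx.
  by have [_ /(_ idx)[+ _]] := saff _ openT 1%N l; apply.
have p_om idx j z : Uf z -> partial idx (fun z => om (aff z) 0 j) z =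
    \sum_l partial l (fun y => om y 0 j) (aff z) * partial idx (fun z => aff z 0 l) z.
  move=> Uz; apply: (partial_comp (f := fun y => om y 0 j) oU Uz (som 1%N j)) => l.
  exact: d_aff.
have d_omaff idx j z : Uf z -> derivable (fun z => om (aff z) 0 j) z 'e_idx.
  by move=> Uz; have [_ /(_ idx)[+ _]] := somaff 1%N j; apply.
(* The derivative of W in s_i is t om_i(x0 + t s): both sides vanish at t = 0,
   and by closedness they have the same time derivative. *)
have key i z : D z -> partial (rshift 1 i) W z = time_coord z * om (aff z) 0 i.
  apply: (@tube_eq n a B (partial (rshift 1 i) W) (fun z => time_coord z * om (aff z) 0 i)).
  - move=> w Dw; have [_ /(_ (rshift 1 i))[_ [_ /(_ (lshift n 0))[H _]]]] := sW 2%N.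
    exact: H.
  - move=> w Dw; apply: derivableM; first by have [] := d_t w.
    exact: d_omaff (DU _ Dw).
  - move=> w Dw; have Uw := DU _ Dw.
    rewrite (schwarz _ _ oD Dw (sW 2%N)).
    rewrite (@partial_near _ _ _ f); last by apply: (near_open oD Dw) => y /dW[].
    have [dt1 dt2] := d_t w.
    rewrite partialM//; last exact: d_omaff.
    have -> : partial (lshift n 0) (fun z => time_coord z) w = 1 by exact: dt2.
    rewrite /f.
    have ds j : derivable (fun z : 'rV[R]_(1 + n) => space_coord z 0 j) w 'e_(rshift 1 i).
      by have [_ /(_ (rshift 1 i))[+ _]] := sco j 1%N setT; apply.
    have -> : partial (rshift 1 i) (fun z => \sum_j space_coord z 0 j * om (aff z) 0 j) w =
        \sum_j (space_coord w 0 j * partial (rshift 1 i) (fun z => om (aff z) 0 j) w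
           + om (aff w) 0 j * partial (rshift 1 i) (fun z => space_coord z 0 j) w).
      rewrite /partial; apply: derive_val.
      apply: is_derive_sumr => j _.
      have := @is_deriveM R _ _ _ w _ _ _ (derivableP (ds j)) (derivableP (d_omaff (rshift 1 i) j w Uw)).
      exact.
    rewrite big_split /=; congr (_ + _); last first.
      under eq_bigr do rewrite p_s.
      rewrite (bigD1 i)//= eqxx big1 ?addr0// => j ji.
      by rewrite eq_sym (negPf ji) mulr0.
    rewrite p_om// mulr_sumr; apply: eq_bigr => j _.
    rewrite p_om// (bigD1 i)//= big1; last first.
      move=> l li; rewrite p_aff (inj_eq (@rshift_inj _ _)) eq_sym (negPf li) eq_rlshift.
      by rewrite !mulr0 addr0 mulr0.
    rewrite !p_aff !eqxx eq_rlshift eq_lrshift !mulr0 !mulr1 !addr0 add0r.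
    rewrite (closed _ i j Uw) /time_coord /space_coord !mxE.
    by ring.
  - move=> s Bs; rewrite time_pt mul0r.
    have -> : W = hat (fun u s => W (pt u s)) by apply/funext => w; rewrite /hat pt_time_space.
    rewrite partial_hat time_pt space_pt.
    have -> : (fun s => W (pt 0 s)) = (fun=> 0) by apply/funext => y; exact: W0.
    by rewrite /partial derive_cst.
pose c := a / 2; have c0 : 0 < c by rewrite divr_gt0.
have ca : `|c| < a by rewrite gtr0_norm// ltr_pdivrMr// ltr_pMr// ltr1n.
(* The flow time is only known to be less than a, so th(x) is read off at time
   c = a / 2 in the direction (x - x0) / c. *)
pose g (x : 'rV[R]_n) := pt c (c^-1 *: (x - x0)).
pose V := [set x | `|x - x0| < r * c].
have oV : open V by exact: norm_ball_open.
have gD x : V x -> D (g x).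
  move=> Vx; apply: tube_pt => //; rewrite /B /= normrZ gtr0_norm ?invr_gt0//.
  by rewrite mulrC ltr_pdivrMr.
have affg x : aff (g x) = x.
  by rewrite /aff /g time_pt space_pt scalerA divff ?gt_eqF// scale1r addrC subrK.
have gl q : (fun x => g x 0 (lshift n q)) = (fun=> c).
  by apply/funext => x; rewrite row_mxEl (ord1 q) mxE eqxx mulr1n.
have gr q : (fun x => g x 0 (rshift 1 q)) = (fun x => c^-1 * (x 0 q - x0 0 q)).
  by apply/funext => x; rewrite row_mxEr !mxE.
have sg : smooth_map V g.
  move=> k j; case: (split_ordP j) => q ->; first by rewrite gl; exact: Ck_cst.
  rewrite gr; apply: CkM => //; first exact: Ck_cst.
  by apply: CkB => //; [exact: Ck_coord|exact: Ck_cst].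
exists V, (fun x => W (g x) - W (g x0)); split => //.
- by rewrite /V /= subrr normr0 mulr_gt0.
- by move=> x /gD/DU; rewrite /Uf /= affg.
split.
- move=> k; apply: CkB => //; last exact: Ck_cst.
  by apply: (Ck_comp oD oV gD (sW k)) => j; exact: sg.
- by rewrite subrr.
move=> x i Vx.
have dg j : derivable (fun x => g x 0 j) x 'e_i by have [_ /(_ i)[+ _]] := sg 1%N j; apply.
have H := chain_rule oD (gD x Vx) (sW 1%N) dg.
have := is_deriveB H (is_derive_cst (W (g x0)) x 'e_i).
rewrite subr0 => H2.
rewrite /partial (@derive_val _ _ _ _ _ _ _ H2) big_split_ord /= big_ord1.
rewrite gl derive_cst mulr0 add0r (bigD1 i)//= big1 ?addr0.
  rewrite key ?affg; last exact: gD.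
  rewrite gr time_pt.
  have H3 := is_deriveB (is_derive_coord i x 'e_i) (is_derive_cst (x0 0 i) x 'e_i).
  have H4 := is_deriveZ (c^-1) H3.
  rewrite (@derive_val _ _ _ _ _ _ _ H4) subr0 mxE !eqxx [_ *: _]mulr1.
  by rewrite mulrAC divff ?mul1r// gt_eqF.
move=> j ji; rewrite gr.
have H3 := is_deriveB (is_derive_coord j x 'e_i) (is_derive_cst (x0 0 j) x 'e_i).
have H4 := is_deriveZ (c^-1) H3.
by rewrite (@derive_val _ _ _ _ _ _ _ H4) subr0 mxE (negPf ji) andbF [_ *: _]mulr0 mulr0.
Qed.

End Poincare.

(** * The inverse function theorem *)

Section InverseFunction.
Variables (R : realType).

(** Rows are derivatives, as in [transition_jac]; the chain rule therefore
    reverses the order of composition. *)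
Definition jac n m (F : 'rV[R]_n -> 'rV[R]_m) (x : 'rV[R]_n) : 'M[R]_(n, m) :=
  \matrix_(i, j) partial i (fun y => F y 0 j) x.

Lemma jac_comp n m p (U : set 'rV[R]_m) (V : set 'rV[R]_n) (F : 'rV[R]_m -> 'rV[R]_p)
   (g : 'rV[R]_n -> 'rV[R]_m) x :
  open U -> smooth_map U F -> smooth_map V g -> V x -> U (g x) ->
  jac (F \o g) x = jac g x *m jac F (g x).
Proof.
move=> oU sF sg Vx Ux; apply/matrixP => i j; rewrite !mxE.
have := @partial_comp R m n U (fun y => F y 0 j) g x i oU Ux (sF 1%N j).
move=> ->; first by apply: eq_bigr => l _; rewrite !mxE mulrC.
by move=> l; have [_ /(_ i)[+ _]] := sg 1%N l; apply.
Qed.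

Lemma jac_id n (x : 'rV[R]_n) : jac id x = 1%:M.
Proof. by apply/matrixP => i j; rewrite !mxE partial_coord. Qed.

Lemma jac_near n m (F G : 'rV[R]_n -> 'rV[R]_m) x :
  (\forall y \near x, F y = G y) -> jac F x = jac G x.
Proof.
move=> FG; apply/matrixP => i j; rewrite !mxE; apply: partial_near.
by apply: filterS FG => y ->.
Qed.

(** The flow of the field (x, v) |-> (v DF(x)^-1, 0) moves x so that F(x)
    moves with the constant velocity v; at time c the point F(x0) + c v is
    reached.  Solving c v = y - F(x0) gives the preimage of y, smoothly in y. *)
Lemma right_inverse n (U : set 'rV[R]_n) (F : 'rV[R]_n -> 'rV[R]_n) x0 :
  open U -> U x0 -> smooth_map U F -> jac F x0 \in unitmx ->
  exists (V : set 'rV[R]_n) (G : 'rV[R]_n -> 'rV[R]_n),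
    [/\ open V, V (F x0), smooth_map V G, G (F x0) = x0 &
        forall y, V y -> U (G y) /\ F (G y) = y].
Proof.
move=> oU Ux0 sF uF.
have cjac k i j : Ck k U (fun x => jac F x i j).
  apply: (@Ck_eq _ _ _ _ (partial i (fun y => F y 0 j))) => //.
    by move=> x _; rewrite mxE.
  by have [_ /(_ i)[_]] := sF k.+1 j.
pose U1 := [set x | U x /\ \det (jac F x) != 0].
have oU1 : open U1.
  have o0 : open [set y : R | y != 0] by exact: open_neq.
  apply: (open_preimage oU o0) => x Ux.
  exact: Ck_continuous (det_Ck oU (cjac 0%N)) Ux.
have unit1 x : U1 x -> jac F x \in unitmx by move=> [_ h]; rewrite unitmxE unitfE.
have U1U : U1 `<=` U by move=> x [].
pose X (z : 'rV[R]_(n + n)) : 'rV[R]_(n + n) :=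
  row_mx (rsubmx z *m invmx (jac F (lsubmx z))) 0.
pose U2 := [set z : 'rV[R]_(n + n) | U1 (lsubmx z)].
have sl (V : set 'rV[R]_(n + n)) : smooth_map V (@lsubmx R 1 n n).
  move=> k j; have -> : (fun x : 'rV[R]_(n + n) => lsubmx x 0 j) = (fun x => x 0 (lshift n j)).
    by apply/funext => x; rewrite mxE.
  exact: Ck_coord.
have oU2 : open U2.
  have := @open_preimage _ _ setT U1 (@lsubmx R 1 n n) openT oU1 (fun x _ => smooth_map_continuous (sl setT) I).
  by congr open; apply/seteqP; split=> x //= [].
have sX k j : Ck k U2 (fun z => X z 0 j).
  case: (split_ordP j) => l ->; last first.
    apply: (@Ck_eq _ _ _ _ (fun=> 0)) => //; last exact: Ck_cst.
    by move=> z _; rewrite row_mxEr mxE.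
  apply: (@Ck_eq _ _ _ _ (fun z => \sum_q z 0 (rshift n q) * ((fun x => invmx (jac F x) q l) \o (@lsubmx R 1 n n)) z)) => //.
    by move=> z _; rewrite row_mxEl mxE; apply: eq_bigr => q _; rewrite mxE.
  apply: Ck_sum => // q _; apply: CkM => //; first exact: Ck_coord.
  apply: (Ck_comp oU1 oU2) => //; last by move=> j'; exact: sl.
  apply: invmx_Ck => // i' j'; exact: Ck_sub (cjac k i' j').
have U10 : U1 x0 by split=> //; move: uF; rewrite unitmxE unitfE.
have U2z : U2 (row_mx x0 0) by rewrite /U2 /= row_mxKl.
have [a [r [Phi [a0 r0 sPhi Phi0 dPhi]]]] := smooth_flow oU2 U2z sX.
set D := tube a _ in sPhi dPhi.
pose B := [set v : 'rV[R]_n | `|v| < r].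
have inD (t : R) (v : 'rV[R]_n) : `|t| < a -> B v -> D (pt t (row_mx x0 v)).
  move=> ta Bv; apply: tube_pt => //=.
  apply: mx_norm_lt => // i j; rewrite (ord1 i).
  case: (split_ordP j) => l ->; first by rewrite mxE [X in _ + X]mxE !row_mxEl subrr normr0.
  rewrite mxE [X in _ + X]mxE !row_mxEr mxE subr0.
  by apply: le_lt_trans Bv; exact: mx_norm_coord.
pose x (t : R) v := lsubmx (Phi (pt t (row_mx x0 v))).
have cur (t : R) v j : `|t| < a -> B v -> is_derive t (1 : R)
    (fun u => Phi (pt u (row_mx x0 v)) 0 j) (X (Phi (pt t (row_mx x0 v))) 0 j).
  move=> ta Bv; have Dw := inD t v ta Bv.
  have [_ dw] := dPhi _ Dw.
  have dd : derivable (fun z => Phi z 0 j) (pt t (row_mx x0 v)) 'e_(lshift _ 0).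
    by have [_ /(_ (lshift _ 0))[H _]] := sPhi 1%N j; exact: H.
  by have := pt_curve_derive dd; rewrite dw.
have snd_const (t : R) v : `|t| < a -> B v -> rsubmx (Phi (pt t (row_mx x0 v))) = v.
  move=> ta Bv; apply/rowP => j; rewrite mxE.
  have h1 (s : R) : `|s| <= `|t| -> is_derive s (1 : R) (fun u => Phi (pt u (row_mx x0 v)) 0 (rshift n j)) 0.
    move=> st; have := cur s v (rshift n j) (le_lt_trans st ta) Bv.
    by rewrite row_mxEr mxE.
  apply: (@eq_prim R _ (fun=> v 0 j) (fun=> 0) t h1 (fun s _ => is_derive_cst _ _ _)).
  by rewrite Phi0 row_mxEr.
have xU (t : R) v : `|t| < a -> B v -> U1 (x t v).
  by move=> ta Bv; have [] := dPhi _ (inD t v ta Bv).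
have x'E (t : R) v j : `|t| < a -> B v -> is_derive t (1 : R) (fun u => x u v 0 j)
    ((v *m invmx (jac F (x t v))) 0 j).
  move=> ta Bv; have := cur t v (lshift n j) ta Bv.
  rewrite row_mxEl snd_const// => H.
  by have -> : (fun u => x u v 0 j) = (fun u => Phi (pt u (row_mx x0 v)) 0 (lshift n j))
    by apply/funext => u; rewrite mxE.
have x0E v : x 0 v = x0 by rewrite /x Phi0 row_mxKl.
have FE (t : R) v : `|t| < a -> B v -> F (x t v) = F x0 + t *: v.
  move=> ta Bv; apply/rowP => j.
  have H1 (s : R) : `|s| <= `|t| -> is_derive s (1 : R) (fun u => F (x u v) 0 j) (v 0 j).
    move=> st; have sa := le_lt_trans st ta.
    have := @chain_rule R R n U (fun y => F y 0 j) (fun u => x u v) s 1 oU (U1U _ (xU s v sa Bv)) (sF 1%N j).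
    case/(_ _)/wrap; first by move=> l; have [] := x'E s v l sa Bv.
    move=> H; apply: is_derive_eq H _.
    have -> : v 0 j = ((v *m invmx (jac F (x s v))) *m jac F (x s v)) 0 j.
      by rewrite -mulmxA mulVmx ?mulmx1//; apply: unit1; exact: xU.
    rewrite [RHS]mxE; apply: eq_bigr => l _.
    have -> : 'D_1 (fun y : R => x y v 0 l) s = (v *m invmx (jac F (x s v))) 0 l.
      exact: (@derive_val _ _ _ _ _ _ _ (x'E s v l sa Bv)).
    by rewrite mulrC; congr (_ * _); rewrite mxE.
  apply: (@eq_prim R _ (fun u => (F x0 + u *: v) 0 j) (fun=> v 0 j) t H1) => [s st|].
    have -> : (fun u : R => (F x0 + u *: v) 0 j) = (fun u => F x0 0 j + v 0 j * u).
      by apply/funext => u; rewrite !mxE mulrC.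
    have H2 := is_deriveD (is_derive_cst (F x0 0 j) s (1 : R)) (@is_deriveZ R R R _ (v 0 j) _ _ _ (is_derive_id s (1 : R))).
    by apply: is_derive_eq H2 _; rewrite add0r [_ *: _]mulr1.
  by rewrite x0E scale0r addr0.
pose c := a / 2; have c0 : 0 < c by rewrite divr_gt0.
have ca : `|c| < a by rewrite gtr0_norm// ltr_pdivrMr// ltr_pMr// ltr1n.
(* The time c = a / 2 is fixed and the velocity v = (y - F x0) / c varies. *)
pose w (y : 'rV[R]_n) := pt c (row_mx x0 (c^-1 *: (y - F x0))).
pose V := [set y | `|y - F x0| < r * c].
have oV : open V by exact: norm_ball_open.
have VB y : V y -> B (c^-1 *: (y - F x0)).
  by move=> Vy; rewrite /B /= normrZ gtr0_norm ?invr_gt0// mulrC ltr_pdivrMr.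
have oD : open D by apply: tube_open; exact: norm_ball_open.
have sw : smooth_map V w.
  move=> k j; case: (split_ordP j) => q ->.
    apply: (@Ck_eq _ _ _ _ (fun=> c)) => //; last exact: Ck_cst.
    by move=> y _; rewrite row_mxEl (ord1 q) mxE eqxx mulr1n.
  case: (split_ordP q) => l ->.
    apply: (@Ck_eq _ _ _ _ (fun=> x0 0 l)) => //; last exact: Ck_cst.
    by move=> y _; rewrite row_mxEr row_mxEl.
  apply: (@Ck_eq _ _ _ _ (fun y => c^-1 * (y 0 l - F x0 0 l))) => //.
    by move=> y _; rewrite row_mxEr row_mxEr !mxE.
  apply: CkM => //; first exact: Ck_cst.
  by apply: CkB => //; [exact: Ck_coord|exact: Ck_cst].
exists V, (fun y => x c (c^-1 *: (y - F x0))); split => //.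
- by rewrite /V /= subrr normr0 mulr_gt0.
- apply: (smooth_map_comp (f := @lsubmx R 1 n n) (g := fun y => Phi (w y)) openT oV) => //.
  by apply: (smooth_map_comp oD oV) => // y /VB; exact: inD.
- rewrite subrr scaler0.
  have B0 : B 0 by rewrite /B /= normr0.
  apply/rowP => j.
  have h1 (s : R) : `|s| <= `|c| -> is_derive s (1 : R) (fun u => x u 0 0 j) 0.
    by move=> st; have := x'E s 0 j (le_lt_trans st ca) B0; rewrite mul0mx mxE.
  apply: (@eq_prim R _ (fun=> x0 0 j) (fun=> 0) c h1 (fun s _ => is_derive_cst _ _ _)).
  by rewrite x0E.
move=> y Vy; split; first by apply: U1U; apply: xU => //; exact: VB.
by rewrite FE ?scalerA ?divff ?gt_eqF// ?scale1r ?[F x0 + _]addrC ?subrK//; exact: VB.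
Qed.

(** A right inverse G of F has itself a right inverse H, and
    H = F G H = F, so G is a two-sided inverse. *)
Lemma local_diffeo n (U : set 'rV[R]_n) (F : 'rV[R]_n -> 'rV[R]_n) x0 :
  open U -> U x0 -> smooth_map U F -> jac F x0 \in unitmx ->
  exists (O O' : set 'rV[R]_n) (G : 'rV[R]_n -> 'rV[R]_n),
    [/\ open O, open O', O x0, O `<=` U & [/\ smooth_map O' G,
      forall x, O x -> O' (F x) /\ G (F x) = x &
      forall y, O' y -> O (G y) /\ F (G y) = y]].
Proof.
move=> oU Ux0 sF uF.
have [V [G [oV Vy0 sG Gy0 FG]]] := right_inverse oU Ux0 sF uF.
have uG : jac G (F x0) \in unitmx.
  have := @jac_comp n n n U V F G (F x0) oU sF sG Vy0.
  rewrite Gy0 => /(_ Ux0).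
  rewrite (@jac_near _ _ _ id); last by apply: (near_open oV Vy0) => y /FG[].
  by rewrite jac_id => /esym /mulmx1_unit[].
have [W [H [oW Wx0 sH Hx0 GH]]] := right_inverse oV Vy0 sG uG.
have HF x : W x -> H x = F x.
  by move=> /GH[VH GHx]; have [_] := FG _ VH; rewrite GHx.
pose O := W `&` U.
have oO : open O by exact: openI.
pose O' := [set y | V y /\ O (G y)].
have oO' : open O' by apply: (open_preimage oV oO) => y; exact: smooth_map_continuous.
exists O, O', G; split => //.
- by rewrite /O; split=> //; rewrite -Gy0.
- by move=> x [].
split.
- by move=> k j; apply: Ck_sub (sG k j) => y [].
- move=> x [Wx Ux]; have [VH GHx] := GH x Wx.
  rewrite -(HF x Wx); split=> //; split=> //.
  by rewrite GHx.
- by move=> y [Vy Oy]; split=> //; have [] := FG y Vy.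
Qed.

End InverseFunction.

(** * Charts and transition maps *)

Section ManifoldBasics.
Variables (R : realType) (N : nat) (M : manifold R N).
Implicit Types (c d e : chart R N M).

Lemma atlas_open c : atlas c -> open (cimg c).
Proof. by move=> /atlas_chart[]. Qed.

Lemma cimg_cmap c p : cdom c p -> cimg c (cmap c p).
Proof. by move=> cp; exists p. Qed.

Lemma cinvK c p : atlas c -> cdom c p -> cinv c (cmap c p) = p.
Proof. by move=> /atlas_chart[_ _ H _ _]; exact: H. Qed.

Lemma cinv_cdom c x : atlas c -> cimg c x -> cdom c (cinv c x).
Proof. by move=> ac [p cp <-]; rewrite cinvK. Qed.

Lemma cmapK c x : atlas c -> cimg c x -> cmap c (cinv c x) = x.
Proof. by move=> ac [p cp <-]; rewrite cinvK. Qed.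

Lemma overlapE c d x : atlas c -> overlap c d x <-> cimg c x /\ cdom d (cinv c x).
Proof.
move=> ac; split; first by move=> [p [cp dp] <-]; rewrite cinvK//; split=> //; exact: cimg_cmap.
move=> [cx dx]; exists (cinv c x); last exact: cmapK.
by split=> //; exact: cinv_cdom.
Qed.

Lemma overlap_open c d : atlas c -> atlas d -> open (overlap c d).
Proof.
move=> ac ad; have [od _ _ _ _] := atlas_chart ad; have [_ oc _ _ ic] := atlas_chart ac.
have -> : overlap c d = [set x | cimg c x /\ cdom d (cinv c x)].
  by apply/seteqP; split=> x /= /overlapE; apply.
exact: open_preimage.
Qed.

Lemma overlap_cimg c d : overlap c d `<=` cimg c.
Proof. by move=> x [p [cp dp] <-]; exact: cimg_cmap. Qed.

Lemma cinv_transition c d x : atlas c -> atlas d -> overlap c d x ->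
  cinv d (transition c d x) = cinv c x.
Proof. by move=> ac ad [p [cp dp] <-]; rewrite /transition !cinvK. Qed.

Lemma overlap_transition c d x : atlas c -> atlas d -> overlap c d x ->
  overlap d c (transition c d x).
Proof. by move=> ac ad [p [cp dp] <-]; exists p => //; rewrite /transition cinvK. Qed.

Lemma transitionK c d x : atlas c -> atlas d -> overlap c d x ->
  transition d c (transition c d x) = x.
Proof.
move=> ac ad ox; rewrite {1}/transition cinv_transition//.
by apply: cmapK => //; exact: overlap_cimg ox.
Qed.

Lemma transition_smooth c d : atlas c -> atlas d -> smooth_map (overlap c d) (transition c d).
Proof.
move=> ac ad k j; have [H _] := atlas_compatible ac ad j.
exact: (smooth_onP _ _).1 H k.
Qed.

Lemma transition_jacE c d x : transition_jac c d x = jac (transition c d) x.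
Proof. by []. Qed.

Lemma transition_jac_comp c d e x : atlas c -> atlas d -> atlas e ->
  overlap c d x -> overlap c e x ->
  transition_jac c e x = transition_jac c d x *m transition_jac d e (transition c d x).
Proof.
move=> ac ad ae cdx cex; rewrite !transition_jacE.
have Tx : overlap d e (transition c d x).
  apply/overlapE => //; split; first by apply: overlap_cimg; exact: overlap_transition cdx.
  by rewrite cinv_transition//; case/overlapE: cex.
rewrite -(jac_comp (overlap_open ad ae) (transition_smooth ad ae) (transition_smooth ac ad) cdx Tx).
apply: jac_near; apply: (near_open (overlap_open ac ad) cdx) => y cdy.
by rewrite /= /transition -[cmap d (cinv c y)]/(transition c d y) cinv_transition.
Qed.

Lemma transition_jac_id c x : atlas c -> cimg c x -> transition_jac c c x = 1%:M.
Proof.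
move=> ac cx; rewrite transition_jacE -(jac_id x); apply: jac_near.
by apply: (near_open (atlas_open ac) cx) => y cy; exact: cmapK.
Qed.

Lemma overlap_self c x : atlas c -> cimg c x -> overlap c c x.
Proof. by move=> ac cx; apply/overlapE => //; split=> //; exact: cinv_cdom. Qed.

Lemma transition_jac_inv c d x : atlas c -> atlas d -> overlap c d x ->
  transition_jac c d x *m transition_jac d c (transition c d x) = 1%:M.
Proof.
move=> ac ad cdx; have cx := overlap_cimg cdx.
rewrite -(transition_jac_comp ac ad ac cdx (overlap_self ac cx)).
exact: transition_jac_id.
Qed.

End ManifoldBasics.

(** * The covariant derivative is a tensor *)

Section Tensor.
Variables (R : realType) (n : nat).
Local Notation N := n.+1.
Implicit Types (G : 'rV[R]_N -> 'M[R]_N) (u : 'rV[R]_N -> 'rV[R]_N).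

(** Twice the Christoffel symbols of the first kind, which are linear in the
    derivatives of the metric and avoid the inverse matrix. *)
Definition christoffel1 G x m k j : R :=
  partial k (fun y => G y m j) x + partial j (fun y => G y m k) x
     - partial m (fun y => G y k j) x.

(** For a lowered vector the inverse metric cancels against the metric. *)
Lemma nabla_lower G u x k j : G x \in unitmx ->
  nabla G (lower G u) x k j = partial k (fun y => lower G u y 0 j) x
     - 2^-1 * \sum_m u x 0 m * christoffel1 G x m k j.
Proof.
move=> uG; rewrite /nabla; congr (_ - _).
have E : u x = lower G u x *m invmx (G x) by rewrite /lower mulmxK.
rewrite /christoffel.
under eq_bigr do rewrite -mulrA mulr_suml.
rewrite -mulr_sumr; congr (_ * _); rewrite exchange_big /=; apply: eq_bigr => m _.
rewrite [in RHS]E mxE mulr_suml; apply: eq_bigr => l _.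
rewrite /christoffel1; ring.
Qed.

(** The Leibniz and chain rules, expanded: J is the Jacobian matrix, H its
    first derivatives (second derivatives of the transition, symmetric in the
    first two indices), D the first derivatives of the new metric G', and dG the
    resulting derivatives of the old metric.  Of the terms in H only one survives,
    twice; it cancels the inhomogeneous term in the derivative of a covector. *)
Lemma christoffel1_algebra (J G' : 'I_N -> 'I_N -> R) (H D : 'I_N -> 'I_N -> 'I_N -> R) m k j :
  (forall k i a, H k i a = H i k a) -> (forall a b, G' a b = G' b a) ->
  let dG k m j := \sum_a \sum_b (H k m a * G' a b * J j b +
      J m a * (\sum_c J k c * D c a b) * J j b + J m a * G' a b * H k j b) in
  dG k m j + dG j m k - dG m k j =
   2 * (\sum_a \sum_b J m a * G' a b * H k j b) +
   \sum_a \sum_b \sum_c J m a * (J k c * J j b * (D c a b + D b a c - D a c b)).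
Proof.
move=> Hs Gs dG.
(* E1 to E5 rename the summation indices so that the terms match. *)
have E k' m' j' : dG k' m' j' = \sum_a \sum_b H k' m' a * G' a b * J j' b +
   \sum_a \sum_b \sum_c J m' a * J k' c * J j' b * D c a b +
   \sum_a \sum_b J m' a * G' a b * H k' j' b.
  rewrite /dG -!big_split /=; apply: eq_bigr => a _.
  rewrite -!big_split /=; apply: eq_bigr => b _; congr (_ + _ + _).
  rewrite mulr_sumr mulr_suml; apply: eq_bigr => c _; ring.
rewrite !E.
have E1 : \sum_a \sum_b H j m a * G' a b * J k b = \sum_a \sum_b J k a * G' a b * H m j b.
  rewrite exchange_big /=; apply: eq_bigr => a _; apply: eq_bigr => b _.
  by rewrite Hs (Gs b a); ring.
have E2 : \sum_a \sum_b H k m a * G' a b * J j b = \sum_a \sum_b H m k a * G' a b * J j b.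
  by apply: eq_bigr => a _; apply: eq_bigr => b _; rewrite Hs.
have E3 : \sum_a \sum_b J m a * G' a b * H j k b = \sum_a \sum_b J m a * G' a b * H k j b.
  by apply: eq_bigr => a _; apply: eq_bigr => b _; rewrite (Hs j k).
have E4 : \sum_a \sum_b \sum_c J m a * J j c * J k b * D c a b =
    \sum_a \sum_b \sum_c J m a * (J k c * J j b) * D b a c.
  apply: eq_bigr => a _; rewrite exchange_big /=; apply: eq_bigr => b _.
  by apply: eq_bigr => c _; ring.
have E5 : \sum_a \sum_b \sum_c J k a * J m c * J j b * D c a b =
    \sum_a \sum_b \sum_c J m a * (J k c * J j b) * D a c b.
  under eq_bigr do rewrite exchange_big /=.
  rewrite exchange_big /=; apply: eq_bigr => a _.
  rewrite exchange_big /=; apply: eq_bigr => b _.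
  by apply: eq_bigr => c _; ring.
have E6 : \sum_a \sum_b \sum_c J m a * (J k c * J j b * (D c a b + D b a c - D a c b)) =
   \sum_a \sum_b \sum_c J m a * J k c * J j b * D c a b +
   \sum_a \sum_b \sum_c J m a * (J k c * J j b) * D b a c -
   \sum_a \sum_b \sum_c J m a * (J k c * J j b) * D a c b.
  rewrite -big_split /= -sumrB; apply: eq_bigr => a _.
  rewrite -big_split /= -sumrB; apply: eq_bigr => b _.
  rewrite -big_split /= -sumrB; apply: eq_bigr => c _; ring.
rewrite E6 E4 E5 E3 E1 E2; ring.
Qed.

Lemma derive_jac_sum m p (O : set 'rV[R]_m) (O' : set 'rV[R]_p) (T : 'rV[R]_m -> 'rV[R]_p)
   (f : 'rV[R]_p -> R) x k : open O' -> smooth_map O T -> O x -> O' (T x) -> Ck 1 O' f ->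
  is_derive x 'e_k (f \o T) (\sum_c jac T x k c * partial c f (T x)).
Proof.
move=> oO' sT Ox O'x cf.
have H := @chain_rule R 'rV[R]_m p O' f T x 'e_k oO' O'x cf.
apply: is_derive_eq (H _) _.
  by move=> j; have [_ /(_ k)[+ _]] := sT 1%N j; apply.
by apply: eq_bigr => c _; rewrite !mxE mulrC.
Qed.

(** The inhomogeneous terms, which contain second derivatives of T, cancel
    between the derivative of the covector and the Christoffel symbols
    ([christoffel1_algebra]). *)
Lemma nabla_transform (O O' : set 'rV[R]_N) (T : 'rV[R]_N -> 'rV[R]_N) G G' u u' :
  open O -> open O' -> smooth_map O T -> (forall x, O x -> O' (T x)) ->
  (forall x, O x -> G x = jac T x *m G' (T x) *m (jac T x)^T) ->
  (forall x, O x -> u' (T x) = u x *m jac T x) ->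
  (forall a b, Ck 1 O' (fun z => G' z a b)) ->
  (forall b, Ck 1 O' (fun z => lower G' u' z 0 b)) ->
  (forall z, O' z -> (G' z)^T = G' z) ->
  (forall x, O x -> G x \in unitmx) -> (forall z, O' z -> G' z \in unitmx) ->
  forall x k j, O x -> nabla G (lower G u) x k j =
    \sum_a \sum_b jac T x k a * jac T x j b * nabla G' (lower G' u') (T x) a b.
Proof.
move=> oO oO' sT TO HG Hu cG' cw' symG' uG uG' x k j Ox.
have O'x := TO x Ox.
rewrite nabla_lower; last exact: uG.
under [RHS]eq_bigr => a _ do under eq_bigr => b _ do rewrite (nabla_lower u' a b (uG' _ O'x)).
pose J (i a : 'I_N) := jac T x i a.
pose H (k i a : 'I_N) := partial k (fun y => jac T y i a) x.
pose D (c a b : 'I_N) := partial c (fun z => G' z a b) (T x).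
pose Gx (a b : 'I_N) := G' (T x) a b.
have jacE i a : (fun y => jac T y i a) = partial i (fun y => T y 0 a).
  by apply/funext => y; rewrite mxE.
have dJ k' i a : is_derive x 'e_k' (fun y => jac T y i a) (H k' i a).
  apply: derivableP; rewrite jacE.
  by have [_ /(_ i)[_ [_ /(_ k')[+ _]]]] := sT 2%N a; apply.
have Hs k' i a : H k' i a = H i k' a.
  by rewrite /H !jacE; apply: schwarz oO Ox (sT 2%N a).
have Gs a b : Gx a b = Gx b a by rewrite /Gx -[in LHS](symG' _ O'x) mxE.
have dG' k' a b : is_derive x 'e_k' (fun y => G' (T y) a b) (\sum_c J k' c * D c a b).
  exact: (derive_jac_sum k' oO' sT Ox O'x (cG' a b)).
have dG k' m' j' : partial k' (fun y => G y m' j') x =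
   \sum_a \sum_b (H k' m' a * Gx a b * J j' b +
      J m' a * (\sum_c J k' c * D c a b) * J j' b + J m' a * Gx a b * H k' j' b).
  rewrite (@partial_near _ _ _ (fun y => \sum_a \sum_b jac T y m' a * G' (T y) a b * jac T y j' b)); last first.
    apply: (near_open oO Ox) => y Oy; rewrite HG// mxE exchange_big /=.
    by apply: eq_bigr => b _; rewrite !mxE mulr_suml; apply: eq_bigr => a _; rewrite !mxE.
  rewrite /partial; apply: derive_val; apply: is_derive_sumr => a _; apply: is_derive_sumr => b _.
  have h := is_deriveM (is_deriveM (dJ k' m' a) (dG' k' a b)) (dJ k' j' b).
  apply: is_derive_eq h _; rewrite /GRing.scale /= mulrfctE /J /Gx; ring.
have dw : partial k (fun y => lower G u y 0 j) x =
   \sum_b (lower G' u' (T x) 0 b * H k j b + J j b * (\sum_a J k a * partial a (fun z => lower G' u' z 0 b) (T x))).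
  rewrite (@partial_near _ _ _ (fun y => \sum_b lower G' u' (T y) 0 b * jac T y j b)); last first.
    apply: (near_open oO Ox) => y Oy.
    have -> : lower G u y = lower G' u' (T y) *m (jac T y)^T.
      by rewrite /lower HG// Hu// !mulmxA.
    by rewrite mxE; apply: eq_bigr => b _; rewrite !mxE.
  rewrite /partial; apply: derive_val; apply: is_derive_sumr => b _.
  exact: (is_deriveM (derive_jac_sum k oO' sT Ox O'x (cw' b)) (dJ k j b)).
have chr m' : christoffel1 G x m' k j =
   2 * (\sum_a \sum_b J m' a * Gx a b * H k j b) +
   \sum_a \sum_b \sum_c J m' a * (J k c * J j b * christoffel1 G' (T x) a c b).
  by rewrite /christoffel1 !dG (@christoffel1_algebra J Gx H D m' k j Hs Gs).
have ux a : \sum_m u x 0 m * J m a = u' (T x) 0 a by rewrite Hu// mxE.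
have S : \sum_m u x 0 m * christoffel1 G x m k j =
   2 * (\sum_b lower G' u' (T x) 0 b * H k j b) +
   \sum_c \sum_b J k c * J j b * (\sum_a u' (T x) 0 a * christoffel1 G' (T x) a c b).
  under eq_bigr do rewrite chr mulrDr.
  rewrite big_split /=; congr (_ + _).
    under eq_bigr do rewrite mulrCA mulr_sumr.
    rewrite -mulr_sumr; congr (_ * _); rewrite exchange_big /=.
    under [LHS]eq_bigr => a _ do under eq_bigr => m _ do rewrite mulr_sumr.
    under [LHS]eq_bigr => a _ do rewrite exchange_big /=.
    rewrite exchange_big /=; apply: eq_bigr => b _.
    rewrite /lower mxE mulr_suml; apply: eq_bigr => a _.
    rewrite -ux !mulr_suml; apply: eq_bigr => m _; rewrite /Gx; ring.
  under [LHS]eq_bigr => m _ do rewrite mulr_sumr.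
  rewrite exchange_big /=.
  under [RHS]eq_bigr => c _ do under eq_bigr => b _ do rewrite mulr_sumr.
  under [RHS]eq_bigr => c _ do rewrite exchange_big /=.
  rewrite [RHS]exchange_big /=; apply: eq_bigr => a _.
  under [LHS]eq_bigr => m _ do rewrite mulr_sumr.
  rewrite exchange_big /= [RHS]exchange_big /=; apply: eq_bigr => b _.
  under [LHS]eq_bigr => m _ do rewrite mulr_sumr.
  rewrite exchange_big /=; apply: eq_bigr => c _.
  rewrite -ux mulr_suml mulr_sumr; apply: eq_bigr => m _; ring.
rewrite dw S big_split /= mulrDr mulrA mulVf ?pnatr_eq0// mul1r opprD addrACA subrr add0r.
have -> : \sum_b J j b * (\sum_a J k a * partial a (fun z => lower G' u' z 0 b) (T x)) =
   \sum_a \sum_b J k a * J j b * partial a (fun z => lower G' u' z 0 b) (T x).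
  rewrite exchange_big /=; apply: eq_bigr => b _; rewrite mulr_sumr.
  by apply: eq_bigr => a _; ring.
rewrite mulr_sumr -sumrB; apply: eq_bigr => a _.
rewrite mulr_sumr -sumrB; apply: eq_bigr => b _.
by rewrite /J; ring.
Qed.

End Tensor.

(** * Warped charts *)

Section Lorentz.
Variables (R : realType) (n : nat).

Lemma lorentzian_unit (G : 'M[R]_(1 + n)) : lorentzian_mx G -> G \in unitmx.
Proof.
move=> [_ [P uP E]].
have : P *m G *m P^T \in unitmx.
  rewrite E unitmxE det_ublock det_scalar expr1 det1 mulr1.
  by rewrite unitfE oppr_eq0 oner_eq0.
by rewrite !unitmx_mul => /andP[/andP[_ ->]].
Qed.

Lemma lshift00 : lshift n (0 : 'I_1) = (0 : 'I_n.+1).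
Proof. exact: val_inj. Qed.

Lemma rshift_neq00 (i : 'I_n) : ((rshift 1 i : 'I_n.+1) == 0) = false.
Proof. by []. Qed.

Lemma metric_unit (M : manifold R n.+1) (g : lorentz_metric M) c x :
  atlas c -> cimg c x -> g c x \in unitmx.
Proof. by move=> ac cx; apply: lorentzian_unit; exact: metric_lorentzian. Qed.

Lemma metric_symmetric (M : manifold R n.+1) (g : lorentz_metric M) c x :
  atlas c -> cimg c x -> (g c x)^T = g c x.
Proof. by move=> ac cx; have [] := metric_lorentzian g ac cx. Qed.

End Lorentz.

Section Warped.
Variables (R : realType) (n : nat) (M : manifold R n.+1) (g : lorentz_metric M).
Local Notation e0 := ('e_0 : 'rV[R]_n.+1).

Lemma time_coordE (x : 'rV[R]_(1 + n)) : time_coord x = (x : 'rV[R]_n.+1) 0 0.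
Proof. by rewrite /time_coord mxE lshift00. Qed.

Lemma time_comp_derive (f : R -> R) (x v : 'rV[R]_n.+1) df :
  is_derive (time_coord (x : 'rV[R]_(1 + n))) (1 : R) f df ->
  is_derive x v (fun y : 'rV[R]_n.+1 => f (time_coord (y : 'rV[R]_(1 + n)))) (df * v 0 0).
Proof.
move=> H; have D := is_derive_coord (0 : 'I_n.+1) x v.
have E : (fun y : 'rV[R]_n.+1 => f (time_coord (y : 'rV[R]_(1 + n)))) = f \o (fun y : 'rV[R]_n.+1 => y 0 0).
  by apply/funext => y; rewrite time_coordE.
rewrite time_coordE in H; have [d1 d2] := D.
rewrite E; apply: is_derive_eq (is_derive_comp1 d1 H) _.
by rewrite d2.
Qed.

Lemma time_comp_Ck k (I : set R) (f : R -> R) (U : set 'rV[R]_n.+1) : open U ->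
  (forall x, U x -> I (time_coord (x : 'rV[R]_(1 + n)))) ->
  (forall k t, I t -> derivable (derive1n k f) t 1) ->
  Ck k U (fun y : 'rV[R]_n.+1 => f (time_coord (y : 'rV[R]_(1 + n)))).
Proof.
move=> oU UI; elim: k f => [|k IH] f df.
  move=> x Ux; apply: (@continuous_comp _ _ _ (@time_coord R n) f).
    exact: time_continuous.
  apply: differentiable_continuous; apply/derivable1_diffP.
  exact: (df 0%N _ (UI x Ux)).
have D x i : U x -> is_derive x 'e_i (fun y : 'rV[R]_n.+1 => f (time_coord (y : 'rV[R]_(1 + n))))
    (derive1 f (time_coord (x : 'rV[R]_(1 + n))) * (i == 0)%:R).
  move=> Ux; have H := derivableP (df 0%N _ (UI x Ux)).
  rewrite /= -derive1E in H.
  by have := time_comp_derive 'e_i H; rewrite mxE eqxx /= eq_sym.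
split=> [x Ux|i].
  apply: (@continuous_comp _ _ _ (@time_coord R n) f).
    exact: time_continuous.
  apply: differentiable_continuous; apply/derivable1_diffP.
  exact: (df 0%N _ (UI x Ux)).
split=> [x Ux|]; first by have [] := D x i Ux.
apply: (@Ck_eq _ _ _ _ (fun y : 'rV[R]_n.+1 => derive1 f (time_coord (y : 'rV[R]_(1 + n))) * (i == 0)%:R)) => //.
  by move=> x Ux; rewrite /partial (@derive_val _ _ _ _ _ _ _ (D x i Ux)).
apply: CkM => //; last exact: Ck_cst.
by apply: IH => l t It; have := df l.+1 t It; rewrite derive1Sn.
Qed.

Lemma nabla_near c (v w : 'rV[R]_n.+1 -> 'rV[R]_n.+1) x k j : atlas c -> cimg c x ->
  (forall y, cimg c y -> v y = w y) -> nabla (g c) v x k j = nabla (g c) w x k j.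
Proof.
move=> ac cx vw; rewrite /nabla; congr (_ - _).
  apply: partial_near; apply: (near_open (atlas_open ac) cx) => y cy.
  by rewrite vw.
by apply: eq_bigr => l _; rewrite vw.
Qed.

(** A metric with constant g_(0 j): of the three derivatives in the
    Christoffel symbol of e_0 only d_0 g_(k j) is left, and the covector
    g_(0 j) is constant. *)
Lemma nabla_e0 c x k j : atlas c -> cimg c x ->
  (forall y i, cimg c y -> g c y 0 i = - (i == 0)%:R) ->
  nabla (g c) (lower (g c) (fun=> e0)) x k j = 2^-1 * partial 0 (fun y => g c y k j) x.
Proof.
move=> ac cx G0; have oc := atlas_open ac.
have uG := metric_unit g ac cx.
rewrite nabla_lower// (@partial_cst_on _ _ _ _ (- (j == 0)%:R) _ _ oc cx); last first.
  by move=> y cy; rewrite /lower -rowE mxE G0.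
rewrite (bigD1 0)//= big1 ?addr0 => [|m m0]; last by rewrite mxE (negPf m0) andbF mul0r.
rewrite [e0 0 0]mxE !eqxx mul1r /christoffel1.
rewrite (@partial_cst_on _ _ _ _ (- (j == 0)%:R) _ _ oc cx); last by move=> y cy; exact: G0.
rewrite (@partial_cst_on _ _ _ _ (- (k == 0)%:R) _ _ oc cx); last by move=> y cy; exact: G0.
by rewrite addr0 !sub0r mulrN opprK.
Qed.

Section OneChart.
Variables (c : chart R n.+1 M) (q : R -> R).
Hypotheses (ac : atlas c) (wc : warped_chart g c q).

Let tm (x : 'rV[R]_n.+1) : R := time_coord (x : 'rV[R]_(1 + n)).

Lemma warped_row0 x j : cimg c x -> g c x 0 j = - (j == 0)%:R.
Proof.
case: wc => I [V [h [_ _ _ _ H]]] cx; rewrite (H x cx) -lshift00.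
case: (split_ordP (j : 'I_(1 + n))) => l ->.
  by rewrite (@block_mxEul R 1 n 1 n) (ord1 l) mxE !eqxx mulr1n.
by rewrite (@block_mxEur R 1 n 1 n) mxE lshift00 rshift_neq00 oppr0.
Qed.

Lemma warped_lower x : cimg c x -> lower (g c) (fun=> e0) x = - e0.
Proof.
move=> cx; rewrite /lower -rowE; apply/rowP => j; rewrite !mxE (warped_row0 j cx).
by rewrite eqxx.
Qed.

Lemma warped_q_pos x : cimg c x -> 0 < q (tm x).
Proof.
case: wc => I [V [h [_ E [H _] _ _]]]; rewrite E => -[It _]; exact: H.
Qed.

Lemma warped_diag_pos x (i : 'I_n) : cimg c x -> 0 < g c x (rshift 1 i) (rshift 1 i).
Proof.
move=> cx; have qp := warped_q_pos cx.
case: wc => I [V [h [_ E _ [_ hpos] H]]].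
have Vx : V (space_coord (x : 'rV[R]_(1 + n))) by move: (cx); rewrite E => -[].
rewrite (H x cx) (@block_mxEdr R 1 n 1 n) mxE mulr_gt0 ?exprn_gt0//.
have [_ /(_ 'e_i)] := hpos _ Vx; rewrite -rowE !mxE.
rewrite (bigD1 i)//= big1 => [|j ji]; last by rewrite !mxE (negPf ji) andbF mulr0.
rewrite !mxE !eqxx mulr1 addr0; apply.
apply/eqP => /rowP /(_ i); rewrite !mxE !eqxx /=; apply/eqP.
exact: oner_neq0.
Qed.

(** One has d_t (q^2 h) / 2 = (q'/q) q^2 h on the spatial block,
    and both sides vanish on the row and the column of index 0. *)
Lemma warped_nabla x k j : cimg c x ->
  let om := lower (g c) (fun=> e0) in
  nabla (g c) om x k j = (derive1 q (tm x) / q (tm x)) * (om x 0 k * om x 0 j + g c x k j).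
Proof.
move=> cx om; have oc := atlas_open ac.
rewrite /om nabla_e0//; last by move=> y i; exact: warped_row0.
rewrite warped_lower//.
have om0 (i : 'I_n) : (- e0) 0 (rshift 1 i : 'I_n.+1) = 0.
  by rewrite !mxE rshift_neq00 oppr0.
have om00 : (- e0) 0 (0 : 'I_n.+1) = -1 by rewrite !mxE !eqxx.
have symG y a b : cimg c y -> g c y a b = g c y b a.
  by move=> cy; rewrite -{1}(metric_symmetric g ac cy) mxE.
case: (split_ordP (k : 'I_(1 + n))) => a ->.
  rewrite (ord1 a) lshift00 (@partial_cst_on _ _ _ _ (- (j == 0)%:R) _ _ oc cx) ?mulr0; last by move=> y; exact: warped_row0.
  rewrite (warped_row0 j cx) om00.
  case: (split_ordP (j : 'I_(1 + n))) => b ->.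
    by rewrite (ord1 b) lshift00 om00 eqxx /=; ring.
  by rewrite om0 rshift_neq00 /=; ring.
case: (split_ordP (j : 'I_(1 + n))) => b ->.
  rewrite (ord1 b) lshift00 (@partial_cst_on _ _ _ _ (- ((rshift 1 a : 'I_n.+1) == 0)%:R) _ _ oc cx); last first.
    by move=> y cy; rewrite symG// warped_row0.
  by rewrite om0 symG// (warped_row0 _ cx) rshift_neq00 /=; ring.
rewrite !om0 mul0r add0r.
have qp := warped_q_pos cx.
case: wc => I [V [h [_ E [_ dq] _ H]]].
have It : I (tm x) by move: (cx); rewrite E => -[].
rewrite (@partial_near _ _ _ (hat (fun t s => q t ^+ 2 * h s a b))); last first.
  by apply: (near_open oc cx) => y cy; rewrite (H y cy) (@block_mxEdr R 1 n 1 n) mxE.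
have D : is_derive (time_coord (x : 'rV[R]_(1 + n))) (1 : R) q (derive1 q (tm x)).
  by rewrite derive1E; apply: derivableP; exact: (dq 0%N _ It).
have D2 : is_derive (time_coord (x : 'rV[R]_(1 + n))) (1 : R)
   (fun u => q u ^+ 2 * h (space_coord (x : 'rV[R]_(1 + n))) a b)
   (2 * q (tm x) * derive1 q (tm x) * h (space_coord (x : 'rV[R]_(1 + n))) a b).
  have := is_deriveM (is_deriveM D D) (is_derive_cst (h (space_coord (x : 'rV[R]_(1 + n))) a b) (time_coord (x : 'rV[R]_(1 + n))) (1 : R)).
  move=> K; apply: is_derive_eq K _.
  rewrite /GRing.scale /= mulrfctE /tm; ring.
have := (hat_is_derive_time (fun t s => q t ^+ 2 * h s a b) x _).1 D2.
rewrite lshift00 => D3; rewrite /partial (@derive_val _ _ _ _ _ _ _ D3).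
rewrite (H x cx) (@block_mxEdr R 1 n 1 n) mxE -/(tm x).
by field; rewrite gt_eqF.
Qed.

Lemma warped_phi_Ck k : Ck k (cimg c) (fun x => derive1 q (tm x) / q (tm x)).
Proof.
have qp := @warped_q_pos.
case: wc => I [V [h [_ E [_ dq] _ H]]]; have oc := atlas_open ac.
have CI x : cimg c x -> I (time_coord (x : 'rV[R]_(1 + n))) by rewrite E => -[].
apply: CkM => //.
  apply: (time_comp_Ck k oc CI) => l t It.
  by have := dq l.+1 t It; rewrite derive1Sn.
apply: CkV => //; first by move=> x cx; rewrite gt_eqF// qp.
exact: (time_comp_Ck k oc CI).
Qed.

Lemma warped_phi_partial x i : cimg c x -> i != 0 ->
  partial i (fun x => derive1 q (tm x) / q (tm x)) x = 0.
Proof.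
move=> cx i0.
have D : derivable (fun t => derive1 q t / q t) (tm x) 1.
  have qp := warped_q_pos cx.
  case: wc => I [V [h [_ E [_ dq] _ H]]].
  have It : I (tm x) by move: (cx); rewrite E => -[].
  apply: derivableM; first by have := dq 1%N _ It; rewrite derive1n1.
  by apply: derivableV; [rewrite gt_eqF|exact: (dq 0%N _ It)].
have := time_comp_derive 'e_i (derivableP D).
move=> K; rewrite /partial (@derive_val _ _ _ _ _ _ _ K).
by rewrite mxE eq_sym (negPf i0) andbF mulr0.
Qed.

End OneChart.
End Warped.

(** * From GRW to LCS *)

Section MetricLaw.
Variables (R : realType) (n : nat) (M : manifold R n.+1) (g : lorentz_metric M).
Implicit Types (c d : chart R n.+1 M) (u : 'rV[R]_n.+1 -> 'rV[R]_n.+1).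

Lemma metric_Ck c i j k : atlas c -> Ck k (cimg c) (fun x => g c x i j).
Proof. by move=> ac; exact: (smooth_onP _ _).1 (metric_smooth g ac i j) k. Qed.

Lemma lower_Ck c u k j : atlas c -> smooth_map (cimg c) u -> Ck k (cimg c) (fun x => lower (g c) u x 0 j).
Proof.
move=> ac su; apply: (@Ck_eq _ _ _ _ (fun x => \sum_i u x 0 i * g c x i j)) => //.
- exact: atlas_open.
- by move=> x _; rewrite /lower mxE.
apply: Ck_sum => [|i _]; first exact: atlas_open.
by apply: CkM; [exact: atlas_open|exact: su|exact: metric_Ck].
Qed.

Lemma transition_cimg c d x : atlas c -> atlas d -> overlap c d x -> cimg d (transition c d x).
Proof. by move=> ac ad ox; apply: overlap_cimg; exact: overlap_transition ox. Qed.

Lemma lower_transform c d u u' x : atlas c -> atlas d -> overlap c d x ->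
  u' (transition c d x) = u x *m transition_jac c d x ->
  lower (g c) u x = lower (g d) u' (transition c d x) *m (transition_jac c d x)^T.
Proof. by move=> ac ad ox E; rewrite /lower (metric_transform g ac ad ox) E !mulmxA. Qed.

Lemma metric_nabla_transform c d u u' x k j : atlas c -> atlas d -> overlap c d x ->
  (forall y, overlap c d y -> u' (transition c d y) = u y *m transition_jac c d y) ->
  smooth_map (cimg d) u' ->
  nabla (g c) (lower (g c) u) x k j =
    \sum_a \sum_b transition_jac c d x k a * transition_jac c d x j b *
      nabla (g d) (lower (g d) u') (transition c d x) a b.
Proof.
move=> ac ad ox uu su; rewrite transition_jacE.
apply: (@nabla_transform R n (overlap c d) (cimg d)) => //.
- exact: overlap_open.
- exact: atlas_open.
- exact: transition_smooth.
- by move=> y oy; exact: transition_cimg.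
- by move=> y oy; exact: metric_transform.
- by move=> a b; exact: metric_Ck.
- by move=> b; exact: lower_Ck.
- by move=> z; exact: metric_symmetric.
- by move=> y /overlap_cimg; exact: metric_unit.
- by move=> z; exact: metric_unit.
Qed.

Lemma sandwich_entry (A J : 'M[R]_n.+1) k j :
  (J *m A *m J^T) k j = \sum_a \sum_b J k a * J j b * A a b.
Proof.
rewrite mxE exchange_big /=; apply: eq_bigr => b _.
rewrite !mxE mulr_suml; apply: eq_bigr => a _; ring.
Qed.

Lemma dot_mulmx (a b : 'rV[R]_n.+1) : \sum_i a 0 i * b 0 i = (a *m b^T) 0 0.
Proof. by rewrite mxE; apply: eq_bigr => i _; rewrite mxE. Qed.

(** The projection orthogonal to a unit timelike field, with both indices
    lowered; here om is the lowered field. *)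
Definition spatial (om : 'rV[R]_n.+1) (G : 'M[R]_n.+1) : 'M[R]_n.+1 := om^T *m om + G.

Lemma spatialE om G k j : spatial om G k j = om 0 k * om 0 j + G k j.
Proof. by rewrite mxE; congr (_ + _); rewrite mxE big_ord1 mxE. Qed.

Lemma spatial_transform om om' (J G G' : 'M[R]_n.+1) :
  om = om' *m J^T -> G = J *m G' *m J^T ->
  spatial om G = J *m spatial om' G' *m J^T.
Proof.
by move=> -> ->; rewrite /spatial mulmxDr mulmxDl trmx_mul trmxK !mulmxA.
Qed.

(** Both sides are covariant 2-tensors, so the equation passes from one
    chart to another with the same scalar f. *)
Lemma LCS_equation_transform c d u u' x f : atlas c -> atlas d -> overlap c d x ->
  (forall y, overlap c d y -> u' (transition c d y) = u y *m transition_jac c d y) ->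
  smooth_map (cimg d) u' ->
  (forall a b, nabla (g d) (lower (g d) u') (transition c d x) a b =
     f * spatial (lower (g d) u' (transition c d x)) (g d (transition c d x)) a b) ->
  forall k j, nabla (g c) (lower (g c) u) x k j =
     f * spatial (lower (g c) u x) (g c x) k j.
Proof.
move=> ac ad ox uu su E k j.
rewrite (metric_nabla_transform k j ac ad ox uu su).
rewrite (spatial_transform (lower_transform ac ad ox (uu x ox)) (metric_transform g ac ad ox)).
rewrite sandwich_entry mulr_sumr; apply: eq_bigr => a _.
rewrite mulr_sumr; apply: eq_bigr => b _; rewrite E; ring.
Qed.

End MetricLaw.

Section GRWtoLCS.
Variables (R : realType) (n : nat) (M : manifold R n.+1) (g : lorentz_metric M).
Hypothesis n0 : (0 < n)%N.
Local Notation e0 := ('e_0 : 'rV[R]_n.+1).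

(** For every point p a warped chart w p is chosen.  The field u is d/dt of
    that chart, phi its q'/q and mu = - d_t phi; what has to be checked is that
    these do not depend on the choice, hence are smooth. *)
Lemma GRW_LCS : GRW g -> LCS g.
Proof.
move=> [W [q [Watlas Wcover Wwarp Wtime [c1 [Wc1 [x1 [y1 [cx1 cy1 q1]]]]]]]].
have /choice[w Hw] : forall p : M, exists c, W c /\ cdom c p.
  by move=> p; have [c Wc cp] := Wcover p; exists c.
pose tm (x : 'rV[R]_n.+1) : R := time_coord (x : 'rV[R]_(1 + n)).
pose ph d (y : 'rV[R]_n.+1) := derive1 (q d) (tm y) / q d (tm y).
pose u c x := row 0 (transition_jac (w (cinv c x)) c (cmap (w (cinv c x)) (cinv c x))).
pose phi (p : M) := ph (w p) (cmap (w p) p).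
pose mu (p : M) := - partial 0 (ph (w p)) (cmap (w p) p).
(* A spatial direction. *)
pose i1 : 'I_n.+1 := rshift 1 (Ordinal n0).
have Wa d : W d -> atlas d by exact: Watlas.
have e0_smooth (U : set 'rV[R]_n.+1) : smooth_map U (fun=> e0) by move=> k j; exact: Ck_cst.
have nabW d y : W d -> cimg d y -> forall k j, nabla (g d) (lower (g d) (fun=> e0)) y k j =
    ph d y * spatial (lower (g d) (fun=> e0) y) (g d y) k j.
  by move=> Wd dy k j; rewrite (warped_nabla (Wa d Wd) (Wwarp d Wd))// spatialE.
have rowW d d' y : W d -> W d' -> overlap d d' y -> e0 = e0 *m transition_jac d d' y.
  by move=> Wd Wd' oy; rewrite -rowE Wtime.
have lowW d y : W d -> cimg d y -> lower (g d) (fun=> e0) y = - e0.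
  by move=> Wd dy; have K := warped_lower (Wwarp d Wd) dy.
(* The spatial diagonal entry of the equation determines phi: there u_i u_i
   vanishes and g_(i i) is positive. *)
have phW d d' y : W d -> W d' -> overlap d d' y -> ph d' (transition d d' y) = ph d y.
  move=> Wd Wd' oy; have dy := overlap_cimg oy.
  have ad := Wa _ Wd; have ad' := Wa _ Wd'.
  have dy' := transition_cimg ad ad' oy.
  have := LCS_equation_transform ad ad' oy (fun z oz => rowW d d' z Wd Wd' oz)
    (e0_smooth _) (nabW d' _ Wd' dy') i1 i1.
  have i10 : (i1 == 0) = false by [].
  have z : (- e0) 0 i1 = 0 by rewrite !mxE i10 andbF oppr0.
  rewrite (nabW d)// spatialE lowW// z mul0r add0r.
  move=> /esym /mulIf; apply; rewrite gt_eqF//.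
  exact: (warped_diag_pos (Wwarp d Wd)).
have phi_loc d y : W d -> cimg d y -> phi (cinv d y) = ph d y.
  move=> Wd dy; set p := cinv d y; have [Wp wp] := Hw p.
  have ad := Wa _ Wd; have aw := Wa _ Wp.
  have oy : overlap d (w p) y by apply/overlapE.
  by rewrite /phi -(phW d (w p) y)// /transition.
(* The charts of W share their e_0, so any of them may be used instead of the
   chosen one. *)
have u_loc c d x : atlas c -> W d -> overlap c d x ->
    u c x = row 0 (transition_jac d c (transition c d x)).
  move=> ac Wd ox; rewrite /u; set p := cinv c x; have [Wp wp] := Hw p.
  have ad := Wa _ Wd; have aw := Wa _ Wp; have cx := overlap_cimg ox.
  have cp : cdom c p by exact: cinv_cdom.
  have dp : cdom d p by case/overlapE: ox.
  have o1 : overlap (w p) d (cmap (w p) p) by exists p.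
  have o2 : overlap (w p) c (cmap (w p) p) by exists p.
  rewrite (transition_jac_comp aw ad ac o1 o2) row_mul (Wtime (w p) d Wp Wd _ o1).
  by rewrite -rowE /transition cinvK.
have ph_Ck d k : W d -> Ck k (cimg d) (ph d).
  by move=> Wd; exact: (warped_phi_Ck (Wa _ Wd) (Wwarp d Wd)).
have ph_partial d y i : W d -> cimg d y -> i != 0 -> partial i (ph d) y = 0.
  by move=> Wd dy i0; exact: (warped_phi_partial (Wwarp d Wd)).
have phic d c x j : W d -> atlas c -> overlap c d x ->
    partial j (phi \o cinv c) x = transition_jac c d x j 0 * partial 0 (ph d) (transition c d x).
  move=> Wd ac ox; have ad := Wa _ Wd.
  rewrite (@partial_near _ _ _ (ph d \o transition c d)); last first.
    apply: (near_open (overlap_open ac ad) ox) => y oy.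
    by rewrite /= -(phi_loc d)// ?cinv_transition//; exact: transition_cimg.
  have H := derive_jac_sum j (atlas_open ad) (transition_smooth ac ad) ox (transition_cimg ac ad ox) (ph_Ck d 1%N Wd).
  rewrite /partial (@derive_val _ _ _ _ _ _ _ H) (bigD1 0)//= big1 ?addr0//.
  by move=> i i0; rewrite ph_partial ?mulr0//; exact: transition_cimg.
have mu_loc d y : W d -> cimg d y -> mu (cinv d y) = - partial 0 (ph d) y.
  move=> Wd dy; set p := cinv d y; have [Wp wp] := Hw p.
  have ad := Wa _ Wd; have aw := Wa _ Wp.
  have oy : overlap d (w p) y by apply/overlapE.
  have := phic (w p) d y 0 Wp ad oy.
  have -> : transition_jac d (w p) y 0 0 = 1.
    have := Wtime d (w p) Wd Wp y oy => /rowP /(_ 0); rewrite !mxE !eqxx => ->.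
    by [].
  rewrite mul1r /mu => <-; congr (- _).
  by apply: partial_near; apply: (near_open (atlas_open ad) dy) => z dz; exact: phi_loc.
have local c x : atlas c -> cimg c x -> exists2 d, W d & overlap c d x.
  by move=> ac cx; have [Wp wp] := Hw (cinv c x); exists (w (cinv c x)) => //; apply/overlapE.
exists u, phi, mu; split.
- split=> [c ac i|c d ac ad x ox].
    apply/smooth_onP => k; apply: Ck_local => x cx.
    have [d Wd ox] := local c x ac cx; have ad := Wa _ Wd.
    exists (overlap c d) => //.
    apply: (@Ck_eq _ _ _ _ ((fun y => transition_jac d c y 0 i) \o transition c d)).
    + exact: overlap_open.
    + by move=> y oy; rewrite /= (u_loc c d)// [RHS]mxE.
    apply: (Ck_comp (overlap_open ad ac) (overlap_open ac ad)).
    + by move=> y; exact: overlap_transition.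
    + apply: (@Ck_eq _ _ _ _ (partial 0 (fun y => transition d c y 0 i))).
      * exact: overlap_open.
      * by move=> y _; rewrite mxE.
      * by have [_ /(_ 0)[_]] := transition_smooth ad ac k.+1 i.
    + by move=> j; exact: transition_smooth.
  have cx := overlap_cimg ox; have [e We oe] := local c x ac cx; have ae := Wa _ We.
  have dT := transition_cimg ac ad ox.
  have o1 : overlap d e (transition c d x).
    by apply/overlapE => //; split=> //; rewrite cinv_transition//; case/overlapE: oe.
  have E1 : transition d e (transition c d x) = transition c e x.
    by rewrite /transition -[cmap d (cinv c x)]/(transition c d x) cinv_transition.
  have eT := transition_cimg ac ae oe.
  have o2 : overlap e c (transition c e x) by exact: overlap_transition.
  have o3 : overlap e d (transition c e x).
    by apply/overlapE => //; split=> //; rewrite cinv_transition//; case/overlapE: ox.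
  rewrite (u_loc d e)// (u_loc c e)// E1 -row_mul; congr (row _ _).
  by rewrite (transition_jac_comp ae ac ad o2 o3) transitionK.
- move=> c ac; apply/smooth_onP => k; apply: Ck_local => x cx.
  have [d Wd ox] := local c x ac cx; have ad := Wa _ Wd.
  exists (overlap c d) => //.
  apply: (@Ck_eq _ _ _ _ (ph d \o transition c d)).
  + exact: overlap_open.
  + move=> y oy; rewrite /= -(phi_loc d)// ?cinv_transition//; exact: transition_cimg.
  apply: (Ck_comp (atlas_open ad) (overlap_open ac ad)).
  + by move=> y; exact: transition_cimg.
  + exact: ph_Ck.
  + by move=> j; exact: transition_smooth.
- move=> c ac; apply/smooth_onP => k; apply: Ck_local => x cx.
  have [d Wd ox] := local c x ac cx; have ad := Wa _ Wd.
  exists (overlap c d) => //.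
  apply: (@Ck_eq _ _ _ _ ((fun y => - partial 0 (ph d) y) \o transition c d)).
  + exact: overlap_open.
  + move=> y oy; rewrite /= -(mu_loc d)// ?cinv_transition//; exact: transition_cimg.
  apply: (Ck_comp (atlas_open ad) (overlap_open ac ad)).
  + by move=> y; exact: transition_cimg.
  + by apply: CkN; [exact: atlas_open|have [_ /(_ 0)[_]] := ph_Ck d k.+1 Wd].
  + by move=> j; exact: transition_smooth.
- (* Otherwise q' would vanish on the interval of times of c1. *)
  apply: contrapT => H.
  have phi0 p : phi p = 0.
    by apply/eqP; apply: contrapT => /negP h; apply: H; exists p.
  have [I [V [h [[oI iI oV] E [qp dq] _ _]]]] := Wwarp c1 Wc1.
  have q'0 t : I t -> derive1 (q c1) t = 0.
    move=> It; pose y := pt t (space_coord (x1 : 'rV[R]_(1 + n))).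
    have cy : cimg c1 y.
      by move: (cx1); rewrite E /= time_pt space_pt => -[].
    have := phi_loc c1 y Wc1 cy; rewrite phi0 /ph /tm time_pt => /esym/eqP.
    by rewrite mulf_eq0 invr_eq0 (gt_eqF (qp t It)) orbF => /eqP.
  have const (s t : R) : I s -> I t -> s <= t -> q c1 s = q c1 t.
    move=> Is It st; have Iu (r : R) : s <= r -> r <= t -> I r.
      by move=> su ut; apply: (iI s t) => //; rewrite su ut.
    have [r||r] := @MVT_segment R (q c1) (derive1 (q c1)) s t st.
    + rewrite in_itv /= => /andP[su ut]; rewrite derive1E; apply: derivableP.
      by apply: (dq 0%N); apply: Iu; exact: ltW.
    + apply: derivable_within_continuous => r; rewrite in_itv /= => /andP[su ut].
      by apply: (dq 0%N); exact: Iu.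
    + rewrite in_itv /= => /andP[su ut]; rewrite q'0 ?mul0r; last exact: Iu.
      by move/eqP; rewrite subr_eq0 => /eqP.
  move/eqP: q1; apply.
  have I1 : I (tm x1) by move: (cx1); rewrite E => -[].
  have I2 : I (tm y1) by move: (cy1); rewrite E => -[].
  by have [/const|/ltW /const] := leP (tm x1) (tm y1) => H'; [apply: H'|apply/esym/H'].
move=> c ac x cx u_; have [d Wd ox] := local c x ac cx; have ad := Wa _ Wd.
have dT := transition_cimg ac ad ox.
have uu y : overlap c d y -> e0 = u c y *m transition_jac c d y.
  move=> oy; rewrite (u_loc c d)// -row_mul.
  have := transition_jac_inv ad ac (overlap_transition ac ad oy).
  by rewrite transitionK// => ->; rewrite row1.
have lowc : u_ x = - e0 *m (transition_jac c d x)^T.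
  by rewrite /u_ (lower_transform g (u' := fun=> e0) ac ad ox (uu x ox)) lowW.
split.
- rewrite dot_mulmx.
  rewrite lowc trmx_mul trmxK mulmxA -(uu x ox) linearN /= mulmxN mxE.
  by rewrite -rowE !mxE !eqxx.
- move=> k j; rewrite (LCS_equation_transform ac ad ox uu (e0_smooth _) (nabW d _ Wd dT)).
  rewrite spatialE; congr (_ * _).
  by rewrite -(phi_loc d)// cinv_transition.
- move=> j; rewrite (phic d)// -(cinv_transition ac ad ox) mu_loc//.
  rewrite lowc mulNmx -rowE !mxE; ring.
Qed.

End GRWtoLCS.

(** * Charts adapted to a closed unit field *)

Section AdaptedCoordinates.
Variables (R : realType) (n : nat).
Local Notation N := (1 + n)%N.

(** The extended row basis of the one-row matrix u has a multiple of u as its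
    first row. *)
Lemma complete_basis (u : 'rV[R]_N) : u != 0 -> exists S : 'M[R]_(n, N), col_mx u S \in unitmx.
Proof.
move=> u0; pose K := row_ebase u; pose L := col_ebase u.
have uE : u = L *m usubmx K.
  rewrite -{1}(mulmx_ebase u) rank_rV u0 -mulmxA; congr (_ *m _).
  have -> : pid_mx true = row_mx 1%:M 0 :> 'M[R]_(1, 1 + n).
    apply/rowP => j; rewrite mxE; case: (split_ordP j) => l ->.
      by rewrite row_mxEl (ord1 l) !mxE.
    by rewrite row_mxEr !mxE.
  by rewrite -/K -[in LHS](vsubmxK K) mul_row_col mul1mx mul0mx addr0.
exists (dsubmx K).
have -> : col_mx u (dsubmx K) = block_mx L 0 0 1%:M *m K.
  by rewrite -[in RHS](vsubmxK K) mul_block_col !mul0mx mul1mx addr0 add0r -uE.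
rewrite unitmx_mul row_ebase_unit andbT unitmxE det_ublock det1 mulr1 -unitmxE.
exact: col_ebase_unit.
Qed.

Lemma ball_tube m (O : set 'rV[R]_(1 + m)) (t : R) s : open O -> O (pt t s) ->
  exists2 d : R, 0 < d & forall z, `|time_coord z - t| < d -> `|space_coord z - s| < d -> O z.
Proof.
move=> oO Ots; have /nbhs_distP[d d0 H] : nbhs (pt t s) O by exact: open_nbhs_nbhs.
exists d => // z tz sz; apply: H; apply: mx_norm_lt => // i j; rewrite (ord1 i).
rewrite -(pt_time_space z); case: (split_ordP j) => l ->; rewrite mxE [X in _ + X]mxE.
  by rewrite !row_mxEl (ord1 l) !mxE eqxx !mulr1n -/(time_coord z).
rewrite !row_mxEr; apply: le_lt_trans sz.
by have := mx_norm_coord (space_coord z - s) 0 l; rewrite !mxE.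
Qed.

(** With om = - d th and a hyperplane x0 + y S transversal to u(x0), the
    coordinates (t, y) stand for the point reached from s = x0 + y S by the flow
    of u after the time t - th(s).  The flow increases th at unit speed, so
    th = t at that point, and the closed form becomes - dt.  Transversality
    makes the Jacobian invertible at the origin, and [local_diffeo] applies. *)
Lemma adapted_coordinates (U : set 'rV[R]_N) (u om : 'rV[R]_N -> 'rV[R]_N) x0 :
  open U -> U x0 -> smooth_map U u -> smooth_map U om ->
  (forall x, U x -> \sum_i u x 0 i * om x 0 i = - 1) ->
  (forall x i j, U x -> partial i (fun y => om y 0 j) x = partial j (fun y => om y 0 i) x) ->
  exists (d : R) (F G : 'rV[R]_N -> 'rV[R]_N) (O' : set 'rV[R]_N),
  let B := tube d [set s : 'rV[R]_n | `|s| < d] in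
  [/\ 0 < d, open O', O' `<=` U & O' x0] /\
  [/\ smooth_map B F, smooth_map O' G,
     forall z, B z -> O' (F z) /\ G (F z) = z,
     forall x, O' x -> B (G x) /\ F (G x) = x &
     forall z, B z -> row (lshift n 0) (jac F z) = u (F z) /\
       om (F z) *m (jac F z)^T = - 'e_(lshift n 0)].
Proof.
move=> oU Ux0 su som norm closed.
have sNom : smooth_map U (fun x => - om x).
  move=> k j; apply: (@Ck_eq _ _ _ _ (fun x => - om x 0 j)) => //.
    by move=> x _; rewrite mxE.
  exact: CkN.
have partialN i j x : U x -> partial i (fun y => (- om y) 0 j) x = - partial i (fun y => om y 0 j) x.
  move=> Ux; have -> : (fun y => (- om y) 0 j) = - (fun y => om y 0 j).
    by apply/funext => y; rewrite mxE.
  by rewrite /partial deriveN//; have [_ /(_ i)[+ _]] := som 1%N j; apply.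
have closedN x i j : U x -> partial i (fun y => (- om y) 0 j) x = partial j (fun y => (- om y) 0 i) x.
  by move=> Ux; rewrite !partialN// closed.
have [V [th [oV Vx0 VU [sth th0 dth]]]] := poincare oU Ux0 sNom closedN.
have [a [r [Fl [a0 r0 sFl Fl0 dFl]]]] := smooth_flow oU Ux0 su.
set D := tube a _ in sFl dFl.
have oD : open D by apply: tube_open; exact: norm_ball_open.
have sFl' : smooth_map D Fl by move=> k j; exact: sFl.
have D0 : D (pt 0 x0) by apply: tube_pt; rewrite ?normr0//= subrr normr0.
pose D1 := [set z | D z /\ (V (Fl z) /\ V (space_coord z))].
have oD1 : open D1.
  have h1 : open [set z | D z /\ V (Fl z)].
    by apply: (open_preimage oD oV) => z; exact: smooth_map_continuous.
  have h2 := open_preimage h1 oV (fun z _ => @space_continuous R _ z).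
  move: h2; congr open; apply/seteqP; split=> z /=.
    by move=> [[? ?] ?].
  by move=> [? [? ?]].
have D10 : D1 (pt 0 x0) by split=> //; rewrite Fl0 space_pt.
have [d1 d10 HD1] := ball_tube oD1 D10.
pose E := tube d1 [set s : 'rV[R]_N | `|s - x0| < d1].
have ED z : E z -> D1 z by move=> [tz sz]; apply: HD1; rewrite ?subr0.
have oE : open E by apply: tube_open; exact: norm_ball_open.
(* The function th grows with unit speed along the flow. *)
have thFl z : E z -> th (Fl z) = time_coord z + th (space_coord z).
  have VFl w : E w -> V (Fl w) by move=> /ED[_ []].
  have dE1 w : E w -> is_derive w 'e_(lshift N 0) (th \o Fl) 1.
    move=> Ew; have [Dw [VFw _]] := ED w Ew.
    have h := derive_jac_sum (lshift N 0) oV sFl' Dw VFw (sth 1%N).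
    apply: is_derive_eq h _.
    rewrite -[RHS]opprK -(norm (Fl w)); last exact: VU.
    rewrite -sumrN; apply: eq_bigr => b _.
    by rewrite dth// !mxE mulrN; congr (- (_ * _)); have [_ ->] := dFl w Dw.
  have dE2 w : is_derive w 'e_(lshift N 0) (hat (fun t s => t + th s)) 1.
    apply/hat_is_derive_time.
    have := is_deriveD (is_derive_id (time_coord w) (1 : R)) (is_derive_cst (th (space_coord w)) (time_coord w) (1 : R)).
    by move=> H; apply: is_derive_eq H _; rewrite addr0.
  apply: (@tube_eq R N d1 [set s : 'rV[R]_N | `|s - x0| < d1] (th \o Fl) (hat (fun t s => t + th s))) => w.
  - by move=> Ew; have [] := dE1 w Ew.
  - by move=> _; have [] := dE2 w.
  - move=> Ew; rewrite /partial (@derive_val _ _ _ _ _ _ _ (dE1 w Ew)).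
    by rewrite (@derive_val _ _ _ _ _ _ _ (dE2 w)).
  - by move=> _; rewrite /= Fl0 /hat time_pt space_pt add0r.
(* The rows of S complete u(x0) to a basis. *)
have ux0 : u x0 != 0.
  apply/eqP => u0; have := norm x0 Ux0; rewrite u0.
  rewrite big1 => [/esym/eqP|i _]; last by rewrite mxE mul0r.
  by rewrite oppr_eq0 oner_eq0.
have [S uS] := complete_basis ux0.
pose s (z : 'rV[R]_N) : 'rV[R]_N := x0 + space_coord z *m S.
have sE j : (fun z => s z 0 j) = (fun z => x0 0 j + \sum_k z 0 (rshift 1 k) * S k j).
  by apply/funext => z; rewrite !mxE; congr (_ + _); apply: eq_bigr => k _; rewrite mxE.
have ss (O : set 'rV[R]_N) : open O -> smooth_map O s.
  move=> oO k j; rewrite sE; apply: CkD => //; first exact: Ck_cst.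
  by apply: Ck_sum => // i _; apply: CkM => //; [exact: Ck_coord|exact: Ck_cst].
pose O1 := [set z : 'rV[R]_N | V (s z)].
have oO1 : open O1.
  have := @open_preimage _ _ setT V s openT oV (fun x _ => smooth_map_continuous (ss _ openT) I).
  by congr open; apply/seteqP; split=> x //= [].
pose ins (z : 'rV[R]_N) : 'rV[R]_(1 + N) := pt (time_coord z - th (s z)) (s z).
have insl q : (fun z => ins z 0 (lshift N q)) = (fun z => z 0 (lshift n 0) - (th \o s) z).
  by apply/funext => z; rewrite row_mxEl (ord1 q) mxE eqxx mulr1n /time_coord mxE.
have insr q : (fun z => ins z 0 (rshift 1 q)) = (fun z => s z 0 q).
  by apply/funext => z; rewrite row_mxEr.
have sth' k : Ck k O1 (th \o s) by apply: (Ck_comp oV oO1) => // j; exact: ss.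
have sins : smooth_map O1 ins.
  move=> k j; case: (split_ordP j) => q ->; last by rewrite insr; exact: ss.
  by rewrite insl; apply: CkB => //; exact: Ck_coord.
pose O2 := [set z | O1 z /\ E (ins z)].
have oO2 : open O2 by apply: (open_preimage oO1 oE) => z; exact: smooth_map_continuous.
have s0 : s 0 = x0 by rewrite /s (_ : space_coord 0 = 0) ?mul0mx ?addr0// /space_coord linear0.
have ins0 : ins 0 = pt 0 x0.
  by rewrite /ins s0 th0 subr0 /time_coord linear0 mxE.
have O20 : O2 0.
  split; first by rewrite /O1 /= s0.
  by rewrite ins0; apply: tube_pt; rewrite ?normr0//= subrr normr0.
pose F := Fl \o ins.
have insD z : O2 z -> D (ins z) by move=> [_ /ED[]].
have sins2 : smooth_map O2 ins by move=> k j; apply: Ck_sub (sins k j) => z [].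
have sF : smooth_map O2 F by exact: (smooth_map_comp oD oO2 insD sFl' sins2).
have jF z : O2 z -> jac F z = jac ins z *m jac Fl (ins z).
  by move=> Oz; apply: (jac_comp oD sFl' sins2 Oz); exact: insD.
have row0ins z : O2 z -> row (lshift n 0) (jac ins z) = 'e_(lshift N 0).
  move=> Oz; apply/rowP => j; rewrite !mxE.
  case: (split_ordP j) => q ->.
    have h1 : is_derive z 'e_(lshift n 0) (th \o s) 0.
      by apply/(hat_is_derive_time (fun t y => th (x0 + y *m S))); exact: is_derive_cst.
    have h2 := is_deriveB (is_derive_coord (lshift n 0) z 'e_(lshift n 0)) h1.
    rewrite insl /partial (@derive_val _ _ _ _ _ _ _ h2) mxE (ord1 q) !eqxx subr0.
    by [].
  have h1 : is_derive z 'e_(lshift n 0) (fun z => s z 0 q) 0.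
    by apply/(hat_is_derive_time (fun t y => (x0 + y *m S) 0 q)); exact: is_derive_cst.
  by rewrite insr /partial (@derive_val _ _ _ _ _ _ _ h1) eq_rlshift andbF.
have row0F z : O2 z -> row (lshift n 0) (jac F z) = u (F z).
  move=> Oz; rewrite jF// row_mul row0ins// -rowE.
  by apply/rowP => j; rewrite !mxE; have [_ ->] := dFl _ (insD z Oz).
have thF z : O2 z -> th (F z) = time_coord z.
  by move=> [_ Ez]; rewrite /F /= thFl// /ins time_pt space_pt subrK.
have F0 : F 0 = x0 by rewrite /F /= ins0 Fl0.
have uF : jac F 0 \in unitmx.
  (* Up to a unipotent factor the Jacobian matrix at 0 has the rows u(x0) and S. *)
  pose ka := \col_(a < n) jac ins 0 (rshift 1 a) (lshift N 0).
  have J1 : jac ins 0 = block_mx (1%:M : 'M[R]_1) 0 ka S.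
    apply/matrixP => i j; case: (split_ordP i) => k ->.
      have -> : jac ins 0 (lshift n k) j = row (lshift n 0) (jac ins 0) 0 j.
        by rewrite (ord1 k) [RHS]mxE.
      rewrite row0ins// [LHS]mxE; case: (split_ordP j) => l ->.
        by rewrite block_mxEul (ord1 k) (ord1 l) !mxE !eqxx.
      by rewrite block_mxEur mxE eq_rlshift andbF.
    case: (split_ordP j) => l ->; first by rewrite block_mxEdl [RHS]mxE (ord1 l).
    rewrite block_mxEdr mxE insr sE.
    have h : is_derive (0 : 'rV[R]_N) 'e_(rshift 1 k) (fun z => x0 0 l + \sum_k z 0 (rshift 1 k) * S k l)
        (0 + \sum_(q < n) ('e_(rshift 1 k) : 'rV[R]_N) 0 (rshift 1 q) * S q l).
      apply: is_deriveD; apply: is_derive_sumr => q _.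
      have h := is_deriveM (is_derive_coord (rshift 1 q) (0 : 'rV[R]_N) 'e_(rshift 1 k)) (is_derive_cst (S q l) _ _).
      by apply: is_derive_eq h _; rewrite scaler0 add0r [_ *: _]mulrC.
    rewrite /partial (@derive_val _ _ _ _ _ _ _ h) add0r (bigD1 k)//= big1 ?addr0.
      by rewrite mxE !eqxx mul1r.
    by move=> q qk; rewrite mxE (inj_eq (@rshift_inj _ _)) (negPf qk) andbF mul0r.
  have J2 : jac Fl (ins 0) = col_mx (u x0) 1%:M.
    rewrite ins0; apply/matrixP => i j; rewrite mxE; case: (split_ordP i) => k ->.
      rewrite col_mxEu (ord1 k); have [_ ->] := dFl _ D0.
      by rewrite Fl0.
    rewrite col_mxEd mxE.
    have -> : (fun z => Fl z 0 j) = hat (fun t s => Fl (pt t s) 0 j).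
      by apply/funext => w; rewrite /hat pt_time_space.
    rewrite partial_hat time_pt space_pt.
    have -> : (fun s => Fl (pt 0 s) 0 j) = (fun s => s 0 j) by apply/funext => w; rewrite Fl0.
    by rewrite partial_coord.
  rewrite jF// J1 J2 mul_block_col mul1mx mul0mx addr0 mulmx1.
  have -> : col_mx (u x0) (ka *m u x0 + S) = block_mx (1%:M : 'M[R]_1) 0 ka 1%:M *m col_mx (u x0) S.
    by rewrite mul_block_col !mul1mx mul0mx addr0.
  rewrite unitmx_mul uS andbT unitmxE det_lblock !det1 mulr1.
  exact: unitr1.
have [P [P' [G [oO oO' O0 OO2 [sG GF FG]]]]] := local_diffeo oO2 O20 sF uF.
have O0' : P (pt 0 0).
  have -> : pt 0 0 = 0 :> 'rV[R]_N by rewrite /pt raddf0 row_mx0.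
  exact: O0.
have [d d0 Hd] := ball_tube oO O0'.
pose B := tube d [set s : 'rV[R]_n | `|s| < d].
have BO z : B z -> P z by move=> [tz sz]; apply: Hd; rewrite ?subr0.
have oB : open B by apply: tube_open; exact: origin_ball_open.
have FV z : O2 z -> V (F z) by move=> [_ /ED[_ []]].
exists d, F, G, [set x | P' x /\ B (G x)]; split; split => //.
- by apply: (open_preimage oO' oB) => x; exact: smooth_map_continuous.
- move=> x [P'x BGx]; have [PG <-] := FG x P'x; apply: VU; apply: FV; exact: OO2.
- rewrite -F0; have [P'F0 GF0] := GF 0 O0; split=> //; rewrite GF0.
  have -> : (0 : 'rV[R]_N) = pt 0 0 by rewrite /pt raddf0 row_mx0.
  by apply: tube_pt; rewrite ?normr0//= normr0.
- by move=> k j; apply: Ck_sub (sF k j) => z /BO/OO2.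
- by move=> k j; apply: Ck_sub (sG k j) => z [].
- by move=> z Bz; have [h1 h2] := GF z (BO z Bz); split=> //; split=> //; rewrite h2.
- by move=> x [P'x BGx]; split=> //; have [] := FG x P'x.
move=> z Bz; have O2z := OO2 _ (BO z Bz); split; first exact: row0F.
apply/rowP => j.
have h := derive_jac_sum j oV sF O2z (FV z O2z) (sth 1%N).
have h2 : is_derive z 'e_j (th \o F) ((j == lshift n 0)%:R).
  apply: (near_eq_is_derive (f := fun z : 'rV[R]_N => z 0 (lshift n 0))).
    by apply: (near_open oO2 O2z) => y O2y; rewrite /= thF// /time_coord mxE.
  apply: is_derive_eq (is_derive_coord _ _ _) _.
  by rewrite mxE eqxx eq_sym.
have := @derive_val _ _ _ _ _ _ _ h; rewrite (@derive_val _ _ _ _ _ _ _ h2) => h3.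
rewrite [RHS]mxE [X in - X]mxE eqxx /= h3 -sumrN mxE; apply: eq_bigr => b _.
by rewrite dth ?mxE; [rewrite mulrN opprK mulrC; congr (_ * _); rewrite mxE|exact: FV].
Qed.

End AdaptedCoordinates.

Section AdaptedChart.
Variables (R : realType) (n : nat) (M : manifold R n.+1) (g : lorentz_metric M).
Local Notation e0 := ('e_0 : 'rV[R]_n.+1).

(** The composition of a chart with a diffeomorphism is compatible with all
    charts of the atlas, so it belongs to it by maximality. *)
Lemma change_coordinates (c : chart R n.+1 M) (B Q : set 'rV[R]_n.+1)
    (F G : 'rV[R]_n.+1 -> 'rV[R]_n.+1) :
  atlas c -> open B -> open Q -> Q `<=` cimg c -> smooth_map B F -> smooth_map Q G ->
  (forall z, B z -> Q (F z) /\ G (F z) = z) ->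
  (forall x, Q x -> B (G x) /\ F (G x) = x) ->
  exists e : chart R n.+1 M, [/\ atlas e, cimg e = B,
    forall p, cdom c p -> Q (cmap c p) -> cdom e p,
    forall z, B z -> overlap c e (F z) &
    forall x, Q x -> transition c e x = G x].
Proof.
move=> ac oB oQ Qc sF sG GF FG.
pose e : chart R n.+1 M := Chart [set p | cdom c p /\ Q (cmap c p)]
  (G \o cmap c) (cinv c \o F).
have [oc oic ck cc ci] := atlas_chart ac.
have eB : cimg e = B.
  apply/seteqP; split=> [_ [p [cp Qp] <-]|z Bz]; first by have [] := FG _ Qp.
  have [Qz GFz] := GF z Bz; have cz := Qc _ Qz.
  exists (cinv c (F z)); first by split; [exact: cinv_cdom|rewrite cmapK].
  by rewrite /= cmapK.
have che : is_chart e.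
  split=> //.
  - exact: (open_preimage oc oQ).
  - by rewrite eB.
  - by move=> p [cp Qp] /=; have [_ ->] := FG _ Qp; exact: ck.
  - move=> p [cp Qp]; apply: continuous_comp; first exact: cc.
    exact: smooth_map_continuous sG Qp.
  - rewrite eB => z Bz; apply: continuous_comp; first exact: smooth_map_continuous sF Bz.
    by apply: ci; apply: Qc; have [] := GF z Bz.
have ae : atlas e.
  apply: atlas_maximal => // d ad.
  have [od _ _ _ _] := atlas_chart ad.
  have oed : open (overlap e d).
    have [_ oe _ _ ie] := che.
    have -> : overlap e d = [set x | cimg e x /\ cdom d (cinv e x)].
      apply/seteqP; split=> [_ [p [ep dp] <-]|x [[p ep <-] dx]].
        have [_ _ H _ _] := che; have K := H p ep.
        by split; [exists p|change (cdom d (cinv e (cmap e p))); rewrite K].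
      have [_ _ H _ _] := che; have K := H p ep; exists p => //; split=> //.
      by move: dx; rewrite K.
    exact: open_preimage.
  have ode : open (overlap d e).
    have [oe _ _ _ _] := che; have [_ oid _ _ iid] := atlas_chart ad.
    have -> : overlap d e = [set x | cimg d x /\ cdom e (cinv d x)].
      apply/seteqP; split=> x; first by move=> /(overlapE e x ad).
      by move=> H; apply/(overlapE e x ad).
    exact: open_preimage.
  have ed z : overlap e d z -> B z /\ overlap c d (F z).
    move=> [p [[cp Qp] dp] <-] /=; have [BG FGp] := FG _ Qp; split=> //.
    by rewrite FGp; exists p.
  have de x : overlap d e x -> overlap d c x /\ Q (transition d c x).
    move=> [p [dp [cp Qp]] <-]; split; first by exists p.
    by rewrite /transition cinvK.
  move=> j; split; apply/smooth_onP => k.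
    apply: (Ck_comp (f := fun y => transition c d y 0 j) (g := F) (overlap_open ac ad) oed).
    + by move=> z /ed[].
    + exact: transition_smooth.
    + by move=> l; apply: Ck_sub (sF k l) => z /ed[].
  apply: (Ck_comp (f := fun y => G y 0 j) (g := transition d c) oQ ode).
  + by move=> z /de[].
  + exact: sG.
  + by move=> l; apply: Ck_sub (transition_smooth ad ac k l) => z /de[].
exists e; split=> //.
- move=> z Bz; have [Qz GFz] := GF z Bz; have cz := Qc _ Qz.
  apply/overlapE => //; split=> //; split; first exact: cinv_cdom.
  by rewrite cmapK.
- by move=> x Qx; rewrite /transition /= cmapK//; exact: Qc.
Qed.

Section Field.
Variables (u : chart R n.+1 M -> 'rV[R]_n.+1 -> 'rV[R]_n.+1) (phi mu : M -> R).
Hypothesis uf : vector_field u.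
Hypothesis eqs : forall c, atlas c -> forall x, cimg c x ->
        let u_ := lower (g c) (u c) in
        [/\ \sum_i u c x 0 i * u_ x 0 i = - 1,
            forall k j, nabla (g c) u_ x k j =
              phi (cinv c x) * (u_ x 0 k * u_ x 0 j + g c x k j) &
            forall j, partial j (phi \o cinv c) x = mu (cinv c x) * u_ x 0 j].

Lemma field_smooth c : atlas c -> smooth_map (cimg c) (u c).
Proof. by move=> ac k j; exact: (smooth_onP _ _).1 (uf.1 c ac j) k. Qed.

Lemma christoffel_sym c x l k j : atlas c -> cimg c x ->
  christoffel (g c) x l k j = christoffel (g c) x l j k.
Proof.
move=> ac cx; rewrite /christoffel; congr (_ * _); apply: eq_bigr => m _; congr (_ * _).
rewrite [partial k _ x + _]addrC; congr (_ - _); apply: partial_near.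
apply: (near_open (atlas_open ac) cx) => y cy.
by rewrite -[in RHS](metric_symmetric g ac cy) mxE.
Qed.

(** Antisymmetrising nabla_i u_j kills the Christoffel symbols on one side
    and the right-hand side of the equation on the other. *)
Lemma LCS_closed c x i j : atlas c -> cimg c x ->
  partial i (fun y => lower (g c) (u c) y 0 j) x =
  partial j (fun y => lower (g c) (u c) y 0 i) x.
Proof.
move=> ac cx; have [_ nab _] := eqs ac cx.
have N k l : partial k (fun y => lower (g c) (u c) y 0 l) x =
    nabla (g c) (lower (g c) (u c)) x k l +
    \sum_m christoffel (g c) x m k l * lower (g c) (u c) x 0 m.
  by rewrite /nabla subrK.
have S : g c x i j = g c x j i by rewrite -[in LHS](metric_symmetric g ac cx) mxE.
rewrite !N !nab S; congr (_ * (_ + _) + _); first exact: mulrC.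
by apply: eq_bigr => m _; rewrite christoffel_sym.
Qed.

(** The adapted coordinates of a chart around p; the components of u and of
    its dual follow by the transformation laws. *)
Lemma adapted_chart p : exists (e : chart R n.+1 M) (d : R),
  [/\ 0 < d, atlas e, cdom e p,
    cimg e = tube d [set s : 'rV[R]_n | `|s| < d] &
    forall z, cimg e z -> u e z = e0 /\ lower (g e) (u e) z = - e0].
Proof.
have [c ac cp] := atlas_cover p.
have cx := cimg_cmap cp.
have oc := atlas_open ac.
have som : smooth_map (cimg c) (lower (g c) (u c)).
  by move=> k j; apply: lower_Ck => //; exact: field_smooth.
have [d [F [G [Q [[d0 oQ Qc Qx] [sF sG GF FG HF]]]]]] :=
  adapted_coordinates oc cx (field_smooth ac) som
   (fun x cx => let: And3 h _ _ := eqs ac cx in h) (fun x i j cx => LCS_closed i j ac cx).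
set B := tube d _ in sF sG GF FG HF.
have oB : open B by apply: tube_open; exact: origin_ball_open.
have [e [ae eB ep eo eT]] := change_coordinates ac oB oQ Qc sF sG GF FG.
exists e, d; split=> //; first exact: ep.
rewrite eB => z Bz; have [Qz GFz] := GF z Bz.
have oz := eo z Bz; have Tz : transition c e (F z) = z by rewrite eT.
have Jz : transition_jac c e (F z) = jac G (F z).
  rewrite transition_jacE; apply: jac_near.
  by apply: (near_open oQ Qz) => y; exact: eT.
have FG1 : jac F z *m jac G (F z) = 1%:M.
  rewrite -(jac_comp oQ sG sF Bz Qz) -(jac_id z); apply: jac_near.
  by apply: (near_open oB Bz) => y /GF[].
have [rF omF] := HF z Bz.
have ue : u e z = e0.
  have := uf.2 c e ac ae (F z) oz; rewrite Tz Jz -rF -row_mul FG1 row1 => ->.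
  by rewrite lshift00.
split=> //.
have := @lower_transform R n M g c e (u c) (u e) (F z) ac ae oz (uf.2 c e ac ae (F z) oz).
rewrite Tz Jz => L; rewrite -lshift00 -omF L -mulmxA -trmx_mul FG1 trmx1 mulmx1.
by [].
Qed.

End Field.
End AdaptedChart.

(** * From LCS to GRW *)

Section LorentzSpatial.
Variables (R : realType) (n : nat).

Lemma rest_frame_block (G : 'M[R]_(1 + n)) : G^T = G ->
  (forall j, G (lshift n 0) j = - (j == lshift n 0)%:R) ->
  G = block_mx (- 1)%:M 0 0 (drsubmx G).
Proof.
move=> sG G0; rewrite -[LHS]submxK; congr block_mx; apply/matrixP => i j.
- by rewrite !mxE (ord1 i) (ord1 j) G0 !eqxx.
- by rewrite !mxE (ord1 i) G0 eq_rlshift oppr0.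
- by rewrite !mxE -sG mxE (ord1 j) G0 eq_rlshift oppr0.
Qed.

(** In coordinates that diagonalise G the quadratic form is sig - tau^2, with
    tau linear.  Since e_0 is timelike, tau(e_0) <> 0, and some x = (s, v) has
    tau(x) = 0; as G splits, v S v^T = sig(x) + s^2 > 0. *)
Lemma rest_frame_spatial_pos (G : 'M[R]_(1 + n)) : lorentzian_mx G ->
  (forall j, G (lshift n 0) j = - (j == lshift n 0)%:R) ->
  forall v : 'rV[R]_n, v != 0 -> 0 < (v *m drsubmx G *m v^T) 0 0.
Proof.
move=> [sG [P uP PG]] G0 v v0; have Gb := rest_frame_block sG G0.
pose S := drsubmx G; pose Q := invmx P.
have GQ : G = Q *m block_mx (- 1)%:M 0 0 1%:M *m Q^T.
  by rewrite -PG /Q trmx_inv !mulmxA mulVmx// mul1mx mulmxK// unitmx_tr.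
pose tau (x : 'rV[R]_(1 + n)) := (x *m Q) 0 (lshift n 0).
pose sig (x : 'rV[R]_(1 + n)) := \sum_i ((x *m Q) 0 (rshift 1 i)) ^+ 2.
have form x : (x *m G *m x^T) 0 0 = sig x - tau x ^+ 2.
  rewrite GQ !mulmxA -[_ *m Q^T *m _]mulmxA -trmx_mul /sig /tau.
  move: (x *m Q) => y; rewrite -[y in LHS]hsubmxK mul_row_block !mulmx0 addr0 add0r mulmx1.
  rewrite tr_row_mx mul_row_col mxE addrC; congr (_ + _).
    by rewrite mxE; apply: eq_bigr => i _; rewrite !mxE expr2.
  rewrite mul_mx_scalar -scalemxAl mxE [X in _ * X]mxE big_ord1 !mxE expr2 mulN1r.
  by [].
have form2 (s : R) (w : 'rV[R]_n) : (row_mx s%:M w *m G *m (row_mx s%:M w)^T) 0 0 =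
    - s ^+ 2 + (w *m S *m w^T) 0 0.
  rewrite Gb mul_row_block !mulmx0 addr0 add0r tr_row_mx mul_row_col mxE; congr (_ + _).
  by rewrite mul_mx_scalar -scalemxAl mxE [X in _ * X]mxE big_ord1 !mxE eqxx mulr1n mulN1r expr2.
have alpha0 : tau (row_mx (1 : R)%:M 0) != 0.
  have := form (row_mx (1 : R)%:M 0); rewrite form2 !mul0mx mxE addr0 expr1n => E.
  apply/eqP => t0; move: E; rewrite t0 expr0n subr0 => E.
  have : 0 <= sig (row_mx (1 : R)%:M 0) by apply: sumr_ge0 => i _; exact: sqr_ge0.
  by rewrite -E oppr_ge0 ler10.
(* This s makes tau vanish on the vector (s, v). *)
pose s := - (tau (row_mx 0 v) / tau (row_mx (1 : R)%:M 0)).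
pose x := row_mx s%:M v.
have xE : x = s *: row_mx (1 : R)%:M 0 + row_mx 0 v.
  by rewrite scale_row_mx scaler0 add_row_mx addr0 add0r scale_scalar_mx mulr1.
have tx : tau x = 0.
  rewrite /tau xE mulmxDl -scalemxAl mxE [X in X + _]mxE -/(tau _) -/(tau _) /s.
  by rewrite mulNr divfK// addNr.
have sx : 0 < sig x.
  rewrite lt_def; apply/andP; split; last by apply: sumr_ge0 => i _; exact: sqr_ge0.
  apply/eqP => s0; move/eqP: v0; apply.
  have xQ0 : x *m Q = 0.
    apply/rowP => j; rewrite [RHS]mxE; case: (split_ordP j) => i ->.
      by rewrite (ord1 i).
    apply/eqP; rewrite -sqrf_eq0; apply/eqP.
    apply: (psumr_eq0P (P := xpredT) (F := fun i => ((x *m Q) 0 (rshift 1 i)) ^+ 2)) => // k _.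
    exact: sqr_ge0.
  have x0 : x = 0 by rewrite -(mulmxK (_ : Q \in unitmx) x) ?unitmx_inv// xQ0 mul0mx.
  by have := congr1 rsubmx x0; rewrite row_mxKr linear0.
have := form x; rewrite form2 tx expr0n subr0 => E.
have -> : (v *m S *m v^T) 0 0 = sig x + s ^+ 2 by rewrite -E addrAC addNr add0r.
by rewrite ltr_pwDl// sqr_ge0.
Qed.

End LorentzSpatial.

Section Restriction.
Variables (R : realType) (n : nat).

(** A one-variable function that is the restriction of a smooth function to a
    line of constant space coordinates has its iterated derivatives given by the
    iterated time derivatives. *)
Lemma line_smooth (d : R) (B : set 'rV[R]_n) y k (F : 'rV[R]_(1 + n) -> R) (f : R -> R) :
  open B -> B y -> (forall l, Ck l (tube d B) F) ->
  (forall t : R, `|t| < d -> f t = F (pt t y)) ->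
  forall t : R, `|t| < d -> derivable (derive1n k f) t 1.
Proof.
move=> oB By; elim: k F f => [|k IH] F f cF fF t td.
  have nt : \forall s \near t, `|s : R| < d.
    apply/nbhs_distP; exists (d - `|t|); first by rewrite subr_gt0.
    by move=> s /norm_lt_near; rewrite addrC subrK.
  have dF : derivable F (pt t y) 'e_(lshift n 0).
    by have [_ /(_ (lshift n 0))[H _]] := cF 1%N; apply: H; exact: tube_pt.
  have [H _] := pt_curve_derive dF.
  by apply: near_eq_derivable H; apply: filterS nt => s sd; rewrite /= fF.
rewrite derive1Sn; apply: (IH (partial (lshift n 0) F)) => //.
  by move=> l; have [_ /(_ (lshift n 0))[_]] := cF l.+1.
move=> s sd.
have ns : \forall r \near s, `|r : R| < d.
  apply/nbhs_distP; exists (d - `|s|); first by rewrite subr_gt0.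
  by move=> r /norm_lt_near; rewrite addrC subrK.
have dF : derivable F (pt s y) 'e_(lshift n 0).
  by have [_ /(_ (lshift n 0))[H _]] := cF 1%N; apply: H; exact: tube_pt.
rewrite derive1E (@near_eq_derive _ _ _ _ (fun r => F (pt r y))).
  exact: (@derive_val _ _ _ _ _ _ _ (pt_curve_derive dF)).
by apply: filterS ns => r rd; exact: fF.
Qed.

End Restriction.

Lemma proportional_solutions (R : realType) (d : R) (psi A B : R -> R) :
  (forall t : R, `|t| < d -> is_derive t (1 : R) A (psi t * A t)) ->
  (forall t : R, `|t| < d -> is_derive t (1 : R) B (psi t * B t)) ->
  (forall t : R, `|t| < d -> B t != 0) ->
  forall t : R, `|t| < d -> A t / B t = A 0 / B 0.
Proof.
move=> dA dB B0 t td.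
apply: (@eq_prim R (fun t => A t / B t) (fun=> A 0 / B 0) (fun=> 0) t) => // s st.
have sd := le_lt_trans st td.
have D := is_deriveM (dA s sd) (is_deriveV (B0 s sd) (dB s sd)).
apply: is_derive_eq D _; rewrite /GRing.scale /=.
by have := B0 s sd => h; field.
Qed.

Section LCStoGRW.
Variables (R : realType) (n : nat) (M : manifold R n.+1) (g : lorentz_metric M).
Hypothesis n0 : (0 < n)%N.
Local Notation e0 := ('e_0 : 'rV[R]_n.+1).
Local Notation i1 := (rshift 1 (Ordinal n0) : 'I_n.+1).
Variables (u : chart R n.+1 M -> 'rV[R]_n.+1 -> 'rV[R]_n.+1) (phi mu : M -> R).
Hypothesis phif : scalar_field phi.
Hypothesis eqs : forall c, atlas c -> forall x, cimg c x ->
        let u_ := lower (g c) (u c) in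
        [/\ \sum_i u c x 0 i * u_ x 0 i = - 1,
            forall k j, nabla (g c) u_ x k j =
              phi (cinv c x) * (u_ x 0 k * u_ x 0 j + g c x k j) &
            forall j, partial j (phi \o cinv c) x = mu (cinv c x) * u_ x 0 j].

Section InChart.
Variables (e : chart R n.+1 M) (d : R).
Local Notation ball0 := [set s : 'rV[R]_n | `|s| < d].
Hypotheses (d0 : 0 < d) (ae : atlas e) (eD : cimg e = tube d ball0).
Hypothesis rest : forall z, cimg e z -> u e z = e0 /\ lower (g e) (u e) z = - e0.

Lemma rest_row0 z j : cimg e z -> g e z 0 j = - (j == 0)%:R.
Proof.
move=> ez; have [ue le] := rest ez; move: le; rewrite /lower ue -rowE => /rowP /(_ j).
by rewrite !mxE eqxx.
Qed.

Lemma rest_nabla z k j : cimg e z ->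
  nabla (g e) (lower (g e) (u e)) z k j = 2^-1 * partial 0 (fun y => g e y k j) z.
Proof.
move=> ez; rewrite -(nabla_e0 k j ae ez); last by move=> y i; exact: rest_row0.
by apply: nabla_near => // y ey; rewrite /lower (rest ey).1.
Qed.

(** On the spatial block the equation reads d_t g / 2 = phi g, since the
    lowered field has no spatial components. *)
Lemma expansion z (a b : 'I_n) : cimg e z ->
  partial 0 (fun y => g e y (rshift 1 a) (rshift 1 b)) z =
  2 * phi (cinv e z) * g e z (rshift 1 a) (rshift 1 b).
Proof.
move=> ez; have [_ /(_ (rshift 1 a) (rshift 1 b)) + _] := eqs ae ez.
rewrite rest_nabla// (rest ez).2 !mxE !rshift_neq00 !andbF oppr0 mul0r add0r => E.
by rewrite -mulrA -E mulrA divff ?mul1r// pnatr_eq0.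
Qed.

Lemma rest_pt t y : `|t| < d -> `|y| < d -> cimg e (pt t y).
Proof. by rewrite eD => td yd; exact: tube_pt. Qed.

(** The gradient of phi is a multiple of dt, so phi is constant along the
    segment from (t, 0) to (t, y). *)
Lemma phi_space_cst t y : `|t| < d -> `|y| < d ->
  phi (cinv e (pt t y)) = phi (cinv e (pt t 0)).
Proof.
move=> td yd; pose f := phi \o cinv e.
have fC := (smooth_onP _ _).1 (phif ae) 1%N.
have ptE (s : R) : pt t 0 + (s * 1) *: pt 0 y = pt t (s *: y).
  rewrite /pt mulr1 scale_row_mx add_row_mx add0r; congr row_mx.
  by rewrite [X in _ + _ *: X](_ : _ = 0) ?scaler0 ?addr0// raddf0.
have inD (s : R) : 0 <= s <= 1 -> cimg e (pt t (s *: y)).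
  move=> /andP[s0 s1]; apply: rest_pt => //; rewrite normrZ ger0_norm//.
  by apply: le_lt_trans yd; rewrite ler_piMl.
have D (s : R) : 0 <= s <= 1 -> is_derive (pt t 0 + (s * 1) *: pt 0 y) (pt 0 y : 'rV[R]_n.+1) f 0.
  move=> /inD es; rewrite ptE.
  have dc j : is_derive (pt t (s *: y) : 'rV[R]_n.+1) (pt 0 y : 'rV[R]_n.+1)
      (fun z : 'rV[R]_n.+1 => z 0 j) ((pt 0 y : 'rV[R]_n.+1) 0 j) := is_derive_coord j _ _.
  have := @chain_rule R _ n.+1 (cimg e) f id (pt t (s *: y) : 'rV[R]_n.+1) (pt 0 y : 'rV[R]_n.+1)
    (atlas_open ae) es fC (fun j => @ex_derive _ _ _ _ _ _ _ (dc j)).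
  move=> H; apply: is_derive_eq H _; apply: big1 => j _.
  rewrite (@derive_val _ _ _ _ _ _ _ (dc j)).
  case: (split_ordP (j : 'I_(1 + n))) => b ->.
    by rewrite /pt (@row_mxEl R 1 1 n) mxE mul0rn mulr0.
  have [_ _ /(_ (rshift 1 b))] := eqs ae es; rewrite /f => ->.
  by rewrite (rest es).2 !mxE rshift_neq00 andbF oppr0 mulr0 mul0r.
have [s s01] := @mvt_line R n.+1 f (pt t 0) (pt 0 y) 1 (fun s s01 => @ex_derive _ _ _ _ _ _ _ (D s s01)).
rewrite (@derive_val _ _ _ _ _ _ _ (D s s01)) mulr0.
have -> : pt t 0 + 1 *: pt 0 y = pt t y by rewrite -[1]mulr1 ptE scale1r.
by move=> /eqP; rewrite subr_eq0 => /eqP.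
Qed.

Let S (z : 'rV[R]_n.+1) (a b : 'I_n) : R := g e z (rshift 1 a) (rshift 1 b).

Lemma metric_time_derive (t : R) y a b : `|t| < d -> `|y| < d ->
  is_derive t (1 : R) (fun s => S (pt s y) a b)
    (2 * phi (cinv e (pt t 0)) * S (pt t y) a b).
Proof.
move=> td yd; have ez := rest_pt td yd.
have [_ /(_ 0)[H _]] := metric_Ck g (rshift 1 a) (rshift 1 b) 1 ae.
have H0 := H _ ez; rewrite -(lshift00 n) in H0.
apply: is_derive_eq (pt_curve_derive H0) _.
by rewrite lshift00 expansion// phi_space_cst.
Qed.

Lemma rest_spatial_pos z (v : 'rV[R]_n) : cimg e z -> v != 0 ->
  0 < (v *m drsubmx (g e z : 'M[R]_(1 + n)) *m v^T) 0 0.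
Proof.
move=> ez; apply: rest_frame_spatial_pos; first exact: metric_lorentzian.
by move=> j; rewrite lshift00; exact: rest_row0.
Qed.

Let o := Ordinal n0.

Lemma rest_diag_pos z : cimg e z -> 0 < S z o o.
Proof.
move=> ez; have := @rest_spatial_pos z 'e_o ez.
rewrite -rowE !mxE (bigD1 o)//= big1 => [|j jo]; last by rewrite !mxE (negPf jo) andbF mulr0.
rewrite !mxE !eqxx mulr1 addr0; apply.
apply/eqP => /rowP /(_ o); rewrite !mxE !eqxx /=; apply/eqP.
exact: oner_neq0.
Qed.

(** All entries solve the same scalar linear equation in t, whose
    coefficient 2 phi(t, 0) does not depend on y. *)
Lemma metric_splits (t : R) y a b : `|t| < d -> `|y| < d ->
  S (pt t y) a b = S (pt t 0) o o * (S (pt 0 y) a b / S (pt 0 0) o o).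
Proof.
move=> td yd; have z0 : `|0 : 'rV[R]_n| < d by rewrite normr0.
have Sn (s : R) : `|s| < d -> S (pt s 0) o o != 0.
  by move=> sd; rewrite gt_eqF//; exact: rest_diag_pos (rest_pt sd z0).
have := @proportional_solutions R d (fun t => 2 * phi (cinv e (pt t 0)))
  (fun t => S (pt t y) a b) (fun t => S (pt t 0) o o)
  (fun s sd => metric_time_derive a b sd yd) (fun s sd => metric_time_derive o o sd z0) Sn t td.
by move=> <-; rewrite mulrC divfK// Sn.
Qed.

(** The normalisation q(t)^2 = g_11(t, 0) fixes the scale of h. *)
Lemma adapted_warped : exists q, warped_chart g e q.
Proof.
have z0 : `|0 : 'rV[R]_n| < d by rewrite normr0.
have t0 : `|0 : R| < d by rewrite normr0.
have oB : open ball0 by exact: origin_ball_open.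
(* The warping function is the restriction of F to y = 0. *)
pose F (z : 'rV[R]_(1 + n)) := Num.sqrt (S z o o).
have cF l : Ck l (tube d ball0) F.
  rewrite -eD; apply: (Ck_sqrt (atlas_open ae)); first exact: rest_diag_pos.
  exact: metric_Ck.
exists (fun t => F (pt t 0)), [set t : R | `|t| < d], ball0,
  (fun y => \matrix_(a, b) (S (pt 0 y) a b / S (pt 0 0) o o)).
split.
- split=> //.
    have -> : [set t : R | `|t| < d] = ball (0 : R) d.
      by apply/seteqP; split=> t; rewrite /= -ball_normE /= sub0r normrN.
    exact: ball_open.
  move=> s t /= sd td r /andP[sr rt]; move: sd td; rewrite /= !ltr_norml.
  move=> /andP[s1 _] /andP[_ t2]; apply/andP; split; first exact: lt_le_trans s1 sr.
  exact: le_lt_trans rt t2.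
- by [].
- split=> [t td|k t td]; first by rewrite sqrtr_gt0; exact: rest_diag_pos (rest_pt td z0).
  exact: (@line_smooth R n d ball0 0 k F _ oB z0 cF).
- have c0 := rest_diag_pos (rest_pt t0 z0); split=> [a b|y yd].
    apply/smooth_onP => k.
    apply: (@Ck_eq _ _ _ _ (fun y => S (pt 0 y) a b * (S (pt 0 0) o o)^-1)) => //.
      by move=> y _; rewrite mxE.
    apply: CkM => //; last exact: Ck_cst.
    apply: (Ck_comp (f := fun z : 'rV[R]_n.+1 => S z a b) (g := fun y => pt 0 y : 'rV[R]_n.+1) (atlas_open ae) oB).
    + by move=> y yd; exact: rest_pt.
    + exact: metric_Ck.
    + move=> j; case: (split_ordP (j : 'I_(1 + n))) => i ->.
        apply: (@Ck_eq _ _ _ _ (fun=> 0)) => //; last exact: Ck_cst.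
        by move=> y _; rewrite /pt (@row_mxEl R 1 1 n) mxE mul0rn.
      apply: (@Ck_eq _ _ _ _ (fun y : 'rV[R]_n => y 0 i)) => //; last exact: Ck_coord.
      by move=> y _; rewrite /pt (@row_mxEr R 1 1 n).
  have ey := rest_pt t0 yd.
  have hE : (\matrix_(a, b) (S (pt 0 y) a b / S (pt 0 0) o o)) =
     (S (pt 0 0) o o)^-1 *: drsubmx (g e (pt 0 y) : 'M[R]_(1 + n)).
    by apply/matrixP => a b; rewrite !mxE mulrC.
  split.
    apply/matrixP => a b; rewrite !mxE; congr (_ / _).
    by rewrite /S -[in LHS](metric_symmetric g ae ey) mxE.
  move=> v v0; rewrite hE -scalemxAr -scalemxAl mxE mulr_gt0 ?invr_gt0//.
  exact: rest_spatial_pos.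
move=> z ez; have ez' := ez; rewrite eD in ez'; case: ez' => zt zs.
have G0 : forall j, (g e z : 'M[R]_(1 + n)) (lshift n 0) j = - (j == lshift n 0)%:R.
  by move=> j; rewrite lshift00; exact: rest_row0.
rewrite [LHS](rest_frame_block (metric_symmetric g ae ez) G0); congr block_mx.
apply/matrixP => a b; rewrite /F sqr_sqrtr; last by rewrite ltW//; exact: rest_diag_pos (rest_pt zt z0).
by rewrite [RHS]mxE [X in _ = _ * X]mxE -metric_splits// pt_time_space !mxE.
Qed.

End InChart.
End LCStoGRW.

(** The charts are those in which u = e_0 and the metric is warped, so they
    share d/dt.  If the warping function were constant in a chart around a point
    with phi <> 0, the spatial part of nabla u would vanish there, while it is
    phi times a positive definite matrix. *)
Lemma LCS_GRW (R : realType) (n : nat) (M : manifold R n.+1) (g : lorentz_metric M) :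
  (0 < n)%N -> LCS g -> GRW g.
Proof.
move=> n0 [u [phi [mu [uf phif _ [p0 phi0] eqs]]]].
pose W := [set e : chart R n.+1 M | [/\ atlas e, 
  forall z, cimg e z -> u e z = delta_mx 0 0 & exists q, warped_chart g e q]].
have cover p : exists2 c, W c & cdom c p.
  have [e [d [d0 ae ep eD rest]]] := adapted_chart uf eqs p.
  exists e => //; split=> //; first by move=> z /rest[].
  exact: (adapted_warped n0 phif eqs d0 ae eD rest).
(* The warping function of each chart is chosen; it is arbitrary off W. *)
pose q e := get (fun q => warped_chart g e q).
have Wq e : W e -> warped_chart g e (q e) by case=> _ _; exact: getPex.
exists W, q; split=> //.
- by move=> e [].
- move=> c d [ac uc _] [ad ud _] x ox.
  have := uf.2 c d ac ad x ox; rewrite uc; last exact: overlap_cimg ox.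
  by rewrite ud ?rowE//; exact: transition_cimg.
have [c Wc cp] := cover p0; exists c; split=> //; have [ac uc _] := Wc.
apply: contrapT => H; pose x := cmap c p0.
have cx : cimg c x by exists p0.
have qc y : cimg c y -> q c (time_coord (y : 'rV[R]_(1 + n))) = q c (time_coord (x : 'rV[R]_(1 + n))).
  move=> cy; apply/eqP; apply: contrapT => /negP h; apply: H; by exists y, x.
have wc := Wq c Wc.
have q'0 : derive1 (q c) (time_coord (x : 'rV[R]_(1 + n))) = 0.
  case: (wc) => I [V [h [[oI _ _] E _ _ _]]].
  have [It Vs] : I (time_coord (x : 'rV[R]_(1 + n))) /\ V (space_coord (x : 'rV[R]_(1 + n))).
    by move: cx; rewrite E.
  rewrite derive1E (@near_eq_derive _ _ _ _ (fun=> q c (time_coord (x : 'rV[R]_(1 + n))))) ?derive_cst//.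
  apply: (near_open oI It) => t It'.
  have := qc (pt t (space_coord (x : 'rV[R]_(1 + n)))); rewrite time_pt; apply.
  by rewrite E /= time_pt space_pt.
have := warped_nabla ac wc (rshift 1 (Ordinal n0)) (rshift 1 (Ordinal n0)) cx.
cbv zeta; rewrite q'0 !mul0r.
have -> : nabla (g c) (lower (g c) (fun=> delta_mx 0 0)) x (rshift 1 (Ordinal n0)) (rshift 1 (Ordinal n0)) =
   nabla (g c) (lower (g c) (u c)) x (rshift 1 (Ordinal n0)) (rshift 1 (Ordinal n0)).
  by apply: nabla_near => // y cy; rewrite /lower uc.
have [_ -> _] := eqs c ac x cx.
have -> : lower (g c) (u c) x = - delta_mx 0 0.
  by rewrite -(warped_lower wc cx) /lower uc.
rewrite cinvK// !mxE rshift_neq00 andbF oppr0 mul0r add0r => /eqP.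
by rewrite mulf_eq0 (negPf phi0) (gt_eqF (warped_diag_pos wc _ cx)).
Qed.

Theorem mainTheorem1 (R : realType) (n : nat) (hn : (3 < n.+1)%N)
    (M : manifold R n.+1) (g : lorentz_metric M) :
  LCS g <-> GRW g.
Proof.
have n0 : (0 < n)%N := ltn_trans (ltn0Sn 1) hn.
by split; [exact: LCS_GRW|exact: GRW_LCS].
Qed.
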